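(* Let $E\subset\mathbb{R}^d$ be an open bounded set and let $\Lambda=\{\lambda_k\}_{k\in K}$ ($K$ countable) be a separated sequence in $\mathbb{R}^d$ such that the exponentials $\{e_{\lambda_k}\}_{k\in K}$ form a frame of $L^2(E)$. Then there exist a separated sequence $\Lambda'=\{\lambda'_k\}_{k\in K'}$ ($K'$ countable) in $\mathbb{R}^d$ containing $\Lambda$, and a function $g$ of the Schwartz class on $\mathbb{R}^d$ with $\hat g$ compactly supported, such that each function $f\in P_E$ has an expansion $$f(x)=\sum_{k\in K'}\alpha_k\,g(x-\lambda'_k),$$ where the coefficient sequence $\{\alpha_k\}_{k\in K'}$ is in $\ell^2(K')$ and the series converges uniformly, unconditionally and in $L^2(\mathbb{R}^d)$.
   Context: A set (sequence) $\Lambda\subset\mathbb{R}^d$ is separated if $\inf_{\lambda\ne\lambda'}\|\lambda-\lambda'\|>0$. $e_\lambda(x)=e^{-2\pi i\lambda\cdot x}$; ''$\{e_{\lambda_k}\}$ is a frame of $L^2(E)$'' means that $\{e_{\lambda_k}\chi_E\}_{k\in K}$ is. A sequence $\{\psi_k\}$ in a separable Hilbert space $\mathcal{H}$ is a frame for $\mathcal{H}$ if there are constants $A,B>0$ with $A\|f\|^2\le\sum_k|\langle f,\psi_k\rangle|^2\le B\|f\|^2$ for all $f\in\mathcal{H}$. The Fourier transform is $\hat f(\omega)=\int_{\mathbb{R}^d}f(x)e^{-2\pi i\omega\cdot x}\,dx$, extended to $L^2(\mathbb{R}^d)$. $P_E=\{f\in L^2(\mathbb{R}^d):\operatorname{supp}\hat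 f\subseteq E\}$, with the support understood up to null sets, i.e. $\hat f=0$ a.e. outside $E$. *)

(* Defs.v *)
From HB Require Import structures.
From mathcomp Require Import all_boot all_order all_algebra.
From mathcomp Require Import finmap.
From mathcomp Require Import all_classical all_reals all_analysis.
From mathcomp Require Import summability.
From mathcomp Require Import complex.

Set Implicit Arguments.
Unset Strict Implicit.
Unset Printing Implicit Defensive.
Import Order.TTheory GRing.Theory Num.Theory.
Import numFieldNormedType.Exports.

Local Open Scope classical_set_scope.
Local Open Scope ring_scope.

(* The library has no measurable structure on row vectors and no Lebesgue
   measure beyond dimension 1.  'rV_n gets the sigma-algebra generated by its
   coordinates (the Borel sets, when the coefficients are real). *)

Definition rV_display : measure_display -> measure_display.
Proof. exact. Qed.

Section measurable_rV.
Context {d : measure_display} {T : measurableType d}.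
Variable n : nat.

Let coords : 'I_n -> 'rV[T]_n -> T := fun i x => x ord0 i.

Let rV_set0 : g_sigma_preimage coords set0.
Proof. exact: sigma_algebra0. Qed.

Let rV_setC A : g_sigma_preimage coords A -> g_sigma_preimage coords (~` A).
Proof. exact: sigma_algebraC. Qed.

Let rV_bigcup (F : (set 'rV[T]_n)^nat) :
  (forall i, g_sigma_preimage coords (F i)) ->
  g_sigma_preimage coords (\bigcup_i (F i)).
Proof. exact: sigma_algebra_bigcup. Qed.

HB.instance Definition _ := @isMeasurable.Build (rV_display d)
  'rV[T]_n (g_sigma_preimage coords) rV_set0 rV_setC rV_bigcup.

End measurable_rV.

Lemma measurable_coord d (T : measurableType d) n (i : 'I_n) :
  measurable_fun [set: 'rV[T]_n] (fun x => x ord0 i).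
Proof.
move=> _ Y mY; rewrite setTI; apply: sub_sigma_algebra => /=.
rewrite -bigcup_seq/=; exists i => /=; first by rewrite mem_index_enum.
by exists Y => //; rewrite setTI.
Qed.

Lemma measurable_fun_rV d1 d2 (T1 : measurableType d1) (T2 : measurableType d2)
    n (f : T1 -> 'rV[T2]_n) :
  (forall i, measurable_fun [set: T1] (fun x => f x ord0 i)) ->
  measurable_fun [set: T1] f.
Proof.
move=> mf _ Y; apply: (@smallest_sub _ _ _ [set Y | measurable (setT `&` f @^-1` Y)]).
  split => [|A|F].
  - by rewrite /= preimage_set0 setI0.
  - by rewrite /= setTD !setTI preimage_setC => mA; apply: measurableC.
  - rewrite /= => mF; rewrite setTI preimage_bigcup.
    by apply: bigcup_measurable => k _; have := mF k; rewrite setTI.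
move=> {Y}; case: n => [|n] in f mf *; first by rewrite big_ord0.
rewrite -bigcup_mkord_ord; apply: bigcup_sub => i Ii A [B mB <-] /=.
rewrite [X in _ `&` _ @^-1` X]setTI.
exact: mf.
Qed.

Section lebesgue_rV.
Variable R : realType.

Section cons_rV.
Variable d : nat.

Definition cons_rV (p : measurableTypeR R * 'rV[R]_d) :
    'rV[R]_d.+1 :=
  row_mx (const_mx p.1 : 'rV_1) p.2.

Definition uncons_rV (x : 'rV[R]_d.+1) :
    measurableTypeR R * 'rV[R]_d :=
  (x ord0 ord0, \row_i x ord0 (lift ord0 i)).

Lemma cons_rVK : cancel cons_rV uncons_rV.
Proof.
case=> a y; rewrite /uncons_rV /cons_rV; congr pair.
  by rewrite mxE; case: splitP => j //= _; rewrite mxE.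
apply/rowP => i; rewrite !mxE; case: splitP => j /=.
  by rewrite /bump /= add1n => ij; have := ltn_ord j; rewrite -ij.
by rewrite /bump /= !add1n => -[ij]; congr (y _ _); apply/val_inj.
Qed.

Lemma measurable_cons_rV : measurable_fun setT cons_rV.
Proof.
apply: measurable_fun_rV => i; rewrite /cons_rV.
have [j|j] := splitP (i : 'I_(1 + d)) => ij.
  apply: (eq_measurable_fun fst) => [x _|]; last exact: measurable_fst.
  rewrite mxE; case: splitP => k //= ik; first by rewrite mxE.
  by have := ltn_ord j; rewrite -ij ik.
apply: (eq_measurable_fun ((fun y : 'rV[R]_d => y ord0 j) \o snd)) => [x _|].
  rewrite mxE; case: splitP => k /= ik.
    by have := ltn_ord k; rewrite -ik ij.
  by congr (x.2 _ _); apply/val_inj/eqP; rewrite -(eqn_add2l 1) -ij ik.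
by apply: measurableT_comp; [exact: measurable_coord|exact: measurable_snd].
Qed.

Lemma measurable_uncons_rV : measurable_fun setT uncons_rV.
Proof.
apply: measurable_fun_pair; first exact: measurable_coord.
apply: measurable_fun_rV => i.
apply: (eq_measurable_fun (fun x : 'rV[R]_d.+1 => x ord0 (lift ord0 i))).
  by move=> x _; rewrite mxE.
exact: measurable_coord.
Qed.

End cons_rV.

HB.instance Definition _ d :=
  isMeasurableFun.Build _ _ _ _ (@cons_rV d) (@measurable_cons_rV d).

Section cons_measure.
Variables (d : nat)
  (mu : {sigma_finite_measure set 'rV[R]_d -> \bar R}).

Definition cons_measure : set 'rV[R]_d.+1 -> \bar R :=
  pushforward (@lebesgue_measure R \x mu)%E (@cons_rV d).

Let cons_measure0 : cons_measure set0 = 0%E.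
Proof. exact: measure0. Qed.

Let cons_measure_ge0 A : (0 <= cons_measure A)%E.
Proof. by apply: (measure_ge0 (pushforward _ _)); exact: measurable_cons_rV. Qed.

Let cons_measure_sigma_additive : semi_sigma_additive cons_measure.
Proof.
apply: (@measure_semi_sigma_additive _ _ _ (pushforward _ _)).
exact: measurable_cons_rV.
Qed.

HB.instance Definition _ := isMeasure.Build _ _ _ cons_measure
  cons_measure0 cons_measure_ge0 cons_measure_sigma_additive.

Let cons_measure_sigma_finite : sigma_finite setT cons_measure.
Proof.
have /sigma_finiteP[F [TF ndF Foo]] := sigma_finiteT (@lebesgue_measure R).
have /sigma_finiteP[G [TG ndG Goo]] := sigma_finiteT mu.
exists (fun n => @uncons_rV d @^-1` (F n `*` G n)).
  rewrite predeqE => x; split => // _.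
  have [n _ Fn] : (\bigcup_n F n) (uncons_rV x).1 by rewrite -TF.
  have [k _ Gk] : (\bigcup_n G n) (uncons_rV x).2 by rewrite -TG.
  exists (maxn n k) => //; split.
    by move: Fn; exact/subsetPset/ndF/leq_maxl.
  by move: Gk; exact/subsetPset/ndG/leq_maxr.
move=> k; have [mF Fk] := Foo k; have [mG Gk] := Goo k; split.
  rewrite -[X in measurable X]setTI; apply: measurable_uncons_rV => //.
  exact: measurableX.
rewrite /cons_measure /pushforward -comp_preimage.
rewrite (_ : _ \o _ = id); last by apply/funext => x; exact: cons_rVK.
rewrite preimage_id product_measure1E//.
by rewrite lte_mul_pinfty// ge0_fin_numE.
Qed.

HB.instance Definition _ :=
  Measure_isSigmaFinite.Build _ _ _ cons_measure cons_measure_sigma_finite.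

End cons_measure.

(* Lebesgue measure on R^d: the d-fold product of the one on R. *)
Fixpoint lebesgue_rV (d : nat) :
    {sigma_finite_measure set 'rV[R]_d -> \bar R} :=
  match d with
  | 0 => @dirac _ 'rV[R]_0 0 R
  | d'.+1 => cons_measure (lebesgue_rV d')
  end.

End lebesgue_rV.

Section euclidean.
Variables (R : realType) (d : nat).
Implicit Types x y : 'rV[R]_d.

Definition dotr x y : R := \sum_i x ord0 i * y ord0 i.

(* The norm `|x| of the library is the sup norm. *)
Definition enorm x : R := Num.sqrt (dotr x x).

Definition separated_seq (K : Type) (lam : K -> 'rV[R]_d) :=
  (0 < ereal_inf [set (enorm (lam kl.1 - lam kl.2))%:E |
                    kl in [set kl : K * K | kl.1 <> kl.2]])%E.

End euclidean.

Section complex_functions.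
Variables (R : realType) (d : nat).
Local Notation V := ('rV[R]_d).
Local Notation C := (R[i]).
Local Notation mu := (lebesgue_rV R d).
Implicit Types (D E : set V) (f g h : V -> C).

Definition absc (z : C) : R := Normc.normc z.

Definition cmeasurable D f :=
  measurable_fun D (fun x => complex.Re (f x)) /\
  measurable_fun D (fun x => complex.Im (f x)).

Definition cintegrable D f :=
  mu.-integrable D (fun x => (complex.Re (f x))%:E) /\
  mu.-integrable D (fun x => (complex.Im (f x))%:E).

Definition cintegral D f : C :=
  ((\int[mu]_(x in D) complex.Re (f x)) +i*
   (\int[mu]_(x in D) complex.Im (f x)))%C.

Definition sqnormL2 D f : \bar R := (\int[mu]_(x in D) (absc (f x) ^+ 2)%:E)%E.

Definition L2 D f := cmeasurable D f /\ (sqnormL2 D f < +oo)%E.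

Definition innerL2 D f g : C := cintegral D (fun x => f x * (g x)^*%C).

(* The index set carries no order; since the terms are nonnegative,
   [\esum] is the sum of the series. *)
Definition frameL2 (K : countType) D (psi : K -> V -> C) :=
  (forall k, L2 D (psi k)) /\
  exists A B : R, [/\ 0 < A, 0 < B & forall f, L2 D f ->
    (A%:E * sqnormL2 D f <=
       \esum_(k in [set: K]) (absc (innerL2 D f (psi k)) ^+ 2)%:E /\
     \esum_(k in [set: K]) (absc (innerL2 D f (psi k)) ^+ 2)%:E <=
       B%:E * sqnormL2 D f)%E].

(* e_lam(x) = exp(- 2 pi i lam . x) *)
Definition expo (lam x : V) : C :=
  let t := 2 * pi * dotr lam x in (cos t -i* sin t)%C.

Definition indicc E (x : V) : C := ((\1_E x : R)%:C)%C.

Definition fourier f (w : V) : C := cintegral setT (fun x => f x * expo w x).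

(* [h] is the Fourier transform of the L^2 function [f]: the extension by
   continuity of [fourier] from the dense subspace L^1 /\ L^2. *)
Definition fourierL2 f h :=
  [/\ L2 setT f, L2 setT h &
  exists u : nat -> V -> C,
    [/\ forall n, cintegrable setT (u n) /\ L2 setT (u n),
        (fun n => sqnormL2 setT (fun x => u n x - f x)) @ \oo --> 0%E &
        (fun n => sqnormL2 setT (fun w => fourier (u n) w - h w)) @ \oo
          --> 0%E]].

(* P_E; the spectrum lies in [E] up to a null set. *)
Definition bandlimited E f :=
  exists2 h, fourierL2 f h & {ae mu, forall w, ~ E w -> h w = 0}.

Definition partial_deriv (i : 'I_d) (f : V -> R) (x : V) : R :=
  'D_(delta_mx ord0 i) f x.

Definition iter_partial (s : seq 'I_d) (f : V -> R) : V -> R :=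
  foldr partial_deriv f s.

Definition smooth (f : V -> R) := forall s : seq 'I_d,
  continuous (iter_partial s f) /\
  forall (x : V) i, derivable (iter_partial s f) x (delta_mx ord0 i).

Definition rapidly_decreasing (f : V -> R) :=
  forall (b : 'I_d -> nat) (s : seq 'I_d), exists M : R,
    forall x : V, `|(\prod_i x ord0 i ^+ b i) * iter_partial s f x| <= M.

Definition schwartz g :=
  [/\ smooth (fun x => complex.Re (g x)), smooth (fun x => complex.Im (g x)),
      rapidly_decreasing (fun x => complex.Re (g x)) &
      rapidly_decreasing (fun x => complex.Im (g x))].

Definition csupport f : set V := closure [set x | f x <> 0].

Definition ell2 (K : countType) (a : K -> C) :=
  (\esum_(k in [set: K]) (absc (a k) ^+ 2)%:E < +oo)%E.

(* Unconditional convergence is convergence of the net of partial sums over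
   the finite subsets of the index set. *)
Definition uncond_unif_cvg (K : countType) (phi : K -> V -> C) f :=
  forall e : R, 0 < e -> \forall F \near @totally K,
    forall x, absc (f x - partial_sum (phi ^~ x) F) <= e.

Definition uncond_L2_cvg (K : countType) (phi : K -> V -> C) f :=
  (fun F : {fset K} => sqnormL2 setT (fun x => f x - partial_sum (phi ^~ x) F))
    @ @totally K --> 0%E.

End complex_functions.

(* Main.v *)
(* Fix r with E inside the box |w_i| <= r, let g be the inverse Fourier transform of a smooth
   bump equal to 1 on that box, and let G be the analogous function for 2r.  Sampling on a fine
   lattice eZ^d gives g(x - y) = sum_k e^d G(ek - y) g(x - ek), and f = f * g for band-limited f,
   hence f = sum_k c_k g(x - ek) with c_k = e^d (f * G)(ek) in l^2.

   Adjoining the whole lattice to Lambda could destroy separation, so the lattice points n close to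
   Lambda ("bad" points) have to be avoided.  If n is bad then its neighbour n + e_1 is not, and
   g(x - en) - g(x - e(n + e_1)) = sum_k N_kn g(x - ek), where N has l^2-norm at most 1/2 for small e
   because G varies little over a distance e.  Moving the coefficient of every bad point to its
   neighbour thus leaves an error with coefficients N c, and a Neumann series produces coefficients
   supported on the good points.  The points of Lambda get the coefficient 0. *)
From HB Require Import structures.
Require Import Defs.
From mathcomp Require Import all_boot all_order all_algebra.
From mathcomp Require Import finmap.
From mathcomp Require Import all_classical all_reals all_analysis.
From mathcomp Require Import summability.
From mathcomp Require Import complex.
From mathcomp Require Import ring lra zify.
From mathcomp Require Import measurable_realfun.

Set Implicit Arguments.
Unset Strict Implicit.
Unset Printing Implicit Defensive.
Import Order.TTheory GRing.Theory Num.Theory.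
Import numFieldNormedType.Exports.

Local Open Scope classical_set_scope.
Local Open Scope ring_scope.

(** * Smooth functions and a plateau function *)

(** Neither Plancherel's theorem nor Poisson summation is invoked. The Fourier identities rest on
    the convergence of Dirichlet integrals: it gives the sampling series of [gs] on the line,
    averaging that series over one lattice cell gives Fourier inversion for [gs], and products over
    the coordinates carry both to R^d. The plateau at 2r is 1 on the whole support of the plateau at
    r; this is why samples of f * G reproduce f * g.

    The identity f = f * g is the delicate one, since f is only an L^2 function. Band-limitation
    shows that f * g_s is the same function for all s >= r; letting s tend to infinity in its
    integrals over boxes recovers f almost everywhere. The series is summed pointwise to f * g,
    which is defined everywhere.

    A lattice point is bad when some point of Lambda is within e/4 of it in every coordinate. As e/4
    is less than half a step, one point of Lambda cannot spoil two neighbours, and for small e two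
    distinct points of Lambda are too far apart to do so. The bound 1/2 holds for the absolute row
    and column sums of N, and Schur's test turns it into an operator bound. *)

Section smooth_functions.
Variable R : realType.
Implicit Types (u v f : R -> R) (n : nat) (x y a : R).

(** The derivative is an existential witness: the closure lemmas below supply it in closed form and
    never have to compute an iterated [derive1]. *)
Fixpoint kdiff n u : Prop :=
  if n is n'.+1 then
    exists2 v, (forall x, is_derive x (1 : R) u (v x)) & kdiff n' v
  else True.

Definition cinfty u := forall n, kdiff n u.

Lemma kdiff_eq n u v : u =1 v -> kdiff n u -> kdiff n v.
Proof. by move=> /funext ->. Qed.

Lemma kdiffS n u : kdiff n.+1 u -> kdiff n u.
Proof.
elim: n u => [//|n IH] u [v uv kv]; exists v => //.
exact: IH.
Qed.

Lemma kdiffD n u v : kdiff n u -> kdiff n v -> kdiff n (fun x => u x + v x).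
Proof.
elim: n u v => [//|n IH] u v [u' uu' ku'] [v' vv' kv'].
by exists (fun x => u' x + v' x); [move=> x; exact: is_deriveD|exact: IH].
Qed.

Lemma kdiff_cst n a : kdiff n (fun=> a).
Proof.
by elim: n a => [//|n IH] a; exists (fun=> 0); [move=> x; exact: is_derive_cst|].
Qed.

Lemma kdiffM n u v : kdiff n u -> kdiff n v -> kdiff n (fun x => u x * v x).
Proof.
elim: n u v => [//|n IH] u v ku kv.
have [u' uu' ku'] := ku; have [v' vv' kv'] := kv.
exists (fun x => u' x * v x + u x * v' x).
  move=> x; apply: (is_derive_eq (is_deriveM _ _)).
  by rewrite /GRing.scale/=; ring.
by apply: kdiffD; apply: IH => //; exact: kdiffS.
Qed.

Lemma kdiffZ n a u : kdiff n u -> kdiff n (fun x => a * u x).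
Proof. by apply: kdiffM; exact: kdiff_cst. Qed.

Lemma kdiff_affine n a b u : kdiff n u -> kdiff n (fun x => u (a * x + b)).
Proof.
elim: n u => [//|n IH] u [u' uu' ku'].
exists (fun x => a * u' (a * x + b)); last exact/kdiffZ/IH.
move=> x.
have h : is_derive x (1 : R) (fun x => a * x + b) a.
  apply: (is_derive_eq (is_deriveD _ _)).
  by rewrite /GRing.scale/= mulr1 addr0.
apply: (is_derive_eq (is_derive1_comp _ h)).
by rewrite mulrC.
Qed.

(** Induction on the order with [u] fixed: the derivative is -(1/u)(1/u)u', and the induction
    hypothesis covers both factors 1/u. *)
Lemma kdiffV n u : (forall x, u x != 0) -> kdiff n u ->
  kdiff n (fun x => (u x)^-1).
Proof.
move=> u0; elim: n => [//|n IH] ku; have [u' uu' ku'] := ku.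
exists (fun x => - 1 * ((u x)^-1 * ((u x)^-1 * u' x))).
  move=> x; apply: (is_derive_eq (is_deriveV _ _)) => //.
  by rewrite /GRing.scale/= -exprVn; ring.
apply/kdiffZ/kdiffM; first exact/IH/kdiffS.
by apply/kdiffM => //; exact/IH/kdiffS.
Qed.

Lemma kdiff_id n : kdiff n (fun x => x).
Proof.
case: n => [//|n]; exists (fun=> 1); [move=> x; exact: is_derive_id|].
exact: kdiff_cst.
Qed.

Lemma cinfty_derive u : cinfty u ->
  (forall x, is_derive x (1 : R) u (u^`()%classic x)) /\ cinfty u^`()%classic.
Proof.
move=> cu.
have E v : (forall x, is_derive x (1 : R) u (v x)) -> v = u^`()%classic.
  by move=> uv; apply/funext => x; rewrite derive1E derive_val.
split=> [x|n]; first by have [v uv _] := cu 1%N; rewrite -(E _ uv).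
by have [v uv kv] := cu n.+1; rewrite -(E _ uv).
Qed.

Lemma cinfty_continuous u : cinfty u -> continuous u.
Proof.
move=> cu x; apply/differentiable_continuous/derivable1_diffP.
by have [/(_ x)[]] := cinfty_derive cu.
Qed.

End smooth_functions.

(** * A smooth step built from exp(-1/x) *)

Section plateau.
Variable R : realType.
Implicit Types (n : nat) (x y a : R).

(** The extra power of x closes the family under differentiation, up to linear combinations, so that
    smoothness of exp(-1/x) extended by 0 is a single induction. *)
Definition expinv n x : R := if 0 < x then x ^- n * expR (- x^-1) else 0.

(** Keep only the term of order n + 2 in the series of exp(1/x). The quadratic bound is what makes
    the derivative at 0 vanish. *)
Lemma expinv_le n x : `|expinv n x| <= n.+2`!%:R * x ^+ 2.
Proof.
rewrite /expinv; case: ifPn => [x0|_]; last by rewrite normr0 mulr_ge0 ?sqr_ge0 ?ler0n.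
have f0 : 0 < n.+2`!%:R :> R by rewrite ltr0n fact_gt0.
rewrite ger0_norm ?mulr_ge0 ?expR_ge0 ?invr_ge0 ?exprn_ge0 ?(ltW x0)//.
have := @expR_ge1Dxn _ x^-1 n.+1 (ltW _); rewrite invr_gt0 => /(_ x0) h.
have {}h : x ^- n.+2 / n.+2`!%:R <= expR x^-1.
  by rewrite -exprVn (le_trans _ h)// lerDr.
rewrite expRN -invfM -[leRHS]invrK lef_pV2 ?posrE; last 2 first.
- by rewrite mulr_gt0 ?expR_gt0 ?exprn_gt0.
- by rewrite invr_gt0 mulr_gt0 ?exprn_gt0.
apply: (@le_trans _ _ (x ^+ n * (x ^- n.+2 / n.+2`!%:R))); last first.
  by rewrite ler_wpM2l// exprn_ge0 ?ltW.
rewrite -addn2 exprD !invfM; set k := _%:R^-1.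
by rewrite [leRHS]mulrA [X in _ <= X * _]mulrA divff ?expf_neq0 ?gt_eqF// mul1r mulrC.
Qed.

Lemma is_derive_expinv n x :
  is_derive x (1 : R) (expinv n) (expinv n.+2 x - n%:R * expinv n.+1 x).
Proof.
have [x0|x0|->] := ltgtP x 0.
- have -> : expinv n.+2 x - n%:R * expinv n.+1 x = 0.
    by rewrite /expinv ltNge (ltW x0)/= mulr0 subr0.
  apply: (@near_eq_is_derive _ _ _ (cst 0) (expinv n)) => //.
    near=> y; rewrite /expinv ltNge ltW//=; near: y; exact: lt_nbhsl.
- pose f (x : R) := x^-1 ^+ n * expR (- x^-1).
  have dV : is_derive x (1 : R) (fun y : R => y^-1) (- x ^- 2).
    have := @is_deriveV _ id x 1 1 (lt0r_neq0 x0) _.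
    by rewrite /GRing.scale/= mulr1; exact.
  have df : is_derive x (1 : R) f (expinv n.+2 x - n%:R * expinv n.+1 x).
    have d1 := is_deriveX n dV.
    have d2 := @is_derive1_comp _ expR (fun y : R => - y^-1) x _ _ (is_derive_expR _) (is_deriveN dV).
    have -> : f = (fun y : R => y^-1) ^+ n * (expR \o (fun y : R => - y^-1)).
      by apply/funext => y; rewrite /f !fctE.
    apply: (is_derive_eq (is_deriveM d1 d2)).
    rewrite /expinv x0 /GRing.scale/= !fctE -!exprVn.
    set E := expR _; set k := x^-1; case: n {f d1 d2} => [|n] /=; first by ring.
    by rewrite !exprS; ring.
  apply: near_eq_is_derive df => //.
  near=> y; rewrite /f /expinv.
  rewrite ifT ?exprVn//; near: y; exact: lt_nbhsr.
- rewrite /expinv ltxx mulr0 subr0.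
  have h : (h^-1 *: (expinv n (h *: (1:R) + 0) - expinv n 0)) @[h --> 0^'] --> (0 : R).
    apply/cvgrPdist_le => e e0; near=> h.
    rewrite sub0r normrN {2}/expinv ltxx subr0 addr0 /GRing.scale/= mulr1.
    rewrite normrM normfV ler_pdivrMl ?normr_gt0; last by near: h; exact: nbhs_dnbhs_neq.
    apply: (le_trans (expinv_le _ _)).
    rewrite -(real_normK (num_real h)) expr2 mulrC -mulrA ler_wpM2l//.
    rewrite -ler_pdivlMr ?ltr0n ?fact_gt0//.
    near: h; apply: dnbhs0_le; by rewrite divr_gt0 ?ltr0n ?fact_gt0.
  split; first by apply/cvg_ex; exists 0.
  exact/cvg_lim.
Unshelve. all: end_near. Qed.

Lemma cinfty_expinv n : cinfty (expinv n).
Proof.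
move=> k; elim: k n => [//|k IH] n.
exists (fun x => expinv n.+2 x + (- n%:R) * expinv n.+1 x).
  by move=> x; rewrite mulNr; exact: is_derive_expinv.
by apply: kdiffD => //; exact: kdiffZ.
Qed.

(** The second argument is 1 - x, in the affine form of [kdiff_affine]. Since x and 1 - x are never
    both nonpositive, the sum never vanishes. *)
Let den x := expinv 0 x + expinv 0 (- 1 * x + 1).

Lemma expinv0_ge0 x : 0 <= expinv 0 x.
Proof. by rewrite /expinv; case: ifP; rewrite // invr1 mul1r expR_ge0. Qed.

Let expinv0_gt0 x : 0 < x -> 0 < expinv 0 x.
Proof. by move=> x0; rewrite /expinv x0 invr1 mul1r expR_gt0. Qed.

Let den_gt0 x : 0 < den x.
Proof.
rewrite /den; have [x0|x0] := ltP 0 x.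
  by rewrite ltr_pwDl ?expinv0_gt0 ?expinv0_ge0.
rewrite ltr_wpDl ?expinv0_ge0// expinv0_gt0//; lra.
Qed.

Definition smooth_step x := expinv 0 x / den x.

Lemma cinfty_smooth_step : cinfty smooth_step.
Proof.
move=> n; apply: kdiffM; first exact: cinfty_expinv.
apply: kdiffV => [x|]; first by rewrite gt_eqF.
apply: kdiffD; first exact: cinfty_expinv.
exact/kdiff_affine/cinfty_expinv.
Qed.

Lemma smooth_step0 x : x <= 0 -> smooth_step x = 0.
Proof. by move=> x0; rewrite /smooth_step /expinv ltNge x0 mul0r. Qed.

Lemma smooth_step1 x : 1 <= x -> smooth_step x = 1.
Proof.
move=> x1; rewrite /smooth_step.
rewrite (_ : den x = expinv 0 x) ?divff//.
  by rewrite gt_eqF// expinv0_gt0// (lt_le_trans _ x1).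
rewrite /den [X in _ + X]/expinv ifF ?addr0//.
by apply/negbTE; rewrite -leNgt; lra.
Qed.

Definition plateau x := smooth_step (2 + x) * smooth_step (2 - x).

Lemma plateauN x : plateau (- x) = plateau x.
Proof. by rewrite /plateau opprK mulrC. Qed.

Lemma plateau1 x : `|x| <= 1 -> plateau x = 1.
Proof.
rewrite ler_norml => /andP[x1 x2].
by rewrite /plateau !smooth_step1 ?mulr1//; lra.
Qed.

Lemma plateau0 x : 2 <= `|x| -> plateau x = 0.
Proof.
rewrite /plateau ler_normr => /orP[x2|x2].
  by rewrite (@smooth_step0 (2 - x)) ?mulr0//; lra.
by rewrite smooth_step0 ?mul0r//; lra.
Qed.

Lemma cinfty_plateau : cinfty plateau.
Proof.
move=> n; apply: kdiffM.
  apply: (@kdiff_eq _ _ (fun x => smooth_step (1 * x + 2))).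
    by move=> x; rewrite mul1r addrC.
  exact/kdiff_affine/cinfty_smooth_step.
apply: (@kdiff_eq _ _ (fun x => smooth_step ((- 1) * x + 2))).
  by move=> x; rewrite mulN1r addrC.
exact/kdiff_affine/cinfty_smooth_step.
Qed.

End plateau.

(** * Integrals over intervals and Fourier transforms of bumps *)

Section interval_integrals.
Variable R : realType.
Local Notation mu := (@lebesgue_measure R).
Implicit Types (u v f g F : R -> R) (n : nat) (x y a b c e : R).

Lemma contD f g : continuous f -> continuous g -> continuous (fun x => f x + g x).
Proof. by move=> cf cg x; apply: continuousD; [exact: cf|exact: cg]. Qed.

Lemma contN f : continuous f -> continuous (fun x => - f x).
Proof. by move=> cf x; apply: continuousN; exact: cf. Qed.

Lemma contM f g : continuous f -> continuous g -> continuous (fun x => f x * g x).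
Proof. by move=> cf cg x; apply: continuousM; [exact: cf|exact: cg]. Qed.

Lemma cont_cst c : continuous (fun _ : R => c).
Proof. by move=> x; exact: cst_continuous. Qed.

Lemma cont_id : continuous (fun x : R => x).
Proof. by move=> x. Qed.

Lemma cont_comp f g : continuous f -> continuous g -> continuous (fun x => f (g x)).
Proof. by move=> cf cg x; apply: continuous_comp; [exact: cg|exact: cf]. Qed.

Lemma contcos f : continuous f -> continuous (fun x => cos (f x)).
Proof. by apply: cont_comp; exact: continuous_cos. Qed.

Lemma contsin f : continuous f -> continuous (fun x => sin (f x)).
Proof. by apply: cont_comp; exact: continuous_sin. Qed.

Lemma cont_norm f : continuous f -> continuous (fun x => `|f x|).
Proof. by apply: cont_comp => x; exact: norm_continuous. Qed.

Lemma cont_sum (I : Type) (r : seq I) (P : pred I) (f : I -> R -> R) :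
  (forall i, continuous (f i)) -> continuous (fun x => \sum_(i <- r | P i) f i x).
Proof.
move=> cf; elim: r => [|i r IH].
  by under eq_fun do rewrite big_nil; exact: cont_cst.
under eq_fun do rewrite big_cons; case: (P i) => //.
exact: contD.
Qed.

Definition itg a b f : R := \int[mu]_(x in `[a, b]) f x.

Lemma cont_integrable a b f : continuous f -> mu.-integrable `[a, b] (EFin \o f).
Proof.
move=> cf; apply: continuous_compact_integrable; first exact: segment_compact.
exact: continuous_subspaceT.
Qed.

Lemma cont_measurable f : continuous f -> measurable_fun setT f.
Proof. exact: continuous_measurable_fun. Qed.

Lemma eq_itg a b f g : (forall x, a <= x <= b -> f x = g x) -> itg a b f = itg a b g.
Proof. by move=> fg; apply: eq_Rintegral => x; rewrite inE/= in_itv/=; exact: fg. Qed.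

Lemma itgD a b f g : continuous f -> continuous g ->
  itg a b (fun x => f x + g x) = itg a b f + itg a b g.
Proof. by move=> cf cg; rewrite /itg RintegralD//; exact: cont_integrable. Qed.

Lemma itgZ a b c f : continuous f -> itg a b (fun x => c * f x) = c * itg a b f.
Proof. by move=> cf; rewrite /itg RintegralZl//; exact: cont_integrable. Qed.

Lemma itgN a b f : continuous f -> itg a b (fun x => - f x) = - itg a b f.
Proof.
move=> cf; rewrite -mulN1r -itgZ//; apply: eq_itg => x _.
by rewrite mulN1r.
Qed.

Lemma itg_sum (I : Type) (r : seq I) a b (f : I -> R -> R) :
  (forall i, continuous (f i)) ->
  itg a b (fun x => \sum_(i <- r) f i x) = \sum_(i <- r) itg a b (f i).
Proof.
move=> cf; elim: r => [|i r IH].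
  rewrite big_nil; under eq_fun do rewrite big_nil.
  by rewrite /itg/= Rintegral_cst//= mul0r.
rewrite big_cons -IH; under eq_fun do rewrite big_cons.
rewrite itgD//; exact: cont_sum.
Qed.

Lemma le_itg a b f g : continuous f -> continuous g ->
  (forall x, a <= x <= b -> f x <= g x) -> itg a b f <= itg a b g.
Proof.
move=> cf cg fg; apply: le_Rintegral => //; try exact: cont_integrable.
Qed.

Lemma itg_cst a b c : a <= b -> itg a b (fun=> c) = c * (b - a).
Proof.
move=> ab; rewrite /itg Rintegral_cst//= lebesgue_measure_itv/= lte_fin.
by case: ltgtP ab => // -> _; rewrite subrr.
Qed.

Lemma itg_norm_le a b c f : a <= b -> continuous f ->
  (forall x, a <= x <= b -> `|f x| <= c) -> `|itg a b f| <= c * (b - a).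
Proof.
move=> ab cf fc; rewrite -(itg_cst c ab).
apply: le_trans (le_normr_Rintegral _ (cont_integrable _ _ cf)) _ => //.
apply: le_itg => //; [exact: cont_norm|exact: cont_cst].
Qed.

Lemma is_derive_cont f g : (forall x, is_derive x (1 : R) f (g x)) -> continuous f.
Proof.
move=> fg x; apply/differentiable_continuous/derivable1_diffP.
by have [] := fg x.
Qed.

Lemma is_derive_LRcont a b f g : (forall x, is_derive x (1 : R) f (g x)) ->
  derivable_oo_LRcontinuous f a b.
Proof.
move=> fg; have cf := is_derive_cont fg; split.
- by move=> x _; have [] := fg x.
- exact/cvg_at_right_filter/cf.
- exact/cvg_at_left_filter/cf.
Qed.

Lemma itg_FTC a b F f : a < b -> continuous f ->
  (forall x, is_derive x (1 : R) F (f x)) -> itg a b f = F b - F a.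
Proof.
move=> ab cf Ff; rewrite /itg /Rintegral (@continuous_FTC2 _ f F a b)//.
- exact: continuous_subspaceT.
- exact: is_derive_LRcont Ff.
- by move=> x _; rewrite derive1E derive_val.
Qed.

Lemma itg_parts a b F f G g : a < b -> continuous f -> continuous g ->
  (forall x, is_derive x (1 : R) F (f x)) ->
  (forall x, is_derive x (1 : R) G (g x)) ->
  itg a b (fun x => F x * g x) =
    F b * G b - F a * G a - itg a b (fun x => f x * G x).
Proof.
move=> ab cf cg Ff Gg; have cF := is_derive_cont Ff; have cG := is_derive_cont Gg.
apply/eqP; rewrite eq_sym subr_eq -itgD; [|exact: contM..].
apply/eqP; symmetry; apply: (@itg_FTC a b (fun x => F x * G x)) => //.
  by apply: contD; exact: contM.
move=> x; apply: (is_derive_eq (is_deriveM _ _)).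
by rewrite /GRing.scale/= [G x * _]mulrC.
Qed.

Lemma is_derive_itg a b (M : R) (f f' : R -> R -> R) y : a <= b ->
  (forall y, continuous (f y)) ->
  (forall y w, is_derive y (1 : R) (f ^~ w) (f' y w)) ->
  (forall y w, a <= w <= b -> `|f' y w| <= M) ->
  is_derive y (1 : R) (fun y => itg a b (f y)) (itg a b (f' y)).
Proof.
move=> ab cf df fM.
have M0 : 0 <= M by apply: (le_trans _ (fM 0 a _)); rewrite ?lexx.
have Iy : `]y - 1, y + 1[%classic y by rewrite /= in_itv/=; apply/andP; split; lra.
have pE z w : partial1of2 f z w = f' z w.
  by rewrite partial1of2E derive_val.
have i1 : forall x, `]y - 1, y + 1[%classic x ->
    mu.-integrable `[a, b] (EFin \o f x).
  by move=> x _; exact: cont_integrable.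
have i2 : forall x w, `]y - 1, y + 1[%classic x -> `[a, b]%classic w ->
    derivable (f ^~ w) x 1.
  by move=> x w _ _; have [] := df x w.
have i3 : mu.-integrable `[a, b] (EFin \o (fun=> M)).
  by apply: cont_integrable; exact: cont_cst.
have i4 : forall x w, `]y - 1, y + 1[%classic x -> `[a, b]%classic w ->
    `|partial1of2 f x w| <= M.
  by move=> x w _ /=; rewrite in_itv/= pE; exact: fM.
have M1 : forall w : R, 0 <= (fun=> M) w by [].
split.
  by have := @derivable_under_integral _ _ _ _ _ _ _ _ _ _ Iy i1 i2 _ M1 i3 i4; exact.
rewrite -derive1E (differentiation_under_integral _ Iy i1 i2 M1 i3 i4)//.
by apply: eq_itg => w _; rewrite pE.
Qed.

Lemma is_derive_cosl c e y :
  is_derive y (1 : R) (fun y => cos (c * y + e)) (- c * sin (c * y + e)).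
Proof.
have h : is_derive y (1 : R) (fun x => c * x + e) c.
  apply: (is_derive_eq (is_deriveD _ _)).
  by rewrite /GRing.scale/= mulr1 addr0.
apply: (is_derive_eq (is_derive1_comp _ h)).
by rewrite !mulNr mulrC.
Qed.

Lemma is_derive_sinl c e y :
  is_derive y (1 : R) (fun y => sin (c * y + e)) (c * cos (c * y + e)).
Proof.
have h : is_derive y (1 : R) (fun x => c * x + e) c.
  apply: (is_derive_eq (is_deriveD _ _)).
  by rewrite /GRing.scale/= mulr1 addr0.
apply: (is_derive_eq (is_derive1_comp _ h)).
by rewrite mulrC.
Qed.

Lemma cont_bounded a b f : continuous f -> exists2 M : R, 0 <= M &
  forall x, a <= x <= b -> `|f x| <= M.
Proof.
move=> cf; have [ab|ba] := leP a b; last first.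
  exists 0 => // x /andP[ax xb]; have := le_trans ax xb.
  by rewrite leNgt ba.
have [||c _ fc] := @compact_EVT_max _ _ (fun x => `|f x|) _ _ (@segment_compact _ a b).
- by exists a; rewrite /= in_itv/= lexx.
- by apply: continuous_subspaceT; exact: cont_norm.
by exists `|f c| => // x xab; apply: fc; rewrite inE/= in_itv.
Qed.

End interval_integrals.

(** Structural recursion on the body of the function. Opaque functions are closed by [assumption],
    which is why many proofs first put their continuity into the context. *)
Ltac cont := cbv beta; lazymatch goal with
  | |- continuous (fun x => x) => exact: cont_id
  | |- continuous (fun _ => ?c) => exact: cont_cst
  | |- continuous (fun x => @GRing.mul _ (@?f x) (@?g x)) => apply: (@contM _ f g); cont
  | |- continuous (fun x => @GRing.add _ (@?f x) (@?g x)) => apply: (@contD _ f g); cont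
  | |- continuous (fun x => @GRing.opp _ (@?f x)) => apply: (@contN _ f); cont
  | |- continuous (fun x => cos (@?f x)) => apply: (@contcos _ f); cont
  | |- continuous (fun x => sin (@?f x)) => apply: (@contsin _ f); cont
  | |- continuous (fun x => Num.norm (@?f x)) => apply: (@cont_norm _ f); cont
  | |- _ => assumption
  end.

(** * Cosine and sine transforms of smooth functions with compact support *)

Section fourier_compact.
Variable R : realType.
Implicit Types (u v f g F : R -> R) (n k : nat) (x y a b c e : R).

Variable A : R.
Hypothesis A0 : 0 < A.

Definition cosT u y : R := itg (- A) A (fun w => u w * cos (2 * pi * (y * w))).
Definition sinT u y : R := itg (- A) A (fun w => u w * sin (2 * pi * (y * w))).

Definition ccinfty u := cinfty u /\ forall x, A < `|x| -> u x = 0.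

Let NAA : - A < A. Proof. by rewrite gtrN. Qed.

Lemma ccinfty_derive u : ccinfty u -> ccinfty (u^`())%classic.
Proof.
move=> [cu u0]; split; first by have [] := cinfty_derive cu.
move=> x xA; rewrite derive1E.
rewrite (@near_eq_derive _ _ _ u (cst 0)) ?derive_cst//.
near=> z; rewrite u0//; near: z.
exact: (@cvgr_norm_gt _ _ _ _ _ id x (@cvg_id _ (nbhs x))).
Unshelve. all: end_near. Qed.

Lemma ccinfty_mulid u c : ccinfty u -> ccinfty (fun x => c * x * u x).
Proof.
move=> [cu u0]; split; last by move=> x /u0 ->; rewrite mulr0.
by move=> n; apply: kdiffM; [apply/kdiffZ/kdiff_id|exact: cu].
Qed.

Lemma ccinfty_edge u : ccinfty u -> u A = 0 /\ u (- A) = 0.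
Proof.
move=> [cu u0].
have h e : 0 < A - 0 -> `|e| = A -> u e = 0.
  move=> _ eA; apply/eqP/negPn/negP => ue.
  have ce : u x @[x --> e] --> u e := @cinfty_continuous _ _ cu e.
  have [/= d d0 dP] : \forall x \near e, 0 < `|u x|.
    by apply: (@cvgr_norm_gt _ _ _ _ _ u (u e) ce); rewrite normr_gt0.
  have e0 : e != 0 by rewrite -normr_gt0 eA.
  pose z := e + d / 2 * Num.sg e.
  (* The point z lies d/2 further out than e, hence outside the support but still in the ball where
     u does not vanish. *)
  have := dP z; rewrite /ball/= /z opprD addNKr normrN normrM normr_sg e0 mulr1.
  rewrite gtr0_norm ?divr_gt0// ltr_pdivrMr// ltr_pMr// ltr1n => /(_ isT).
  rewrite u0 ?normr0 ?ltxx// {1}(numEsg e) mulrC -mulrDl normrM normr_sg e0 mulr1.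
  rewrite eA gtr0_norm; first by rewrite ltrDl divr_gt0.
  by rewrite addr_gt0// divr_gt0.
by split; apply: h; rewrite ?subr0// ?normrN gtr0_norm.
Qed.

Let bdd u : ccinfty u -> exists2 M : R, 0 <= M & forall x, `|u x| <= M.
Proof.
move=> [cu u0]; have [M M0 h] := cont_bounded (- A) A (cinfty_continuous cu).
exists M => // x; have [/h//|xA] := boolP (- A <= x <= A).
by rewrite u0 ?normr0// ltNge ler_norml.
Qed.

Lemma is_derive_cosT u y : ccinfty u ->
  is_derive y (1 : R) (cosT u) (sinT (fun w => - (2 * pi) * w * u w) y).
Proof.
move=> su; have cu := cinfty_continuous su.1; have [M M0 uM] := bdd su.
apply: (@is_derive_itg _ _ _ (2 * pi * A * M) (fun y w => u w * cos (2 * pi * (y * w)))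
  (fun y w => - (2 * pi) * w * u w * sin (2 * pi * (y * w)))); first exact: ltW.
- by move=> z; cont.
- move=> z w.
  have := @is_derive_cosl _ (2 * pi * w) 0 z.
  under [X in is_derive _ _ X]eq_fun do rewrite addr0 -mulrA [w * _]mulrC.
  move=> h; have := is_deriveZ (u w) h; rewrite /GRing.scale/= addr0.
  rewrite [_ * w * z]mulrAC -[_ * z * w]mulrA.
  by move=> h'; apply: (is_derive_eq h'); ring.
- move=> z w wA; rewrite !normrM -!mulrA.
  rewrite normrN normrM !(ger0_norm (pi_ge0 _)) ger0_norm// -!mulrA.
  rewrite ler_wpM2l// ler_wpM2l ?pi_ge0// ler_pM ?mulr_ge0//.
    by rewrite ler_norml.
  rewrite -[leRHS]mulr1 ler_pM// ler_norml; rewrite sin_geN1 sin_le1//.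
Qed.

Lemma is_derive_sinT u y : ccinfty u ->
  is_derive y (1 : R) (sinT u) (cosT (fun w => 2 * pi * w * u w) y).
Proof.
move=> su; have cu := cinfty_continuous su.1; have [M M0 uM] := bdd su.
apply: (@is_derive_itg _ _ _ (2 * pi * A * M) (fun y w => u w * sin (2 * pi * (y * w)))
  (fun y w => 2 * pi * w * u w * cos (2 * pi * (y * w)))); first exact: ltW.
- by move=> z; cont.
- move=> z w.
  have := @is_derive_sinl _ (2 * pi * w) 0 z.
  under [X in is_derive _ _ X]eq_fun do rewrite addr0 -mulrA [w * _]mulrC.
  move=> h; have := is_deriveZ (u w) h; rewrite /GRing.scale/= addr0.
  rewrite [_ * w * z]mulrAC -[_ * z * w]mulrA.
  by move=> h'; apply: (is_derive_eq h'); ring.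
- move=> z w wA; rewrite !normrM -!mulrA.
  rewrite (ger0_norm (pi_ge0 _)) ger0_norm//.
  rewrite ler_wpM2l// ler_wpM2l ?pi_ge0// ler_pM ?mulr_ge0//.
    by rewrite ler_norml.
  rewrite -[leRHS]mulr1 ler_pM// ler_norml; rewrite cos_geN1 cos_le1//.
Qed.

(** The two transforms are treated together because differentiating either one gives the other,
    applied to u times a multiple of w. *)
Lemma cinfty_trigT n u : ccinfty u -> kdiff n (cosT u) /\ kdiff n (sinT u).
Proof.
elim: n u => [//|n IH] u su; split.
- exists (sinT (fun w => - (2 * pi) * w * u w)).
    by move=> y; exact: is_derive_cosT.
  by have [] := IH _ (ccinfty_mulid (- (2 * pi)) su).
- exists (cosT (fun w => (2 * pi) * w * u w)).
    by move=> y; exact: is_derive_sinT.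
  by have [] := IH _ (ccinfty_mulid (2 * pi) su).
Qed.

(** Integration by parts: the factor y comes from differentiating the kernel in w, and is traded for
    a derivative of u. *)
Lemma mul_cosT u y : ccinfty u ->
  y * cosT u y = - (2 * pi)^-1 * sinT (u^`())%classic y.
Proof.
move=> su; have cu := cinfty_continuous su.1.
have [du cu'] := cinfty_derive su.1; have cdu := cinfty_continuous cu'.
have [u1 u2] := ccinfty_edge su.
have P0 : (2 : R) * pi != 0 by rewrite mulf_neq0 ?gt_eqF ?pi_gt0.
apply: (mulfI P0); rewrite [RHS]mulrA mulrN divff// mulN1r.
have dS w : is_derive w (1 : R) (fun w => sin (2 * pi * (y * w)))
    (2 * pi * y * cos (2 * pi * (y * w))).
  have := @is_derive_sinl _ (2 * pi * y) 0 w.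
  under [X in is_derive _ _ X]eq_fun do rewrite addr0 -mulrA.
  by rewrite addr0 -[X in _ * _ X]mulrA.
have cP : continuous (fun w : R => 2 * pi * y * cos (2 * pi * (y * w))) by cont.
have := itg_parts NAA cdu cP du dS.
rewrite u1 u2 !mul0r subrr sub0r => <-.
rewrite /cosT mulrA -itgZ; last by cont.
by apply: eq_itg => w _; ring.
Qed.

Lemma mul_sinT u y : ccinfty u ->
  y * sinT u y = (2 * pi)^-1 * cosT (u^`())%classic y.
Proof.
move=> su; have cu := cinfty_continuous su.1.
have [du cu'] := cinfty_derive su.1; have cdu := cinfty_continuous cu'.
have [u1 u2] := ccinfty_edge su.
have P0 : (2 : R) * pi != 0 by rewrite mulf_neq0 ?gt_eqF ?pi_gt0.
apply: (mulfI P0); rewrite [RHS]mulrA divff// mul1r.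
have dS w : is_derive w (1 : R) (fun w => cos (2 * pi * (y * w)))
    (- (2 * pi * y) * sin (2 * pi * (y * w))).
  have := @is_derive_cosl _ (2 * pi * y) 0 w.
  under [X in is_derive _ _ X]eq_fun do rewrite addr0 -mulrA.
  by rewrite addr0 -[X in _ * _ X]mulrA.
have cP : continuous (fun w : R => - (2 * pi * y) * sin (2 * pi * (y * w))) by cont.
have := itg_parts NAA cdu cP du dS.
rewrite u1 u2 !mul0r subrr sub0r => /eqP; rewrite eq_sym eqr_oppLR => /eqP; rewrite /sinT /cosT => ->.
rewrite mulrA -itgZ -?itgN; try by cont.
by apply: eq_itg => w _; ring.
Qed.

(** Each power of y costs one integration by parts; what remains is the trivial bound on the
    transform of a k-th derivative. *)
Lemma decay_trigT k u : ccinfty u -> exists2 M : R, 0 <= M &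
  forall y, `|y ^+ k * cosT u y| <= M /\ `|y ^+ k * sinT u y| <= M.
Proof.
elim: k u => [|k IH] u su.
  have [M M0 uM] := bdd su; have cu := cinfty_continuous su.1.
  exists (M * (A - - A)).
    by rewrite mulr_ge0// subr_ge0 ltW.
  move=> y; rewrite expr0 !mul1r; split; apply: itg_norm_le; try exact: ltW; try by cont.
    move=> x _; rewrite normrM -[leRHS]mulr1 ler_pM// ler_norml.
    by rewrite cos_geN1 cos_le1.
  move=> x _; rewrite normrM -[leRHS]mulr1 ler_pM// ler_norml.
  by rewrite sin_geN1 sin_le1.
have [M M0 h] := IH _ (ccinfty_derive su).
have P0 : 0 <= (2 : R) * pi by rewrite mulr_ge0 ?pi_ge0.
exists ((2 * pi)^-1 * M); first by rewrite mulr_ge0// invr_ge0.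
move=> y; rewrite exprSr -!mulrA mul_cosT// mul_sinT//.
have [h1 h2] := h y.
rewrite !(mulrCA (y ^+ k)) !normrM normrN !(@ger0_norm _ (2 * pi)^-1) ?invr_ge0//.
by rewrite -!normrM !ler_wpM2l// invr_ge0.
Qed.

Lemma decay_derive_trigT k n u : ccinfty u -> exists2 M : R, 0 <= M &
  forall y, `|y ^+ k * derive1n n (cosT u) y| <= M /\
            `|y ^+ k * derive1n n (sinT u) y| <= M.
Proof.
elim: n u => [|n IH] u su; first by have [M M0 h] := decay_trigT k su; exists M.
have [M1 M10 h1] := IH _ (ccinfty_mulid (- (2 * pi)) su).
have [M2 M20 h2] := IH _ (ccinfty_mulid (2 * pi) su).
have E1 : derive1n n.+1 (cosT u) = derive1n n (sinT (fun w => - (2 * pi) * w * u w)).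
  rewrite /derive1n iterSr; congr (iter _ _ _); apply/funext => y.
  by rewrite derive1E; have := is_derive_cosT y su => -[_ ->].
have E2 : derive1n n.+1 (sinT u) = derive1n n (cosT (fun w => (2 * pi) * w * u w)).
  rewrite /derive1n iterSr; congr (iter _ _ _); apply/funext => y.
  by rewrite derive1E; have := is_derive_sinT y su => -[_ ->].
exists (M1 + M2); first exact: addr_ge0.
move=> y; rewrite E1 E2; split.
  by rewrite (le_trans (h1 y).2)// lerDl.
by rewrite (le_trans (h2 y).1)// lerDr.
Qed.

End fourier_compact.

(** * The Dirichlet kernel *)

Section dirichlet.
Variable R : realType.
Implicit Types (f p q Q : R -> R) (n k m N : nat) (x y a b c e w t : R).

(* Bessel's inequality makes the Fourier coefficients square summable. *)
Lemma bessel_cvg0 a b c (phi : nat -> R -> R) Q : a <= b -> 0 < c ->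
  (forall n, continuous (phi n)) -> continuous Q ->
  (forall m n, itg a b (fun v => phi m v * phi n v) = if m == n then c else 0) ->
  itg a b (fun v => Q v * phi n v) @[n --> \oo] --> 0.
Proof.
move=> ab c0 cphi cQ orth.
pose d n := itg a b (fun v => Q v * phi n v).
(* The orthogonal projection of Q on the first n functions, c being their common squared norm;
   below, Q - S n has nonnegative squared norm. *)
pose S n v := \sum_(k < n) c^-1 * d k * phi k v.
have cS n : continuous (S n).
  by apply: cont_sum => i; apply: contM; [exact: cont_cst|exact: cphi].
have ip n f : continuous f -> itg a b (fun v => f v * S n v) =
    \sum_(k < n) c^-1 * d k * itg a b (fun v => f v * phi k v).
  move=> cf; under [in LHS]eq_itg do rewrite /S mulr_sumr.
  rewrite (@itg_sum _ _ _ a b (fun (i : 'I_n) v => f v * (c^-1 * d i * phi i v))); last first.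
    by move=> i; apply: contM => //; apply: contM; [exact: cont_cst|exact: cphi].
  apply: eq_bigr => i _; rewrite -(@itgZ _ a b (c^-1 * d i)); last by apply: contM => //; exact: cphi.
  by apply: eq_itg => v _; ring.
have QS n : itg a b (fun v => Q v * S n v) = c^-1 * \sum_(k < n) d k ^+ 2.
  by rewrite ip// mulr_sumr; apply: eq_bigr => i _; rewrite expr2 mulrA.
have SS n : itg a b (fun v => S n v * S n v) = c^-1 * \sum_(k < n) d k ^+ 2.
  rewrite ip// mulr_sumr; apply: eq_bigr => i _.
  under eq_itg do rewrite mulrC.
  rewrite ip; last exact: cphi.
  rewrite (bigD1 i)//= big1 ?addr0 => [|j ji].
    by rewrite orth eqxx; field; rewrite gt_eqF.
  by rewrite orth ifN ?mulr0// eq_sym.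
have bd n : \sum_(k < n) d k ^+ 2 <= c * itg a b (fun v => Q v * Q v).
  have : 0 <= itg a b (fun v => (Q v - S n v) * (Q v - S n v)).
    by apply: Rintegral_ge0 => v _; rewrite -expr2 sqr_ge0.
  rewrite (@eq_itg _ _ _ _ (fun v => Q v * Q v + -2 * (Q v * S n v) + S n v * S n v)); last by move=> v _; ring.
  have cSn := cS n.
  have cQQ : continuous (fun v => Q v * Q v) by exact: contM.
  have cQS : continuous (fun v => Q v * S n v) by exact: contM.
  have cSS : continuous (fun v => S n v * S n v) by exact: contM.
  rewrite itgD//; last by cont.
  rewrite itgD//; last by cont.
  rewrite itgZ// QS SS.
  rewrite -(ler_pdivrMl _ _ c0); lra.
have : cvgn (series (fun k => d k ^+ 2)).
  apply: nondecreasing_is_cvgn.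
    by apply: nondecreasing_series => n _ _; exact: sqr_ge0.
  exists (c * itg a b (fun v => Q v * Q v)) => _ [n _ <-].
  by rewrite /series/= big_mkord.
move=> /cvg_series_cvg_0 d20.
apply/cvgrPdist_lt => r r0.
have /cvgrPdist_lt/(_ (r ^+ 2)) := d20; rewrite exprn_gt0// => /(_ isT).
apply: filterS => n; rewrite !sub0r !normrN ger0_norm ?sqr_ge0//.
by move=> h; rewrite -(@ltr_pXn2r _ 2) ?nnegrE ?normr_ge0 ?(ltW r0)// real_normK ?num_real.
Qed.

Variable e : R.
Hypothesis e0 : 0 < e.
(** Half of the period 1/e shared by the functions cos(2 pi e m v) with m an integer. *)
Let T : R := (2 * e)^-1.

Let T0 : 0 < T. Proof. by rewrite invr_gt0 mulr_gt0. Qed.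
Let eT : 2 * (e * T) = 1. Proof. by rewrite mulrA divff// mulf_neq0// gt_eqF. Qed.
Let NTT : - T < T. Proof. by rewrite gtrN. Qed.

Lemma itg_cos_period m c : (0 < m)%N ->
  itg (- T) T (fun v => cos (2 * pi * e * m%:R * v + c)) = 0.
Proof.
move=> m0; pose k : R := 2 * pi * e * m%:R.
have k0 : k != 0 by rewrite !mulf_neq0 ?gt_eqF ?pi_gt0// ltr0n.
have dk x : is_derive x (1 : R) (fun v => k^-1 * sin (k * v + c)) (cos (k * x + c)).
  apply: (is_derive_eq (is_deriveZ _ (is_derive_sinl k c x))).
  by rewrite /GRing.scale/= mulrA mulVf// mul1r.
rewrite (@itg_FTC _ _ _ (fun v => k^-1 * sin (k * v + c)))//; last by cont.
rewrite -mulrBr (_ : k * T + c = (k * - T + c) + (pi *+ 2) *+ m).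
  by rewrite (periodicn (@sinD2pi R)) subrr mulr0.
rewrite -mulr_natr -[pi *+ 2]mulr_natr /k.
have -> : 2 * pi * e * m%:R * T = (2 * (e * T)) * pi * m%:R by ring.
have -> : 2 * pi * e * m%:R * - T = - (2 * (e * T)) * pi * m%:R by ring.
rewrite eT; ring.
Qed.

Definition dirichlet N t : R := 1 + 2 * \sum_(k < N) cos (2 * pi * k.+1%:R * t).

Lemma dirichletE N t : sin (pi * t) * dirichlet N t = sin (pi * (2 * N%:R + 1) * t).
Proof.
rewrite /dirichlet; elim: N => [|N IH].
  by rewrite big_ord0 !mulr0 addr0 mulr1 add0r mulr1.
rewrite big_ord_recr/= [2 * (_ + _)]mulrDr addrA mulrDr IH.
set z := 2 * pi * _ * t.
have -> : pi * (2 * N%:R + 1) * t = z - pi * t by rewrite /z -natr1; ring.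
have -> : pi * (2 * N.+1%:R + 1) * t = z + pi * t by rewrite /z; ring.
by rewrite sinB sinD; ring.
Qed.

Lemma cont_dirichlet N w : continuous (fun v => dirichlet N (e * (v - w))).
Proof.
apply: contD; first exact: cont_cst.
apply: contM; first exact: cont_cst.
by apply: cont_sum => i; cont.
Qed.

Lemma itg_dirichlet N w : itg (- T) T (fun v => e * dirichlet N (e * (v - w))) = 1.
Proof.
rewrite itgZ; last exact: cont_dirichlet.
rewrite itgD; [|exact: cont_cst|]; last first.
  by apply: contM; [exact: cont_cst|apply: cont_sum => i; cont].
rewrite itg_cst ?ltW// itgZ; last by apply: cont_sum => i; cont.
rewrite (@itg_sum _ _ _ _ _ (fun (i : 'I_N) v => cos (2 * pi * i.+1%:R * (e * (v - w))))); last by move=> i; cont.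
rewrite big1 ?mulr0 ?addr0; first by rewrite mul1r opprK -mulr2n -mulr_natl mulrCA.
move=> i _; rewrite -[RHS](@itg_cos_period i.+1 (- (2 * pi * e * i.+1%:R * w)) isT).
by apply: eq_itg => v _; congr cos; ring.
Qed.

(** The sines of half-odd frequency are orthogonal on one period: the product formula gives cosines
    of the integer frequencies n - m and n + m + 1, and the latter is never 0. Bessel's inequality
    then suffices, without a density argument. *)
Lemma riemann_lebesgue_sin w Q : continuous Q ->
  itg (- T) T (fun v => Q v * sin (pi * (2 * n%:R + 1) * (e * (v - w))))
    @[n --> \oo] --> 0.
Proof.
move=> cQ.
pose phi n v := sin (pi * (2 * n%:R + 1) * (e * (v - w))).
have cphi n : continuous (phi n) by rewrite /phi; cont.
apply: (@bessel_cvg0 _ _ T phi) => //; first exact: ltW.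
have E m n : (m <= n)%N -> itg (- T) T (fun v => phi m v * phi n v) =
    2^-1 * (itg (- T) T (fun v => cos (2 * pi * e * (n - m)%:R * v + - (2 * pi * e * (n - m)%:R * w)))).
  move=> mn; pose c v := cos (2 * pi * e * (n - m)%:R * v + - (2 * pi * e * (n - m)%:R * w)).
  pose c' v := cos (2 * pi * e * (n + m).+1%:R * v + - (2 * pi * e * (n + m).+1%:R * w)).
  have cc : continuous c by rewrite /c; cont.
  have cc' : continuous c' by rewrite /c'; cont.
  rewrite (_ : itg _ _ _ = itg (- T) T (fun v => 2^-1 * c v + - 2^-1 * c' v)).
    rewrite itgD ?itgZ//; try by cont.
    by rewrite (@itg_cos_period (n + m).+1)// mulr0 addr0.
  apply: eq_itg => v _; rewrite /phi /c /c'.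
  set x := pi * (2 * m%:R + 1) * _; set y := pi * (2 * n%:R + 1) * _.
  have -> : 2 * pi * e * (n - m)%:R * v + - (2 * pi * e * (n - m)%:R * w) = y - x.
    by rewrite natrB// /x /y; ring.
  have -> : 2 * pi * e * (n + m).+1%:R * v + - (2 * pi * e * (n + m).+1%:R * w) = y + x.
    by rewrite -[(n + m).+1%:R]natr1 natrD /x /y; ring.
  by rewrite cosB cosD; field.
move=> m n; have [mn|nm|<-] := ltngtP m n.
- by rewrite E ?(ltnW mn)// itg_cos_period ?mulr0// subn_gt0.
- under eq_itg do rewrite mulrC.
  by rewrite E ?(ltnW nm)// itg_cos_period ?mulr0// subn_gt0.
- rewrite E// subnn -[RHS](mulr1).
  rewrite (@eq_itg _ _ _ _ (fun=> 1)); last first.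
    by move=> v _; rewrite !(mulr0, mul0r) oppr0 addr0 cos0.
  by rewrite itg_cst ?ltW//; field.
Qed.

(** The value at v = w is the limit of the quotient, namely the ratio of the derivatives of
    numerator and denominator. *)
Let q p dp w v := if v == w then dp / (pi * e) else (p v - p w) / sin (pi * (e * (v - w))).

Let sin_neq0 v w : v != w -> `|v - w| < e^-1 -> sin (pi * (e * (v - w))) != 0.
Proof.
move=> vw h.
have h1 : `|pi * (e * (v - w))| < pi.
  rewrite normrM (ger0_norm (pi_ge0 _)) gtr_pMr ?pi_gt0// normrM gtr0_norm//.
  by rewrite -ltr_pdivlMl// mulr1.
have h2 : pi * (e * (v - w)) != 0 by rewrite !mulf_eq0 !negb_or subr_eq0 vw !gt_eqF ?pi_gt0.
move: h1 h2; move: (pi * _) => z; rewrite ltr_norml => /andP[z1 z2] z0.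
have [zp|zn|zz] := ltgtP z 0; last by rewrite zz eqxx in z0.
  by rewrite -[z]opprK sinN oppr_eq0 gt_eqF// sin_gt0_pi//; lra.
by rewrite gt_eqF// sin_gt0_pi//; lra.
Qed.

Let q_continuous p dp w v : continuous p -> is_derive w (1 : R) p dp ->
  `|v - w| < e^-1 -> {for v, continuous (q p dp w)}.
Proof.
move=> cp dpw vw; have [->|vnw] := eqVneq v w; last first.
  have : (fun v => (p v - p w) / sin (pi * (e * (v - w)))) z @[z --> v] --> q p dp w v.
    rewrite /q (negbTE vnw); apply: cvgM.
      by apply: cvgB; [exact: cp|exact: cvg_cst].
    apply: cvgV; first exact: sin_neq0.
    suff : continuous (fun v => sin (pi * (e * (v - w)))) by apply.
    by cont.
  apply: cvg_trans; apply: near_eq_cvg; near=> z.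
  rewrite /q ifN//; near: z; exists `|v - w|; first by rewrite /= normr_gt0 subr_eq0.
  by move=> z /= vz; apply: contraTneq vz => ->; rewrite ltxx.
apply/continuous_withinNx.
rewrite /q eqxx.
have s0 : is_derive w (1 : R) (fun v => sin (pi * e * v + - (pi * e * w))) (pi * e).
  apply: (is_derive_eq (is_derive_sinl _ _ _)).
  by rewrite subrr cos0 mulr1.
have [/cvg_ex[/= l1 h1] E1] := dpw; have [/cvg_ex[/= l2 h2] E2] := s0.
have dpE : dp = l1 by rewrite -E1; exact/cvg_lim.
have peE : pi * e = l2 by rewrite -E2; exact/cvg_lim.
have l20 : l2 != 0 by rewrite -peE mulf_neq0 ?gt_eqF ?pi_gt0.
(* The ratio of the difference quotients of p and of the sine; cancelling the increment gives back
   [q]. *)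
have h12 : (h^-1 *: (p (h%:A + w) - p w)) / (h^-1 *:
    (sin (pi * e * (h%:A + w) - pi * e * w) - sin (pi * e * w - pi * e * w)))
    @[h --> 0^'] --> l1 / l2.
  by apply: cvgM => //; apply: cvgV.
apply/cvgrPdist_le => r r0.
have /cvgrPdist_le/(_ r r0) [d /= d0 dP] := h12.
have d'0 : 0 < Num.min d e^-1 by rewrite lt_min d0 invr_gt0.
exists (Num.min d e^-1) => //= z wz zw.
have : `|w - z| < Num.min d e^-1 := wz; rewrite lt_min => /andP[zd ze].
have : ball_ Num.norm (0 : R) d (z - w) by rewrite /= sub0r normrN distrC.
move=> /dP; rewrite subr_eq0 => /(_ zw).
rewrite dpE peE ifN// /GRing.scale/= !mulr1 !subrK subrr sin0 subr0.
suff -> : (z - w)^-1 * (p z - p w) * ((z - w)^-1 * sin (l2 * z - l2 * w))^-1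
   = (p z - p w) / sin (pi * (e * (z - w))) by [].
have -> : l2 * z - l2 * w = pi * (e * (z - w)) by rewrite -peE; ring.
have s0' := @sin_neq0 z w zw; rewrite distrC in s0'.
by field; rewrite s0'//= subr_eq0.
Unshelve. all: end_near. Qed.

(* Dividing p(v) - p(w) by the sine in the Dirichlet kernel leaves a continuous function, to
   which the Riemann-Lebesgue lemma applies. *)
Lemma dirichlet_cvg p dp w : continuous p -> is_derive w (1 : R) p dp ->
  `|w| < T ->
  itg (- T) T (fun v => p v * (e * dirichlet N (e * (v - w)))) @[N --> \oo] --> p w.
Proof.
move=> cp dpw wT.
(* [q] is known to be continuous only for |v - w| < 1/e. Composing with the clamp to [-T, T] makes
   it continuous on the whole line and does not change the integral. *)
pose cl v := Num.max (- T) (Num.min T v).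
have ccl : continuous cl.
  move=> v; apply: (@continuous_max _ _ (cst (- T)) (fun v => Num.min T v) v).
    exact: cst_continuous.
  apply: (@continuous_min _ _ (cst T) (fun v => v) v) => //.
  exact: cst_continuous.
have clT v : `|cl v - w| < e^-1.
  have -> : e^-1 = T + T by rewrite -mulr2n -mulr_natl /T; field; rewrite gt_eqF.
  rewrite (le_lt_trans (ler_normB _ _))// ler_ltD// ler_norml.
  by rewrite /cl le_max lexx/= ge_max ge_min lexx/= andbT ltW.
have clE v : - T <= v <= T -> cl v = v.
  by move=> /andP[h1 h2]; rewrite /cl (min_idPr h2) (max_idPr h1).
pose Q v := q p dp w (cl v).
have cQ : continuous Q.
  move=> v; apply: continuous_comp; first exact: ccl.
  exact: q_continuous.
have cD N := @cont_dirichlet N w.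
have -> : (fun N => itg (- T) T (fun v => p v * (e * dirichlet N (e * (v - w))))) =
    (fun N => e * itg (- T) T (fun v => Q v * sin (pi * (2 * N%:R + 1) * (e * (v - w)))) + p w).
  apply/funext => N.
  rewrite [in RHS](_ : p w = p w * itg (- T) T (fun v => e * dirichlet N (e * (v - w)))); last first.
    by rewrite itg_dirichlet mulr1.
  have cDN := cD N.
  rewrite -!itgZ; try by cont; exact: cD.
    rewrite -itgD; try by cont; exact: cD.
    apply: eq_itg => v vT; rewrite /Q clE// -dirichletE /q.
    case: eqVneq => [->|vw]; first by rewrite subrr !mulr0 sin0; ring.
    have vs0 : sin (pi * (e * (v - w))) != 0.
      by apply: sin_neq0 => //; rewrite -(clE v vT).
    by field.
rewrite -[X in _ --> X]add0r; apply: cvgD; last exact: cvg_cst.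
rewrite -(mulr0 e); apply: cvgM; first exact: cvg_cst.
exact: riemann_lebesgue_sin.
Qed.

End dirichlet.

(** * Limit theorems for real-valued integrands *)

Section real_dominated_convergence.
Context d (T : measurableType d) (R : realType).
Variable mu : {measure set T -> \bar R}.
Implicit Types (f g : T -> R) (D : set T).

Lemma Rdominated_convergence D (f_ : nat -> T -> R) f g : measurable D ->
  (forall n, measurable_fun D (f_ n)) ->
  (forall x, D x -> f_ n x @[n --> \oo] --> f x) ->
  mu.-integrable D (EFin \o g) ->
  (forall n x, D x -> `|f_ n x| <= g x) ->
  mu.-integrable D (EFin \o f) /\
  \int[mu]_(x in D) f_ n x @[n --> \oo] --> \int[mu]_(x in D) f x.
Proof.
move=> mD mf ff ig fg.
have mf' : measurable_fun D f by exact: (measurable_fun_cvg mf ff).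
have h1 n : measurable_fun D (fun x => (f_ n x)%:E) by exact/measurable_EFinP.
have h2 : measurable_fun D (EFin \o f) by exact/measurable_EFinP.
have h3 x : D x -> (f_ n x)%:E @[n --> \oo] --> (f x)%:E.
  by move=> Dx; apply: cvg_EFin; [exact: nearW|exact: ff].
have h4 x n : D x -> (`|(f_ n x)%:E| <= (EFin \o g) x)%E by exact: fg.
have [i1 _ i2] := dominated_convergence mD h1 h2 (aeW _ h3) ig (aeW _ h4).
split=> //; apply: fine_cvg; rewrite fineK; last exact: integrable_fin_num.
exact: i2.
Qed.

Lemma le_integrable_norm D f g : measurable D -> measurable_fun D f ->
  mu.-integrable D (EFin \o g) -> (forall x, D x -> `|f x| <= g x) ->
  mu.-integrable D (EFin \o f).
Proof.
move=> mD mf ig fg; apply: le_integrable ig => //; first exact/measurable_EFinP.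
by move=> x Dx; rewrite /= lee_fin (le_trans (fg x Dx))// ler_norm.
Qed.

Lemma RintegrableZ D c f : measurable D -> mu.-integrable D (EFin \o f) ->
  mu.-integrable D (EFin \o (fun x => c * f x)).
Proof. by move=> mD fi; apply: eq_integrable (integrableZl mD c fi). Qed.

Lemma RintegrableD D f g : measurable D -> mu.-integrable D (EFin \o f) ->
  mu.-integrable D (EFin \o g) -> mu.-integrable D (EFin \o (fun x => f x + g x)).
Proof. by move=> mD fi gi; apply: eq_integrable (integrableD mD fi gi). Qed.

Lemma RintegrableB D f g : measurable D -> mu.-integrable D (EFin \o f) ->
  mu.-integrable D (EFin \o g) -> mu.-integrable D (EFin \o (fun x => f x - g x)).
Proof. by move=> mD fi gi; apply: eq_integrable (integrableB mD fi gi). Qed.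

Lemma fatou_le (f_ : nat -> T -> R) f (M : \bar R) :
  (forall n, measurable_fun setT (f_ n)) -> (forall n x, 0 <= f_ n x) ->
  (forall x, f_ n x @[n --> \oo] --> f x) ->
  (forall n, (\int[mu]_x (f_ n x)%:E <= M)%E) ->
  (\int[mu]_x (f x)%:E <= M)%E.
Proof.
move=> mf f0 ff fM.
have h1 n : measurable_fun setT (fun x => (f_ n x)%:E) by exact/measurable_EFinP.
have h2 n x : setT x -> (0 <= (f_ n x)%:E)%E by rewrite lee_fin.
have := fatou mu measurableT h1 h2.
rewrite (_ : (fun x => limn_einf _) = (fun x => (f x)%:E)); last first.
  apply/funext => x.
  have h3 : (f_ n x)%:E @[n --> \oo] --> (f x)%:E.
    by apply: cvg_EFin; [exact: nearW|exact: ff].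
  by rewrite is_cvg_limn_einfE; [exact/cvg_lim|exact: cvgP h3].
move=> /le_trans; apply; rewrite limn_einf_lim; apply: lime_le.
  exact: is_cvg_einfs.
apply: nearW => n; apply: le_trans (fM n).
by apply: ereal_inf_lbound; exists n => /=.
Qed.

End real_dominated_convergence.

(** * From interval integrals to integrals over the line *)

Section line_integrals.
Variable R : realType.
Local Notation mu := (@lebesgue_measure R).
Implicit Types (f g : R -> R) (n : nat) (x y a b c s : R).

Lemma itg_dct a b (M : R) (f_ : nat -> R -> R) f :
  (forall n, continuous (f_ n)) ->
  (forall x, a <= x <= b -> f_ n x @[n --> \oo] --> f x) ->
  (forall n x, a <= x <= b -> `|f_ n x| <= M) ->
  itg a b (f_ n) @[n --> \oo] --> itg a b f.
Proof.
move=> cf ff fM.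
have [] := @Rdominated_convergence _ _ R mu `[a, b]%classic f_ f (fun=> M) => //.
- by move=> n; apply: measurable_funS (cont_measurable (cf n)).
- by apply: cont_integrable; exact: cont_cst.
Qed.

Lemma itg_split a b c f : continuous f -> a <= b -> b <= c ->
  itg a c f = itg a b f + itg b c f.
Proof.
move=> cf ab bc; apply/eqP; rewrite addrC -subr_eq; apply/eqP.
rewrite /itg Rintegral_itvB//; last exact: cont_integrable.
rewrite Rintegral_itv_obnd_cbnd//.
by apply: integrableS (cont_integrable b c cf) => //; exact: subset_itv_oc_cc.
Qed.

Lemma itg_supp A T f : continuous f -> 0 <= A -> A <= T ->
  (forall x, A <= `|x| -> f x = 0) -> itg (- T) T f = itg (- A) A f.
Proof.
move=> cf A0 AT f0.
have AA : - A <= A by rewrite (le_trans _ A0)// oppr_le0.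
have TA : - T <= - A by rewrite lerN2.
rewrite (itg_split cf TA (le_trans AA AT)) (itg_split cf AA AT).
have -> : itg (- T) (- A) f = 0.
  rewrite (@eq_itg _ _ _ _ (fun=> 0)) ?itg_cst ?mul0r// => x /andP[_ h].
  by apply: f0; rewrite ler_normr lerNr h orbT.
have -> : itg A T f = 0.
  rewrite (@eq_itg _ _ _ _ (fun=> 0)) ?itg_cst ?mul0r// => x /andP[h _].
  by apply: f0; rewrite ler_normr h.
by rewrite add0r addr0.
Qed.

Lemma itg_opp a b f : continuous f -> a <= b ->
  itg (- b) (- a) f = itg a b (fun x => f (- x)).
Proof.
move=> cf ab; rewrite /itg /Rintegral integration_by_substitution_oppr//.
exact: continuous_subspaceT.
Qed.

Lemma itg_affine a b c s f : continuous f -> 0 < s -> a <= b ->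
  itg (s * a + c) (s * b + c) f = s * itg a b (fun x => f (s * x + c)).
Proof.
move=> cf s0 ab; pose F x := s * x + c.
have dF x : is_derive x (1 : R) F s.
  apply: (is_derive_eq (is_deriveD _ _)).
  by rewrite /GRing.scale/= mulr1 addr0.
have F'E : (F^`())%classic = cst s.
  by apply/funext => x; rewrite derive1E derive_val.
have cF : continuous F by rewrite /F; cont.
rewrite -itgZ; last exact: cont_comp.
rewrite /itg /Rintegral (@integration_by_substitution_increasing _ F f a b)//.
- congr fine; apply: eq_integral => x _.
  by rewrite F'E /= mulrC.
- by move=> x y _ _ xy; rewrite /F ltrD2r ltr_pM2l.
- by rewrite F'E => x _; exact: cst_continuous.
- by rewrite F'E; exact: is_cvg_cst.
- by rewrite F'E; exact: is_cvg_cst.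
- exact: (is_derive_LRcont _ _ dF).
- exact: continuous_subspaceT.
Qed.

Lemma cvg_itg_line f : measurable_fun setT f -> mu.-integrable setT (EFin \o f) ->
  forall u v : nat -> R, u n @[n --> \oo] --> -oo -> v n @[n --> \oo] --> +oo ->
  itg (u n) (v n) f @[n --> \oo] --> \int[mu]_x f x.
Proof.
move=> mf intf u v uoo voo.
rewrite (_ : (fun n => _) = fun n => \int[mu]_x ((f \_ `[u n, v n]) x)); last first.
  by apply/funext => n; rewrite /itg Rintegral_mkcond.
have [] := @Rdominated_convergence _ _ R mu setT (fun n => f \_ `[u n, v n]) f (fun x => `|f x|) => //.
- move=> n; apply/(measurable_restrictT _ _).1 => //.
  exact: measurable_funS mf.
- move=> x _; apply: cvg_near_cst.
  near=> n; rewrite patchE ifT// inE/= in_itv/=; apply/andP; split.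
    by near: n; apply: (cvgrNy_le uoo); rewrite num_real.
  by near: n; apply: (cvgry_ge voo); rewrite num_real.
- exact: (integrable_abse intf).
- by move=> n x _; rewrite patchE; case: ifP => // _; rewrite normr0.
Unshelve. all: end_near. Qed.

Lemma integrable_line_bound f (M : R) : continuous f -> (forall x, 0 <= f x) ->
  (forall n, itg (- n%:R) n%:R f <= M) ->
  mu.-integrable setT (EFin \o f) /\ \int[mu]_x f x <= M.
Proof.
move=> cf f0 fM.
have mf := cont_measurable cf.
pose F n := f \_ `[- n%:R, n%:R].
have F0 n x : 0 <= F n x by rewrite /F patchE; case: ifP.
have mF n : measurable_fun setT (F n).
  apply/(measurable_restrictT _ _).1 => //; exact: measurable_funS mf.
have limF x : F n x @[n --> \oo] --> f x.
  apply: cvg_near_cst; near=> n; rewrite /F patchE ifT// inE/= in_itv/=.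
  rewrite -ler_norml; near: n; exact: nbhs_infty_ger.
have fM' : (\int[mu]_x (f x)%:E <= M%:E)%E.
  apply: (@fatou_le _ _ R mu F f M%:E) => // n.
  rewrite (_ : (\int[mu]_x (F n x)%:E = \int[mu]_(x in `[(- n%:R)%R, n%:R%R]) (f x)%:E)%E).
    rewrite -[leLHS]fineK ?lee_fin; first exact: fM.
    by apply: integrable_fin_num => //; exact: cont_integrable.
  rewrite [RHS]integral_mkcond; apply: eq_integral => x _.
  by rewrite /F !patchE; case: ifP.
have intf : mu.-integrable setT (EFin \o f).
  apply/integrableP; split; first exact/measurable_EFinP.
  apply: le_lt_trans (ltry M).
  by under eq_integral do rewrite /= ger0_norm//.
by split=> //; rewrite -lee_fin /Rintegral fineK// integrable_fin_num.
Unshelve. all: end_near. Qed.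

End line_integrals.

(** * The decay weight 1/(1 + x^2) *)

Section lorentz.
Variable R : realType.
Local Notation mu := (@lebesgue_measure R).
Implicit Types (f g : R -> R) (n : nat) (x y a b c s e : R).

(** The reference weight of the decay estimates. Its antiderivative atan bounds both integrals and
    Riemann sums by multiples of pi, whatever the shift and the scale. *)
Definition lorentz x : R := (1 + x ^+ 2)^-1.

Lemma lorentz_gt0 x : 0 < lorentz x.
Proof. by rewrite invr_gt0 ltr_pwDl// sqr_ge0. Qed.

Lemma lorentz_le1 x : lorentz x <= 1.
Proof. by rewrite invf_le1 ?lerDl ?sqr_ge0// ltr_pwDl// sqr_ge0. Qed.

Let den_neq0 x : 1 + x ^+ 2 != 0.
Proof. by rewrite gt_eqF// ltr_pwDl// sqr_ge0. Qed.

Lemma continuous_lorentz : continuous lorentz.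
Proof.
move=> x; apply: cvgV => //.
suff : continuous (fun x : R => 1 + x * x) by apply.
by cont.
Qed.

Lemma is_derive_atan_affine s c x :
  is_derive x (1 : R) (fun x => atan (s * x + c)) (s * lorentz (s * x + c)).
Proof.
have h : is_derive x (1 : R) (fun x => s * x + c) s.
  apply: (is_derive_eq (is_deriveD _ _)).
  by rewrite /GRing.scale/= mulr1 addr0.
apply: (is_derive_eq (is_derive1_comp _ h)).
by rewrite mulrC.
Qed.

Lemma atanB_le x y : atan x - atan y <= pi.
Proof.
have h1 := atan_ltpi2 x; have h2 := atan_gtNpi2 y.
by rewrite lerBlDr (le_trans (ltW h1))// -lerBlDl; lra.
Qed.

Lemma itg_lorentz_le s c a b : a <= b ->
  itg a b (fun x => s * lorentz (s * x + c)) <= pi.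
Proof.
rewrite le_eqVlt => /predU1P[->|ab].
  by rewrite /itg set_itv1 Rintegral_set1 pi_ge0.
rewrite (itg_FTC ab _ (is_derive_atan_affine s c)) ?atanB_le//.
apply: contM; first exact: cont_cst.
by apply: (cont_comp continuous_lorentz); cont.
Qed.

Lemma integral_lorentz s c : 0 < s ->
  mu.-integrable setT (EFin \o (fun x => s * lorentz (s * x + c))) /\
  \int[mu]_x (s * lorentz (s * x + c)) <= pi.
Proof.
move=> s0; apply: integrable_line_bound.
- apply: contM; first exact: cont_cst.
  by apply: (cont_comp continuous_lorentz); cont.
- by move=> x; rewrite mulr_ge0 ?ltW// lorentz_gt0.
- by move=> n; apply: itg_lorentz_le; rewrite (@le_trans _ _ 0)// ?oppr_le0 ler0n.
Qed.

(** From z^2 <= 2 y^2 + 2 (y - z)^2. *)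
Lemma lorentz_near y z : (y - z) ^+ 2 <= 1 -> lorentz y <= 3 * lorentz z.
Proof.
move=> yz; rewrite /lorentz -[3]invrK -invfM lef_pV2 ?posrE ?mulr_gt0 ?invr_gt0//; last 2 first.
- by rewrite ltr_pwDl// sqr_ge0.
- by rewrite ltr_pwDl// sqr_ge0.
rewrite ler_pdivrMl//; nra.
Qed.

(* Between two nodes at distance e <= 1 the weight changes by a factor at most
   3, so the Riemann sum telescopes against atan. *)
Lemma sum_lorentz_le e c n : 0 < e -> e <= 1 ->
  \sum_(k < n) e * lorentz (e * k%:R + c) <= 3 * pi.
Proof.
move=> e0 e1.
apply: (@le_trans _ _ (3 * (atan (e * n%:R + c) - atan (e * 0%:R + c)))); last first.
  by rewrite ler_pM2l// atanB_le.
elim: n => [|n IH]; first by rewrite big_ord0 subrr mulr0.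
rewrite big_ord_recr/=.
suff : e * lorentz (e * n%:R + c) <= 3 * (atan (e * n.+1%:R + c) - atan (e * n%:R + c)).
  move: IH; lra.
have lt1 : e * n%:R + c < e * n.+1%:R + c.
  by rewrite ltrD2r ltr_pM2l// ltr_nat.
have [|z zn ->] := @MVT R atan lorentz _ _ lt1.
  by apply: continuous_subspaceT => x; exact: continuous_atan.
have -> : 3 * (lorentz z * (e * n.+1%:R + c - (e * n%:R + c))) = e * (3 * lorentz z).
  by rewrite -natr1; ring.
by rewrite ler_pM2l// lorentz_near//; move: zn; rewrite in_itv/= -natr1 => /andP[? ?]; nra.
Qed.

End lorentz.

(** * Dilated plateaus and their transforms *)

Section dilated_plateau.
Variable R : realType.
Local Notation mu := (@lebesgue_measure R).
Implicit Types (n N : nat) (x y z a b c s e w : R).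

Definition dil s w : R := plateau (w / s).

Lemma cinfty_dil s : cinfty (dil s).
Proof.
move=> n; apply: (@kdiff_eq _ _ (fun w => plateau (s^-1 * w + 0))).
  by move=> w; rewrite addr0 mulrC.
exact/kdiff_affine/cinfty_plateau.
Qed.

Lemma cont_dil s : continuous (dil s).
Proof. exact/cinfty_continuous/cinfty_dil. Qed.

Lemma dilN s w : dil s (- w) = dil s w.
Proof. by rewrite /dil mulNr plateauN. Qed.

Lemma dil0 s w : 0 < s -> 2 * s <= `|w| -> dil s w = 0.
Proof.
by move=> s0 h; rewrite /dil plateau0// normrM normfV (gtr0_norm s0) ler_pdivlMr.
Qed.

Lemma dil1 s w : 0 < s -> `|w| <= s -> dil s w = 1.
Proof.
move=> s0 h; rewrite /dil plateau1// normrM normfV (gtr0_norm s0).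
by rewrite ler_pdivrMr// mul1r.
Qed.

Lemma dil_bounded s : 0 < s -> exists2 M : R, 0 <= M & forall w, `|dil s w| <= M.
Proof.
move=> s0; have [M M0 h] := cont_bounded (- (2 * s)) (2 * s) (@cont_dil s).
exists M => // w; have [/h//|] := boolP (- (2 * s) <= w <= 2 * s).
by rewrite -ler_norml -ltNge => /ltW /(dil0 s0) ->; rewrite normr0.
Qed.

Lemma ccinfty_dil s : 0 < s -> ccinfty (2 * s) (dil s).
Proof. by move=> s0; split; [exact: cinfty_dil|move=> x /ltW; exact: dil0]. Qed.

(* [dil s] is even, so its inverse Fourier transform is a cosine integral. *)
Definition gs s : R -> R := cosT (2 * s) (dil s).

Lemma gs_supp s T y : 0 < s -> 2 * s <= T ->
  gs s y = itg (- T) T (fun w => dil s w * cos (2 * pi * (y * w))).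
Proof.
move=> s0 sT; have cd := @cont_dil s; rewrite /gs /cosT -(@itg_supp _ (2 * s) T)//.
- by cont.
- by rewrite mulr_ge0 ?ltW.
- by move=> x h; rewrite dil0// mul0r.
Qed.

Lemma itg_dil_sin s T y : 0 < s -> 2 * s <= T ->
  itg (- T) T (fun w => dil s w * sin (2 * pi * (y * w))) = 0.
Proof.
move=> s0 sT; have cd := @cont_dil s.
have TT : - T <= T.
  by have := lt_le_trans (mulr_gt0 (@ltr0Sn R 1) s0) sT; move=> /ltW; lra.
pose f w := dil s w * sin (2 * pi * (y * w)).
have cf : continuous f by rewrite /f; cont.
have := itg_opp cf TT; rewrite opprK => h.
have h' : itg (- T) T (fun x => f (- x)) = - itg (- T) T f.
  rewrite -itgN//; apply: eq_itg => x _.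
  by rewrite /f dilN !mulrN sinN mulrN.
by move: h; rewrite h' -/(itg _ _ f); lra.
Qed.

Lemma gsN s y : gs s (- y) = gs s y.
Proof.
rewrite /gs /cosT; apply: eq_itg => w _.
by rewrite mulNr mulrN cosN.
Qed.

Lemma gs_scale s y : 0 < s -> gs s y = s * gs 1 (s * y).
Proof.
move=> s0; rewrite /gs /cosT mulr1.
have cd := @cont_dil s.
have h := @itg_affine R (-2) 2 0 s (fun w => dil s w * cos (2 * pi * (y * w))) _ s0 _.
rewrite (_ : - (2 * s) = s * - 2 + 0); last by ring.
rewrite (_ : 2 * s = s * 2 + 0); last by ring.
rewrite h//; first last; [lra|by cont|].
congr (s * _); apply: eq_itg => w _; rewrite addr0 /dil divr1.
rewrite [s * w / s]mulrAC divff ?gt_eqF// mul1r; congr (_ * cos _); ring.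
Qed.

Let s2_gt0 s : 0 < s -> 0 < 2 * s. Proof. by move=> s0; rewrite mulr_gt0. Qed.

Lemma cinfty_gs s : 0 < s -> cinfty (gs s).
Proof.
by move=> s0 n; have [] := cinfty_trigT (s2_gt0 s0) n (ccinfty_dil s0).
Qed.

Lemma cont_gs s : 0 < s -> continuous (gs s).
Proof. by move=> s0; exact/cinfty_continuous/cinfty_gs. Qed.

Lemma gs_schwartz s k n : 0 < s -> exists2 M : R, 0 <= M &
  forall y, `|y ^+ k * derive1n n (gs s) y| <= M.
Proof.
move=> s0; have [M M0 h] := decay_derive_trigT (s2_gt0 s0) k n (ccinfty_dil s0).
by exists M => // y; have [] := h y.
Qed.

(** Since (1 + y^2)^2 = 1 + 2 y^2 + y^4, the Schwartz bounds of orders 0, 2 and 4 suffice. The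
    weight is squared because [kap_bound] and [gs_pair_bound] spend one factor on an integral or a
    sum and keep the other as decay. *)
Lemma gs_decay s n : 0 < s -> exists2 C : R, 0 <= C &
  forall y, `|derive1n n (gs s) y| <= C * lorentz y ^+ 2.
Proof.
move=> s0; have [M0 M00 h0] := gs_schwartz 0 n s0.
have [M2 M20 h2] := gs_schwartz 2 n s0.
have [M4 M40 h4] := gs_schwartz 4 n s0.
exists (M0 + 2 * M2 + M4); first by rewrite !addr_ge0// mulr_ge0.
move=> y; rewrite /lorentz exprVn ler_pdivlMr; last first.
  by rewrite exprn_gt0// ltr_pwDl// sqr_ge0.
rewrite -[X in _ * X]gtr0_norm; last by rewrite exprn_gt0// ltr_pwDl// sqr_ge0.
rewrite -normrM; move: (h0 y) (h2 y) (h4 y); move: (derive1n _ _ _) => D.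
rewrite expr0 mul1r.
have -> : D * (1 + y ^+ 2) ^+ 2 = D + 2 * (y ^+ 2 * D) + y ^+ 4 * D by ring.
move: (y ^+ 2 * D) (y ^+ 4 * D) => D2 D4 hD hD2 hD4.
rewrite (le_trans (ler_normD _ _))// lerD// (le_trans (ler_normD _ _))// lerD//.
by rewrite normrM ger0_norm// ler_pM2l.
Qed.

(** Mean value theorem; e <= 1 allows [lorentz_near] to move the decay from the intermediate point
    to y. The gained factor e is what later makes the operator N small. *)
Lemma gs_diff s : 0 < s -> exists2 C : R, 0 <= C &
  forall e y, 0 < e -> e <= 1 -> `|gs s y - gs s (y - e)| <= e * C * lorentz y.
Proof.
move=> s0; have [C C0 h] := gs_decay 1 s0.
exists (3 * C); first by rewrite mulr_ge0.
move=> e y e0 e1.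
have [df _] := cinfty_derive (cinfty_gs s0).
have lt : y - e < y by rewrite ltrBlDr ltrDl.
have [|z zy ->] := @MVT R (gs s) (gs s)^`()%classic _ _ lt.
  by apply: continuous_subspaceT; exact: cont_gs.
have -> : y - (y - e) = e by ring.
rewrite normrM (gtr0_norm e0) mulrC -!mulrA ler_pM2l//.
rewrite (le_trans (h z))// [leRHS]mulrCA ler_wpM2l//.
apply: (@le_trans _ _ (lorentz z)).
  by rewrite expr2 ler_piMl ?lorentz_le1// ltW// lorentz_gt0.
by apply: lorentz_near; move: zy; rewrite in_itv/= => /andP[? ?]; nra.
Qed.

(** Scaling from s = 1 gives one constant for all s, as required when s tends to infinity in the
    approximate identity. *)
Lemma gs_uniform_decay : exists2 C : R, 0 <= C &
  forall s y, 0 < s -> `|gs s y| <= C * (s * lorentz (s * y) ^+ 2).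
Proof.
have [C C0 h] := gs_decay 0 (@ltr01 R).
exists C => // s y s0; rewrite gs_scale// normrM (gtr0_norm s0).
by rewrite mulrCA ler_pM2l// h.
Qed.

End dilated_plateau.

(** * Fourier inversion and sampling on the line *)

Section symmetric_sums.
Variable R : realType.
Local Notation mu := (@lebesgue_measure R).
Implicit Types (f : R -> R) (n N : nat) (x y z a b c s e w t : R).

(** The sum of f over the integers from -N to N, written with ordinals and a real shift. *)
Definition symsum N f : R := \sum_(k < (2 * N).+1) f (k%:R - N%:R).

Lemma symsum0 f : symsum 0 f = f 0.
Proof. by rewrite /symsum big_ord_recl big_ord0 addr0 subr0. Qed.

Lemma symsumS N f : symsum N.+1 f = f (- N.+1%:R) + symsum N f + f N.+1%:R.
Proof.
rewrite /symsum mulnS add2n big_ord_recl big_ord_recr/= sub0r addrA.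
congr (_ + _ + f _).
  apply: eq_bigr => i _; congr f.
  by rewrite /bump/= add1n -!natr1; ring.
by rewrite /bump/= add1n -!natr1 natrM; ring.
Qed.

(** The sine parts of k and -k cancel. *)
Lemma symsum_cos N a t :
  symsum N (fun k => cos (a + 2 * pi * k * t)) = cos a * dirichlet N t.
Proof.
rewrite /dirichlet; elim: N => [|N IH].
  by rewrite symsum0 big_ord0 !(mulr0, mul0r, addr0) mulr1.
rewrite symsumS IH big_ord_recr/= mulrN mulNr cosB cosD; ring.
Qed.

Lemma le_symsum N f g : (forall x, f x <= g x) -> symsum N f <= symsum N g.
Proof. by move=> fg; apply: ler_sum => i _. Qed.

Lemma symsum_norm N f : `|symsum N f| <= symsum N (fun k => `|f k|).
Proof. exact: ler_norm_sum. Qed.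

Lemma symsumZ N a f : symsum N (fun k => a * f k) = a * symsum N f.
Proof. by rewrite /symsum mulr_sumr. Qed.

Lemma symsum_lorentz_le N e y : 0 < e -> e <= 1 ->
  symsum N (fun k => e * lorentz (e * k - y)) <= 3 * pi.
Proof.
move=> e0 e1; apply: le_trans (sum_lorentz_le (- (e * N%:R) - y) (2 * N).+1 e0 e1).
by rewrite /symsum le_eqVlt; apply/orP; left; apply/eqP; apply: eq_bigr => i _;
  congr (_ * lorentz _); ring.
Qed.

Lemma symsum_gs_bounded s : 0 < s -> exists2 M : R, 0 <= M &
  forall e N y, 0 < e -> e <= 1 -> symsum N (fun k => e * `|gs s (e * k - y)|) <= M.
Proof.
move=> s0; have [C C0 h] := gs_decay 0 s0.
exists (C * (3 * pi)); first by rewrite !mulr_ge0 ?pi_ge0.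
move=> e N y e0 e1.
apply: (@le_trans _ _ (symsum N (fun k => C * (e * lorentz (e * k - y))))).
  apply: le_symsum => k; rewrite mulrCA ler_pM2l// (le_trans (h _))//.
  by rewrite ler_wpM2l// expr2 ler_piMl ?lorentz_le1// ltW// lorentz_gt0.
by rewrite symsumZ ler_wpM2l// symsum_lorentz_le.
Qed.

Lemma cos_norm_le1 t : `|cos t| <= 1.
Proof. by rewrite ler_norml cos_geN1 cos_le1. Qed.

Lemma sin_norm_le1 t : `|sin t| <= 1.
Proof. by rewrite ler_norml sin_geN1 sin_le1. Qed.

(** The samples of [gs s] on the lattice are Fourier coefficients of [dil s] on the period [-T, T],
    T = 1/(2e), and 2s <= T places the support of [dil s] inside one period. The symmetric partial
    sum is therefore a Dirichlet integral, and [dirichlet_cvg] evaluates its limit at w. *)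
Lemma gs_series_cvg e s y z w : 0 < e -> 0 < s -> 2 * s <= (2 * e)^-1 ->
  `|w| < (2 * e)^-1 ->
  symsum N (fun k => e * gs s (e * k - y) * cos (2 * pi * ((z - e * k) * w)))
    @[N --> \oo] --> dil s w * cos (2 * pi * ((z - y) * w)).
Proof.
move=> e0 s0 sT wT; set T := (2 * e)^-1 in sT wT *.
have cd := @cont_dil R s.
pose p v := dil s v * cos (2 * pi * (z * w - y * v)).
have cp : continuous p by rewrite /p; cont.
have dp : derivable p w 1.
  have [d1 _] := cinfty_derive (@cinfty_dil R s).
  apply: derivableM; first by have [] := d1 w.
  have := @is_derive_cosl R (- (2 * pi * y)) (2 * pi * (z * w)) w.
  rewrite (_ : (fun v => _) = (fun v => cos (2 * pi * (z * w - y * v)))); first by case.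
  by apply/funext => v; congr cos; ring.
suff E N : symsum N (fun k => e * gs s (e * k - y) * cos (2 * pi * ((z - e * k) * w))) =
    itg (- T) T (fun v => p v * (e * dirichlet N (e * (v - w)))).
  have := dirichlet_cvg e0 cp (DeriveDef dp erefl) wT.
  rewrite [p w]/p -mulrBl; apply: cvg_trans; apply: near_eq_cvg.
  by apply: nearW => N; rewrite E.
symmetry.
(* The addition formula separates v from the constant phase in z and w; the sine term integrates to
   0 because [dil s] is even. *)
pose F (k : 'I_(2 * N).+1) v := e * cos (2 * pi * ((z - e * (k%:R - N%:R)) * w)) *
     (dil s v * cos (2 * pi * ((e * (k%:R - N%:R) - y) * v))) +
   - (e * sin (2 * pi * ((z - e * (k%:R - N%:R)) * w))) *
     (dil s v * sin (2 * pi * ((e * (k%:R - N%:R) - y) * v))).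
have cF k : continuous (F k) by rewrite /F; cont.
transitivity (itg (- T) T (fun v => \sum_k F k v)).
  apply: eq_itg => v _.
  rewrite mulrCA -mulrA -symsum_cos /symsum !mulr_sumr; apply: eq_bigr => k _.
  rewrite /F; set c := k%:R - N%:R.
  have -> : 2 * pi * (z * w - y * v) + 2 * pi * c * (e * (v - w)) =
    2 * pi * ((z - e * c) * w) + 2 * pi * ((e * c - y) * v) by ring.
  by rewrite cosD; ring.
rewrite itg_sum// /symsum; apply: eq_bigr => k _.
rewrite /F itgD ?itgZ; try by cont.
rewrite -(gs_supp _ s0 sT) (itg_dil_sin _ s0 sT); ring.
Qed.

Lemma itg_telescope e a n f : continuous f -> 0 <= e ->
  \sum_(k < n) itg (a + e * k%:R) (a + e * k.+1%:R) f = itg a (a + e * n%:R) f.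
Proof.
move=> cf e0; elim: n => [|n IH].
  by rewrite big_ord0 mulr0 addr0 /itg set_itv1 Rintegral_set1.
rewrite big_ord_recr/= IH -itg_split//.
  by rewrite lerDl mulr_ge0.
by rewrite lerD2l ler_wpM2l// ler_nat.
Qed.

Lemma integrable_gs s (f : R -> R) : 0 < s -> continuous f -> (forall x, `|f x| <= 1) ->
  mu.-integrable setT (EFin \o (fun t => gs s t * f t)).
Proof.
move=> s0 cf f1; have [C C0 h] := gs_decay 0 s0; have cg := cont_gs s0.
have [i1 _] := @integral_lorentz R 1 0 ltr01.
apply: (@le_integrable_norm _ _ _ mu setT _ (fun t => C * (1 * lorentz (1 * t + 0)))) => //.
- by apply: measurable_funM; apply: cont_measurable.
- exact: RintegrableZ.
- move=> t _; rewrite normrM !mul1r addr0 -[leRHS]mulr1 ler_pM//.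
  rewrite (le_trans (h t))// ler_wpM2l//.
  by rewrite expr2 ler_piMl ?lorentz_le1// ltW// lorentz_gt0.
Qed.

(** The limit in [gs_series_cvg], with y = t and z = x + t, does not depend on t. Integrating the
    series over t in one cell [0, e] turns the lattice sum into an integral over the line. *)
Lemma gs_inversion s x w : 0 < s ->
  \int[mu]_t (gs s t * cos (2 * pi * ((x - t) * w))) = dil s w * cos (2 * pi * (x * w)).
Proof.
(* Then e <= 1 and 1/(2e) = 1/2 + 2s + |w|, which exceeds both 2s and |w|. *)
move=> s0; pose e := (1 + 4 * s + 2 * `|w|)^-1.
have i0 : 1 <= 1 + 4 * s + 2 * `|w| by have := normr_ge0 w; lra.
have e0 : 0 < e by rewrite invr_gt0 (lt_le_trans _ i0).
have e1 : e <= 1 by rewrite invf_le1// (lt_le_trans _ i0).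
have TE : (2 * e)^-1 = (1 + 4 * s + 2 * `|w|) / 2 by rewrite invfM invrK mulrC.
have sT : 2 * s <= (2 * e)^-1 by rewrite TE; have := normr_ge0 w; lra.
have wT : `|w| < (2 * e)^-1 by rewrite TE; have := normr_ge0 w; lra.
set L := dil s w * _.
pose q t := gs s t * cos (2 * pi * ((x - t) * w)).
have cg := cont_gs s0; have cq : continuous q by rewrite /q; cont.
have cq' c : continuous (fun t => q (c - t)) by apply: (cont_comp cq); cont.
pose S N t := \sum_(k < (2 * N).+1) e * q (e * (k%:R - N%:R) - t).
have cS N : continuous (S N).
  apply: (@cont_sum R _ (index_enum 'I_(2 * N).+1) predT
    (fun k t => e * q (e * (k%:R - N%:R) - t))) => i.
  by apply: contM; [exact: cont_cst|exact: cq'].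
have SL t : S N t @[N --> \oo] --> L.
  have := @gs_series_cvg e s t (x + t) w e0 s0 sT wT.
  rewrite addrK; apply: cvg_trans; apply: near_eq_cvg; apply: nearW => N.
  rewrite /S /symsum; apply: eq_bigr => k _; rewrite /q -mulrA.
  by congr (_ * (_ * cos (_ * (_ * _)))); ring.
have [M M0 hM] := symsum_gs_bounded s0.
have SM N t : `|S N t| <= M.
  apply: le_trans (hM e N t e0 e1); rewrite (le_trans (ler_norm_sum _ _ _))//.
  apply: ler_sum => k _; rewrite normrM (gtr0_norm e0) ler_pM2l// normrM.
  by rewrite -[leRHS]mulr1 ler_pM// cos_norm_le1.
have h1 : itg 0 e (S N) @[N --> \oo] --> e * L.
  have -> : e * L = itg 0 e (fun=> L) by rewrite itg_cst ?ltW// subr0 mulrC.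
  by apply: (itg_dct (M := M)).
(* The translates of [-e, 0] by e(k - N), 0 <= k <= 2N, tile [-e(N + 1), eN]. *)
have h2 N : itg 0 e (S N) = e * itg (- (e * N.+1%:R)) (e * N%:R) q.
  rewrite /S (@itg_sum _ _ _ _ _ (fun (k : 'I_(2 * N).+1) t => e * q (e * (k%:R - N%:R) - t))); last first.
    by move=> i; apply: contM; [exact: cont_cst|exact: cq'].
  have -> : e * N%:R = - (e * N.+1%:R) + e * ((2 * N).+1)%:R.
    by rewrite -!natr1 natrM; ring.
  rewrite -itg_telescope ?(ltW e0)// mulr_sumr; apply: eq_bigr => k _.
  rewrite itgZ//; congr (_ * _); set c := e * (k%:R - N%:R).
  have cqc : continuous (fun t => q (t + c)) by apply: (cont_comp cq); cont.
  have := itg_opp cqc (ltW e0); rewrite oppr0.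
  under [X in _ = X -> _]eq_itg do rewrite addrC.
  move=> <-; have := @itg_affine R (- e) 0 c 1 q cq ltr01 _.
  rewrite oppr_le0 (ltW e0) => /(_ isT).
  rewrite !mul1r add0r; under [X in _ = X -> _]eq_itg do rewrite mul1r.
  move=> <-.
  have -> : - (e * N.+1%:R) + e * k%:R = - e + c by rewrite /c -natr1; ring.
  by have -> : - (e * N.+1%:R) + e * k.+1%:R = c by rewrite /c -!natr1; ring.
have cosc : continuous (fun t => cos (2 * pi * ((x - t) * w))) by cont.
have iq : mu.-integrable setT (EFin \o q).
  by apply: integrable_gs => // t; exact: cos_norm_le1.
have u1 : (- (e * N.+1%:R)) @[N --> \oo] --> -oo.
  apply/cvgrNyPle => A; near=> N; rewrite lerNl -ler_pdivrMl//.
  rewrite (@le_trans _ _ N%:R) ?ler_nat//.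
  by near: N; exact: nbhs_infty_ger.
have u2 : (e * N%:R) @[N --> \oo] --> +oo.
  apply/cvgryPge => A; near=> N; rewrite -ler_pdivrMl//.
  by near: N; exact: nbhs_infty_ger.
have h3 := cvg_itg_line (cont_measurable cq) iq u1 u2.
have h4 : e * itg (- (e * N.+1%:R)) (e * N%:R) q @[N --> \oo] --> e * \int[mu]_t q t.
  by apply: cvgM => //; exact: cvg_cst.
have e_neq0 : e != 0 by rewrite gt_eqF.
apply: (mulfI e_neq0); apply: (cvg_unique _ h4) => //.
by move: h1; under eq_fun do rewrite h2.
Unshelve. all: end_near. Qed.

(** Multiply [gs_series_cvg] for the plateau 2s by [dil s w] and integrate in w. The doubled
    parameter is there because [dil (2 * s)] equals 1 on the support [-2s, 2s] of [dil s]; its own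
    support needs 4s <= 1/(2e). Domination comes from [symsum_gs_bounded], which is uniform in N. *)
Lemma sampling e s x y : 0 < e -> e <= 1 -> 0 < s -> 4 * s <= (2 * e)^-1 ->
  symsum N (fun k => e * gs (2 * s) (e * k - y) * gs s (x - e * k))
    @[N --> \oo] --> gs s (x - y).
Proof.
move=> e0 e1 s0 sT; have s20 : 0 < 2 * s by rewrite mulr_gt0.
have cg := @cont_dil R s.
have [M M0 hM] := symsum_gs_bounded s20.
have [M' M'0 hM'] := dil_bounded s0.
pose F N w := \sum_(k < (2 * N).+1) e * gs (2 * s) (e * (k%:R - N%:R) - y) *
     (dil s w * cos (2 * pi * ((x - e * (k%:R - N%:R)) * w))).
have FE N : itg (- (2 * s)) (2 * s) (F N) =
    symsum N (fun k => e * gs (2 * s) (e * k - y) * gs s (x - e * k)).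
  rewrite /F (@itg_sum _ _ _ _ _ (fun (k : 'I_(2 * N).+1) w =>
    e * gs (2 * s) (e * (k%:R - N%:R) - y) *
     (dil s w * cos (2 * pi * ((x - e * (k%:R - N%:R)) * w))))); last by move=> i; cont.
  by apply: eq_bigr => k _; rewrite itgZ//; cont.
have FE' N w : F N w = dil s w * symsum N (fun k => e * gs (2 * s) (e * k - y) *
    cos (2 * pi * ((x - e * k) * w))).
  by rewrite /symsum mulr_sumr; apply: eq_bigr => k _; ring.
have -> : gs s (x - y) = itg (- (2 * s)) (2 * s) (fun w =>
    dil s w * (dil (2 * s) w * cos (2 * pi * ((x - y) * w)))).
  apply: eq_itg => w ws; rewrite (@dil1 _ (2 * s)) ?mul1r//.
  by rewrite ler_norml.
under eq_fun do rewrite -FE.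
apply: (@itg_dct _ _ _ (M' * M)).
- move=> N; apply: (@cont_sum R _ (index_enum 'I_(2 * N).+1) predT (fun k w =>
    e * gs (2 * s) (e * (k%:R - N%:R) - y) *
     (dil s w * cos (2 * pi * ((x - e * (k%:R - N%:R)) * w))))).
  by move=> i; cont.
- move=> w ws; under eq_fun do rewrite FE'.
  apply: cvgM; first exact: cvg_cst.
  apply: gs_series_cvg => //; first by rewrite mulrA -natrM.
  rewrite (@lt_le_trans _ _ (4 * s))// (@le_lt_trans _ _ (2 * s))//.
    by rewrite ler_norml.
  by lra.
- move=> N w ws; rewrite FE' normrM ler_pM// (le_trans _ (hM e N y e0 e1))//.
  rewrite (le_trans (symsum_norm _ _))//; apply: le_symsum => k.
  rewrite !normrM (gtr0_norm e0) -[leRHS]mulr1 ler_pM ?mulr_ge0 ?(ltW e0)//.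
  exact: cos_norm_le1.
Qed.

End symmetric_sums.

(** * Integration on R^d *)

Section real_integrals.
Context d (T : measurableType d) (R : realType).
Variable mu : {measure set T -> \bar R}.
Implicit Types (f g : T -> R).

Lemma integrable_mfun f : mu.-integrable setT (EFin \o f) -> measurable_fun setT f.
Proof. by move=> /measurable_int /measurable_EFinP. Qed.

Lemma integrable_bounded f g (M : R) : mu.-integrable setT (EFin \o f) ->
  measurable_fun setT g -> (forall x, `|g x| <= M) ->
  mu.-integrable setT (EFin \o (fun x => f x * g x)).
Proof.
move=> fi mg gM; have fi' := RintegrableZ M measurableT (integrable_abse fi).
apply: (le_integrable_norm _ _ fi') => //.
  by apply: measurable_funM => //; exact: integrable_mfun.
by move=> x _; rewrite normrM mulrC ler_wpM2r.
Qed.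

Lemma measurable_bigprod (I : Type) (r : seq I) (f : I -> T -> R) :
  (forall i, measurable_fun setT (f i)) ->
  measurable_fun setT (fun x => \prod_(i <- r) f i x).
Proof.
move=> mf; elim: r => [|i r IH].
  by under eq_fun do rewrite big_nil; exact: measurable_cst.
by under eq_fun do rewrite big_cons; exact: measurable_funM.
Qed.

Lemma measurable_bigsum (I : Type) (r : seq I) (f : I -> T -> R) :
  (forall i, measurable_fun setT (f i)) ->
  measurable_fun setT (fun x => \sum_(i <- r) f i x).
Proof.
move=> mf; elim: r => [|i r IH].
  by under eq_fun do rewrite big_nil; exact: measurable_cst.
by under eq_fun do rewrite big_cons; exact: measurable_funD.
Qed.

Lemma measurable_dotr n (a b : T -> 'rV[R]_n) :
  (forall i, measurable_fun setT (fun t => a t ord0 i)) ->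
  (forall i, measurable_fun setT (fun t => b t ord0 i)) ->
  measurable_fun setT (fun t => dotr (a t) (b t)).
Proof. by move=> ma mb; apply: measurable_bigsum => i; exact: measurable_funM. Qed.

Lemma measurable_cosf f : measurable_fun setT f -> measurable_fun setT (fun t => cos (f t)).
Proof. by move=> mf; apply: measurableT_comp => //; apply: cont_measurable; exact: continuous_cos. Qed.

Lemma measurable_sinf f : measurable_fun setT f -> measurable_fun setT (fun t => sin (f t)).
Proof. by move=> mf; apply: measurableT_comp => //; apply: cont_measurable; exact: continuous_sin. Qed.

End real_integrals.

(** * Integrals of tensor products *)

Section tensor.
Variable R : realType.
Local Notation lam := (@lebesgue_measure R).
Local Notation mu := (lebesgue_rV R).
Local Open Scope ereal_scope.

Lemma uncons_rVK d : cancel (@uncons_rV R d) (@cons_rV R d).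
Proof.
move=> x; apply/rowP => i; rewrite /cons_rV /uncons_rV mxE.
case: splitP => j /= ij; rewrite !mxE.
  by congr (x _ _); apply/val_inj; rewrite /= ij ord1.
by congr (x _ _); apply/val_inj; rewrite /= ij /fintype.bump add1n.
Qed.

Lemma cons_rV0 d a (y : 'rV[R]_d) : (cons_rV (a, y)) ord0 ord0 = a.
Proof. by have [] := cons_rVK (a, y). Qed.

Lemma cons_rVS d a (y : 'rV[R]_d) i : (cons_rV (a, y)) ord0 (lift ord0 i) = y ord0 i.
Proof. by have [_ /rowP/(_ i)] := cons_rVK (a, y); rewrite mxE. Qed.

Lemma ge0_integral_cons d (f : 'rV[R]_d.+1 -> \bar R) :
  measurable_fun setT f -> (forall x, 0 <= f x) ->
  \int[mu d.+1]_x f x = \int[lam]_a \int[mu d]_y f (cons_rV (a, y)).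
Proof.
move=> mf f0.
transitivity (\int[pushforward (lam \x mu d) (@cons_rV R d)]_x f x).
  by apply: eq_measure_integral => A mA _.
rewrite ge0_integral_pushforward//.
rewrite (@fubini_tonelli1 _ _ _ _ _ lam (mu d) (f \o @cons_rV R d))//.
  by apply: measurableT_comp => //; exact: measurable_cons_rV.
by move=> x; exact: f0.
Qed.

Lemma integral_cons d (f : 'rV[R]_d.+1 -> \bar R) :
  measurable_fun setT f ->
  (lam \x mu d).-integrable setT (f \o @cons_rV R d) ->
  (mu d.+1).-integrable setT f /\
  \int[mu d.+1]_x f x = \int[lam]_a \int[mu d]_y f (cons_rV (a, y)).
Proof.
move=> mf fi; split.
  apply/integrableP; split=> //; rewrite ge0_integral_cons//.
    2: exact: measurableT_comp.
  move/integrableP : fi => [mf' fi].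
  have m1 : measurable_fun setT (abse \o (f \o @cons_rV R d)) by exact: measurableT_comp.
  have p1 x : 0 <= (abse \o (f \o @cons_rV R d)) x by exact: abse_ge0.
  by have := fi; rewrite (@fubini_tonelli1 _ _ _ _ _ lam (mu d) _ m1 p1).
transitivity (\int[pushforward (lam \x mu d) (@cons_rV R d)]_x f x).
  by apply: eq_measure_integral => A mA _.
rewrite integral_pushforward//.
by rewrite -(@integral12_prod_meas1 _ _ _ _ _ lam (mu d) (f \o @cons_rV R d)).
Qed.

Lemma Rintegral_tensor d (u : R -> R) (v : 'rV[R]_d -> R) (f : 'rV[R]_d.+1 -> R) :
  lam.-integrable setT (EFin \o u) -> (mu d).-integrable setT (EFin \o v) ->
  (forall a y, f (cons_rV (a, y)) = (u a * v y)%R) ->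
  (mu d.+1).-integrable setT (EFin \o f) /\
  (\int[mu d.+1]_x f x = (\int[lam]_a u a) * (\int[mu d]_y v y))%R.
Proof.
move=> ui vi fE.
have mu_ := integrable_mfun ui; have mv := integrable_mfun vi.
have mg : measurable_fun setT (fun p : R * 'rV[R]_d => (u p.1 * v p.2)%R).
  by apply: measurable_funM; apply: measurableT_comp.
have fcons : f \o @cons_rV R d = (fun p => (u p.1 * v p.2)%R).
  by apply/funext => -[a y] /=; exact: fE.
have mf : measurable_fun setT (EFin \o f).
  apply/measurable_EFinP; rewrite (_ : f = (f \o @cons_rV R d) \o @uncons_rV R d).
    rewrite fcons; apply: measurableT_comp => //; exact: measurable_uncons_rV.
  by apply/funext => x /=; rewrite uncons_rVK.
have fi : (lam \x mu d).-integrable setT ((EFin \o f) \o @cons_rV R d).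
  rewrite -compA fcons; apply/integrable12ltyP; first exact/measurable_EFinP.
  rewrite [ltLHS](_ : _ = \int[lam]_x (`|(u x)%:E| * \int[mu d]_y `|(v y)%:E|)).
    rewrite ge0_integralZr//; last by apply: integral_ge0.
      move/integrableP : ui => [_ ui]; move/integrableP : vi => [_ vi].
      by rewrite lte_mul_pinfty// ?integral_ge0// ge0_fin_numE// integral_ge0.
    by apply: measurableT_comp => //; exact/measurable_EFinP.
  apply: eq_integral => x _; rewrite -ge0_integralZl//.
    by apply: eq_integral => y _; rewrite /= normrM EFinM.
  by apply: measurableT_comp => //; exact/measurable_EFinP.
have [i1 i2] := integral_cons mf fi; split=> //.
rewrite /Rintegral i2 -fineM ?integrable_fin_num//.
congr fine; transitivity (\int[lam]_a ((u a)%:E * \int[mu d]_y (v y)%:E)).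
  apply: eq_integral => a _; rewrite -integralZl//.
  by apply: eq_integral => y _; rewrite /= fE EFinM.
have vE : \int[mu d]_y (v y)%:E = (fine (\int[mu d]_y (v y)%:E))%:E.
  by rewrite fineK// integrable_fin_num.
by rewrite vE integralZr.
Qed.

End tensor.

(** * Fourier pairs and their tensor products *)

Section fourier_pairs.
Variable R : realType.
Local Notation lam := (@lebesgue_measure R).
Local Notation mu := (lebesgue_rV R).

Definition pd d (u : 'I_d -> R -> R) (x : 'rV[R]_d) : R := \prod_i u i (x ord0 i).

(* [v] is the Fourier transform of the even function [u]; the shift by [x] is kept so that the
   property tensorises. *)
Definition FTpair (u v : R -> R) := forall w x : R,
  \int[lam]_t (u t * cos (2 * pi * ((x - t) * w))) = v w * cos (2 * pi * (x * w)) /\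
  \int[lam]_t (u t * sin (2 * pi * ((x - t) * w))) = v w * sin (2 * pi * (x * w)).

Lemma measurable_pd d (u : 'I_d -> R -> R) :
  (forall i, measurable_fun setT (u i)) -> measurable_fun setT (pd u).
Proof.
move=> mu_; apply: measurable_bigprod => i; apply: measurableT_comp => //.
exact: measurable_coord.
Qed.

Lemma measurable_rVB d (x : 'rV[R]_d) i :
  measurable_fun setT (fun t : 'rV[R]_d => (x - t) ord0 i).
Proof.
under eq_fun do rewrite !mxE.
by apply: measurable_funB => //; exact: measurable_coord.
Qed.

Lemma measurable_dotrB d (x w : 'rV[R]_d) :
  measurable_fun setT (fun t : 'rV[R]_d => 2 * pi * dotr (x - t) w).
Proof.
apply: measurable_funM => //; apply: measurable_dotr => i //.
exact: measurable_rVB.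
Qed.

Lemma integral_rV0 (f : 'rV[R]_0 -> R) : measurable_fun setT f ->
  (mu 0).-integrable setT (EFin \o f) /\ \int[mu 0]_x f x = f 0.
Proof.
move=> mf; have E : (\int[mu 0]_x (f x)%:E = (f 0)%:E)%E.
  by rewrite integral_dirac//; [rewrite diracT mul1e|exact/measurable_EFinP].
split; last by rewrite /Rintegral E.
apply/integrableP; split; first exact/measurable_EFinP.
rewrite integral_dirac//; first by rewrite diracT mul1e ltry.
by apply: measurableT_comp => //; exact/measurable_EFinP.
Qed.

Lemma pd_cons d (u : 'I_d.+1 -> R -> R) a (y : 'rV[R]_d) :
  pd u (cons_rV (a, y)) = u ord0 a * pd (fun i => u (lift ord0 i)) y.
Proof.
rewrite /pd big_ord_recl cons_rV0; congr (_ * _).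
by apply: eq_bigr => i _; rewrite cons_rVS.
Qed.

Lemma integrable_pd d (u : 'I_d -> R -> R) :
  (forall i, lam.-integrable setT (EFin \o u i)) ->
  (mu d).-integrable setT (EFin \o pd u) /\
  \int[mu d]_x pd u x = \prod_i \int[lam]_t u i t.
Proof.
elim: d u => [|d IH] u ui.
  have [|i1 i2] := @integral_rV0 (pd u).
    by apply: measurable_pd => -[].
  by split=> //; rewrite i2 /pd !big_ord0.
have [i1 i2] := IH (fun i => u (lift ord0 i)) (fun i => ui _).
have [j1 j2] := Rintegral_tensor (ui ord0) i1 (pd_cons u).
by split=> //; rewrite j2 i2 big_ord_recl.
Qed.

Lemma rV_subE d (x y : 'rV[R]_d) i j : (x - y) i j = x i j - y i j.
Proof. by rewrite !mxE. Qed.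

Lemma dotr_cons d (x w : 'rV[R]_d.+1) a (y : 'rV[R]_d) :
  dotr (x - cons_rV (a, y)) w =
  (x ord0 ord0 - a) * w ord0 ord0 + dotr ((uncons_rV x).2 - y) (uncons_rV w).2.
Proof.
rewrite /dotr big_ord_recl rV_subE cons_rV0; congr (_ + _).
by apply: eq_bigr => i _; rewrite !rV_subE cons_rVS !mxE.
Qed.

Lemma integrable_cosM (u : R -> R) (x w : R) : lam.-integrable setT (EFin \o u) ->
  lam.-integrable setT (EFin \o (fun t => u t * cos (2 * pi * ((x - t) * w)))) /\
  lam.-integrable setT (EFin \o (fun t => u t * sin (2 * pi * ((x - t) * w)))).
Proof.
move=> ui; split; apply: (integrable_bounded (M := 1)) => //.
- by apply: cont_measurable; cont.
- by move=> t; exact: cos_norm_le1.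
- by apply: cont_measurable; cont.
- by move=> t; exact: sin_norm_le1.
Qed.

Lemma integrable_pd_cos d (u : 'I_d -> R -> R) (x w : 'rV[R]_d) :
  (forall i, lam.-integrable setT (EFin \o u i)) ->
  (mu d).-integrable setT (EFin \o (fun t => pd u t * cos (2 * pi * dotr (x - t) w))) /\
  (mu d).-integrable setT (EFin \o (fun t => pd u t * sin (2 * pi * dotr (x - t) w))).
Proof.
move=> /integrable_pd[ui _]; split; apply: (integrable_bounded (M := 1)) => //.
- by apply: measurable_cosf; exact: measurable_dotrB.
- by move=> t; exact: cos_norm_le1.
- by apply: measurable_sinf; exact: measurable_dotrB.
- by move=> t; exact: sin_norm_le1.
Qed.

(** The shape produced by the addition formulas of cosine and sine, with c = -1 or c = 1. *)
Lemma Rintegral_tensor2 d (a1 a2 : R -> R) (b1 b2 : 'rV[R]_d -> R) (f : 'rV[R]_d.+1 -> R) (c : R) :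
  lam.-integrable setT (EFin \o a1) -> lam.-integrable setT (EFin \o a2) ->
  (mu d).-integrable setT (EFin \o b1) -> (mu d).-integrable setT (EFin \o b2) ->
  (forall a y, f (cons_rV (a, y)) = a1 a * b1 y + c * (a2 a * b2 y)) ->
  \int[mu d.+1]_x f x = (\int[lam]_a a1 a) * (\int[mu d]_y b1 y) +
    c * ((\int[lam]_a a2 a) * (\int[mu d]_y b2 y)).
Proof.
move=> a1i a2i b1i b2i fE.
pose g1 (x : 'rV[R]_d.+1) := a1 (x ord0 ord0) * b1 (@uncons_rV R d x).2.
pose g2 (x : 'rV[R]_d.+1) := a2 (x ord0 ord0) * b2 (@uncons_rV R d x).2.
have g1E a y : g1 (cons_rV (a, y)) = a1 a * b1 y by rewrite /g1 cons_rV0 cons_rVK.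
have g2E a y : g2 (cons_rV (a, y)) = a2 a * b2 y by rewrite /g2 cons_rV0 cons_rVK.
have [i1 <-] := Rintegral_tensor a1i b1i g1E.
have [i2 <-] := Rintegral_tensor a2i b2i g2E.
rewrite -RintegralZl// -RintegralD//; last exact: RintegrableZ.
congr (Rintegral _ _ _); apply/funext => x.
by rewrite -[x]uncons_rVK; case: (uncons_rV x) => a y; rewrite fE g1E g2E.
Qed.

(** Induction on the dimension. Cosine and sine are carried together because the addition formulas
    mix them. *)
Lemma pd_FT d (u v : 'I_d -> R -> R) :
  (forall i, lam.-integrable setT (EFin \o u i)) ->
  (forall i, FTpair (u i) (v i)) -> forall w x : 'rV[R]_d,
  \int[mu d]_t (pd u t * cos (2 * pi * dotr (x - t) w)) = pd v w * cos (2 * pi * dotr x w) /\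
  \int[mu d]_t (pd u t * sin (2 * pi * dotr (x - t) w)) = pd v w * sin (2 * pi * dotr x w).
Proof.
elim: d u v => [|d IH] u v ui uv w x.
  have mp : measurable_fun setT (pd u) by apply: measurable_pd => -[].
  rewrite (integral_rV0 _).2; last first.
    by apply: measurable_funM => //; apply: measurable_cosf; exact: measurable_dotrB.
  rewrite (integral_rV0 _).2; last first.
    by apply: measurable_funM => //; apply: measurable_sinf; exact: measurable_dotrB.
  by rewrite /pd /dotr !big_ord0.
pose u' i := u (lift ord0 i); pose v' i := v (lift ord0 i).
have ui' i : lam.-integrable setT (EFin \o u' i) by exact: ui.
set x' := (uncons_rV x).2; set w' := (uncons_rV w).2.
have [IHc IHs] := IH u' v' ui' (fun i => uv _) w' x'.
have [Hc Hs] := uv ord0 (w ord0 ord0) (x ord0 ord0).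
have [Ic Is] := integrable_cosM (x ord0 ord0) (w ord0 ord0) (ui ord0).
have [Jc Js] := integrable_pd_cos x' w' ui'.
have xw : dotr x w = x ord0 ord0 * w ord0 ord0 + dotr x' w'.
  rewrite /dotr big_ord_recl; congr (_ + _).
  by apply: eq_bigr => i _; rewrite !mxE.
have vw : pd v w = v ord0 (w ord0 ord0) * pd v' w'.
  by rewrite -{1}[w]uncons_rVK pd_cons.
split.
- rewrite (Rintegral_tensor2 (c := -1) Ic Is Jc Js); last first.
    by move=> a y; rewrite pd_cons dotr_cons mulrDr cosD -/x' -/w'; ring.
  by rewrite IHc IHs Hc Hs xw vw [2 * pi * (_ + _)]mulrDr cosD; ring.
- rewrite (Rintegral_tensor2 (c := 1) Is Ic Jc Js); last first.
    by move=> a y; rewrite pd_cons dotr_cons mulrDr sinD -/x' -/w'; ring.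
  by rewrite IHc IHs Hc Hs xw vw [2 * pi * (_ + _)]mulrDr sinD; ring.
Qed.

(** For w != 0 the sine is the cosine with x moved by the quarter period 1/(4w), so that
    [gs_inversion] covers it. *)
Lemma gs_FTpair s : 0 < s -> FTpair (gs s) (dil s).
Proof.
move=> s0 w x; split; first exact: gs_inversion.
have [->|w0] := eqVneq w 0.
  under eq_Rintegral do rewrite !mulr0 sin0 mulr0.
  by rewrite !mulr0 sin0 mulr0 Rintegral_cst// mul0r.
have E y : sin (2 * pi * (y * w)) = cos (2 * pi * ((y - (4 * w)^-1) * w)).
  by rewrite -cosBpihalf; congr cos; field; rewrite w0.
under eq_Rintegral => t _.
  rewrite E (_ : x - t - (4 * w)^-1 = (x - (4 * w)^-1) - t); last by ring.
  over.
by rewrite E; exact: gs_inversion.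
Qed.

Lemma integrable_gs1 s : 0 < s -> lam.-integrable setT (EFin \o gs s).
Proof.
move=> s0; rewrite (_ : gs s = fun t => gs s t * 1); last first.
  by apply/funext => t; rewrite mulr1.
by apply: integrable_gs => // [|x]; [exact: cont_cst|rewrite normr1].
Qed.

Lemma compact_support_line (A : R) (f : R -> R) : continuous f ->
  (forall x, A <= `|x| -> f x = 0) ->
  lam.-integrable setT (EFin \o f) /\ \int[lam]_x f x = itg (- A) A f.
Proof.
move=> cf f0.
have fE : f = f \_ `[- A, A].
  apply/funext => x; rewrite patchE; case: ifPn => // /negP.
  rewrite inE/= in_itv/= -ler_norml => /negP; rewrite -ltNge => /ltW.
  exact: f0.
split; last first.
  by rewrite /itg [RHS]Rintegral_mkcond -fE.
rewrite {1}fE -restrict_EFin.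
have h := cont_integrable (- A) A cf.
by apply/(@integrable_mkcond _ _ _ lam `[- A, A]%classic (EFin \o f)).
Qed.

Lemma integrable_dil s : 0 < s -> lam.-integrable setT (EFin \o dil s).
Proof.
move=> s0; have [] // := @compact_support_line (2 * s) (dil s) (@cont_dil _ s).
by move=> x; exact: dil0.
Qed.

Lemma dil_FTpair s : 0 < s -> FTpair (dil s) (gs s).
Proof.
move=> s0 w x; have cd := @cont_dil R s.
have ss : 2 * s <= 2 * s by [].
have gE := gs_supp w s0 ss; have sE := itg_dil_sin w s0 ss.
split.
- rewrite (@compact_support_line (2 * s) _ _ _).2; [|by cont|]; last first.
    by move=> t ts; rewrite dil0// mul0r.
  rewrite (@eq_itg _ _ _ _ (fun t => cos (2 * pi * (x * w)) * (dil s t * cos (2 * pi * (w * t))) +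
     sin (2 * pi * (x * w)) * (dil s t * sin (2 * pi * (w * t))))); last first.
    move=> t _; rewrite (_ : 2 * pi * ((x - t) * w) = 2 * pi * (x * w) - 2 * pi * (w * t)); last by ring.
    by rewrite cosB; ring.
  by rewrite itgD ?itgZ; [rewrite -gE sE; ring|by cont..].
- rewrite (@compact_support_line (2 * s) _ _ _).2; [|by cont|]; last first.
    by move=> t ts; rewrite dil0// mul0r.
  rewrite (@eq_itg _ _ _ _ (fun t => sin (2 * pi * (x * w)) * (dil s t * cos (2 * pi * (w * t))) +
     - cos (2 * pi * (x * w)) * (dil s t * sin (2 * pi * (w * t))))); last first.
    move=> t _; rewrite (_ : 2 * pi * ((x - t) * w) = 2 * pi * (x * w) - 2 * pi * (w * t)); last by ring.
    by rewrite sinB; ring.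
  by rewrite itgD ?itgZ; [rewrite -gE sE; ring|by cont..].
Qed.

End fourier_pairs.

(** * Band-limited functions reproduce under convolution *)

Section square_integrable.
Context d (T : measurableType d) (R : realType).
Variable mu : {measure set T -> \bar R}.
Implicit Types (f g v : T -> R).

Definition L2r f := measurable_fun setT f /\
  mu.-integrable setT (EFin \o (fun x => f x ^+ 2)).

(** Young's inequality; the free weight c is tuned in [L2_weak_cvg]. *)
Lemma mul_le_sqr (a b c : R) : 0 < c -> `|a * b| <= c * a ^+ 2 + c^-1 * b ^+ 2.
Proof.
move=> c0; rewrite normrM -(real_normK (num_real a)) -(real_normK (num_real b)).
move: (normr_ge0 a) (normr_ge0 b); move: `|a| `|b| => x y x0 y0.
have h : 0 <= c^-1 * (c * x - y) ^+ 2 by rewrite mulr_ge0 ?sqr_ge0// invr_ge0 ltW.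
have -> : c * x ^+ 2 + c^-1 * y ^+ 2 = c^-1 * (c * x - y) ^+ 2 + 2 * (x * y).
  by field; rewrite gt_eqF.
have := mulr_ge0 x0 y0; lra.
Qed.

Lemma L2r_mul f g : L2r f -> L2r g -> mu.-integrable setT (EFin \o (fun x => f x * g x)).
Proof.
move=> [mf fi] [mg gi]; have h := RintegrableD measurableT fi gi.
apply: (le_integrable_norm _ _ h) => //; first exact: measurable_funM.
by move=> x _; have := mul_le_sqr (f x) (g x) ltr01; rewrite invr1 !mul1r.
Qed.

Lemma L2r_bounded f (M : R) : mu.-integrable setT (EFin \o f) ->
  (forall x, `|f x| <= M) -> L2r f.
Proof.
move=> fi fM; have mf := integrable_mfun fi; split=> //.
exact: (integrable_bounded fi mf fM).
Qed.

(** Young's inequality with a weight adapted to the target error. The squared distances are extended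
    reals because their finiteness is known only for large n. *)
Lemma L2_weak_cvg (v_ : nat -> T -> R) v f :
  (forall n, measurable_fun setT (v_ n)) -> measurable_fun setT v -> L2r f ->
  (forall n, mu.-integrable setT (EFin \o (fun x => v_ n x * f x))) ->
  mu.-integrable setT (EFin \o (fun x => v x * f x)) ->
  (\int[mu]_x ((v_ n x - v x) ^+ 2)%:E)%E @[n --> \oo] --> 0%E ->
  \int[mu]_x (v_ n x * f x) @[n --> \oo] --> \int[mu]_x (v x * f x).
Proof.
move=> mv_ mv [mf fi] vi_ vi cv.
set I := fun n => (\int[mu]_x ((v_ n x - v x) ^+ 2)%:E)%E.
pose P := \int[mu]_x (f x ^+ 2).
have P0 : 0 <= P by apply: Rintegral_ge0 => x _; exact: sqr_ge0.
apply/cvgrPdist_le => e e0.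
(* With this weight the term in f is P/c <= e/2, and the other is c times at most e/(2c). Adding 1
   to P keeps c positive when f vanishes. *)
pose c := 2 * (P + 1) / e.
have c0 : 0 < c by rewrite divr_gt0// mulr_gt0// ltr_wpDl.
have h0 : 0 < e / (2 * c) by rewrite divr_gt0// mulr_gt0.
near=> n.
have In : (I n < (e / (2 * c))%:E)%E.
  near: n; move/fine_cvgP : cv => [If] /cvgrPdist_lt/(_ _ h0) hI.
  apply: filterS2 If hI => n If; rewrite sub0r normrN ger0_norm; last first.
    by rewrite fine_ge0// integral_ge0// => x _; rewrite lee_fin sqr_ge0.
  by rewrite -lte_fin fineK.
have If : I n \is a fin_num.
  rewrite ge0_fin_numE; first exact: lt_trans In (ltry _).
  by rewrite integral_ge0// => x _; rewrite lee_fin sqr_ge0.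
have msq : measurable_fun setT (fun x => (v_ n x - v x) ^+ 2).
  by apply: measurable_funX; exact: measurable_funB.
have isq : mu.-integrable setT (EFin \o (fun x => (v_ n x - v x) ^+ 2)).
  apply/integrableP; split; first exact/measurable_EFinP.
  under eq_integral do rewrite /= ger0_norm ?sqr_ge0//.
  by rewrite ltey_eq If.
rewrite distrC -RintegralB//.
have id := RintegrableB measurableT (vi_ n) vi.
apply: le_trans (le_normr_Rintegral measurableT id) _.
apply: (@le_trans _ _ (\int[mu]_x (c * (v_ n x - v x) ^+ 2 + c^-1 * f x ^+ 2))).
  apply: le_Rintegral => //.
  - exact: (integrable_abse id).
  - by apply: RintegrableD => //; exact: RintegrableZ.
  - move=> x _; rewrite -mulrBl; exact: mul_le_sqr.
rewrite RintegralD//; try exact: RintegrableZ.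
rewrite !RintegralZl// -/P.
have -> : \int[mu]_x ((v_ n x - v x) ^+ 2) = fine (I n) by [].
have In' : fine (I n) <= e / (2 * c) by rewrite -lee_fin fineK// ltW.
have h1 : c * fine (I n) <= e / 2.
  apply: (@le_trans _ _ (c * (e / (2 * c)))); first by rewrite ler_pM2l.
  by rewrite le_eqVlt; apply/orP; left; apply/eqP; field; rewrite gt_eqF.
have h2 : c^-1 * P <= e / 2.
  rewrite /c invf_div mulrAC ler_pdivrMr; last by rewrite mulr_gt0// ltr_wpDl.
  by rewrite mulrA divfK// ler_pM2l// lerDl.
lra.
Unshelve. all: end_near. Qed.

End square_integrable.

(** * Fubini's theorem with a bounded kernel *)

Section fubini_kernels.
Context d1 d2 (T1 : measurableType d1) (T2 : measurableType d2) (R : realType).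
Variable m1 : {sigma_finite_measure set T1 -> \bar R}.
Variable m2 : {sigma_finite_measure set T2 -> \bar R}.
Implicit Types (u : T1 -> R) (v : T2 -> R) (k : T1 * T2 -> R).
Local Open Scope ereal_scope.

Lemma integrable_prod u v :
  m1.-integrable setT (EFin \o u) -> m2.-integrable setT (EFin \o v) ->
  (m1 \x m2).-integrable setT (EFin \o (fun p => u p.1 * v p.2)%R).
Proof.
move=> ui vi; have mu_ := integrable_mfun ui; have mv := integrable_mfun vi.
have mg : measurable_fun setT (fun p : T1 * T2 => (u p.1 * v p.2)%R).
  by apply: measurable_funM; apply: measurableT_comp.
apply/integrable12ltyP; first exact/measurable_EFinP.
rewrite [ltLHS](_ : _ = \int[m1]_x (`|(u x)%:E| * \int[m2]_y `|(v y)%:E|)).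
  rewrite ge0_integralZr//; last by apply: integral_ge0.
    move/integrableP : ui => [_ ui]; move/integrableP : vi => [_ vi].
    by rewrite lte_mul_pinfty// ?integral_ge0// ge0_fin_numE// integral_ge0.
  by apply: measurableT_comp => //; exact/measurable_EFinP.
apply: eq_integral => x _; rewrite -ge0_integralZl//.
  by apply: eq_integral => y _; rewrite /= normrM EFinM.
by apply: measurableT_comp => //; exact/measurable_EFinP.
Qed.

Lemma measurable_Rintegral_param k : measurable_fun setT k ->
  measurable_fun setT (fun x => (\int[m2]_y k (x, y))%R).
Proof.
move=> mk; have mk' : measurable_fun setT (EFin \o k) by exact/measurable_EFinP.
apply: measurableT_comp; first exact: fine_measurable.
have h1 : measurable_fun setT (fubini_F m2 (EFin \o k)^\+).
  by apply: measurable_fun_fubini_tonelli_F => //; exact: measurable_funepos.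
have h2 : measurable_fun setT (fubini_F m2 (EFin \o k)^\-).
  by apply: measurable_fun_fubini_tonelli_F => //; exact: measurable_funeneg.
rewrite (_ : (fun x => _) = fubini_F m2 (EFin \o k)^\+ \- fubini_F m2 (EFin \o k)^\-).
  exact: emeasurable_funB.
apply/funext => x; rewrite integralE /fubini_F /=; congr (_ - _);
  by apply: eq_integral => y _; rewrite ?funeposE ?funenegE.
Qed.

Lemma Rfubini_kernel u v k (M : R) :
  m1.-integrable setT (EFin \o u) -> m2.-integrable setT (EFin \o v) ->
  measurable_fun setT k -> (forall p, `|k p| <= M)%R ->
  (\int[m1]_x (u x * \int[m2]_y (v y * k (x, y))) =
   \int[m2]_y (v y * \int[m1]_x (u x * k (x, y))))%R.
Proof.
move=> ui vi mk kM; have mu_ := integrable_mfun ui; have mv := integrable_mfun vi.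
have ik := integrable_bounded (integrable_prod ui vi) mk kM.
have ky x : m2.-integrable setT (EFin \o (fun y => v y * k (x, y))%R).
  by apply: (integrable_bounded (M := M)) => //; exact: measurableT_comp mk _.
have kx y : m1.-integrable setT (EFin \o (fun x => u x * k (x, y))%R).
  by apply: (integrable_bounded (M := M)) => //; exact: measurableT_comp mk _.
have := @Fubini _ _ _ _ _ m1 m2 _ ik.
rewrite /Rintegral => F; congr fine.
transitivity (\int[m1]_x \int[m2]_y (u x * v y * k (x, y))%:E).
  apply: eq_integral => x _; rewrite EFinM fineK; last exact: integrable_fin_num (ky x).
  rewrite -(integralZl measurableT (ky x)); apply: eq_integral => y _.
  by rewrite /= -EFinM mulrA.
rewrite F; apply: eq_integral => y _; rewrite EFinM fineK; last exact: integrable_fin_num (kx y).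
rewrite -(integralZl measurableT (kx y)); apply: eq_integral => x _.
by rewrite /= -EFinM mulrCA mulrA.
Qed.

End fubini_kernels.

(** * The kernel g on R^d and the multiplication formula *)

Section band_limited.
Variables (R : realType) (d : nat).
Local Notation lam := (@lebesgue_measure R).
Local Notation mu := (lebesgue_rV R d).
Local Notation V := 'rV[R]_d.
Implicit Types (f h : V -> R[i]) (v : V -> R) (x y w t : V) (s r : R).

(** [gd r] is the kernel g and [gd (2 * r)] the kernel G of the overview; [dd s] is the Fourier
    transform of [gd s]. *)
Definition gd s : V -> R := pd (fun=> gs s).
Definition dd s : V -> R := pd (fun=> dil s).

Lemma dotrC x y : dotr x y = dotr y x.
Proof. by apply: eq_bigr => i _; rewrite mulrC. Qed.

Lemma dotr0B x w : dotr (0 - x) w = - dotr x w.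
Proof. by rewrite /dotr -sumrN; apply: eq_bigr => i _; rewrite !mxE sub0r mulNr. Qed.

Lemma dotr0 w : dotr 0 w = 0.
Proof. by rewrite /dotr big1// => i _; rewrite mxE mul0r. Qed.

Lemma integrable_gd s : 0 < s -> mu.-integrable setT (EFin \o gd s).
Proof. by move=> s0; have [] := integrable_pd (fun _ : 'I_d => integrable_gs1 s0). Qed.

Lemma integrable_dd s : 0 < s -> mu.-integrable setT (EFin \o dd s).
Proof. by move=> s0; have [] := integrable_pd (fun _ : 'I_d => integrable_dil s0). Qed.

Lemma dd_cos s z : 0 < s ->
  \int[mu]_w (dd s w * cos (2 * pi * dotr z w)) = gd s z /\
  \int[mu]_w (dd s w * sin (2 * pi * dotr z w)) = 0.
Proof.
move=> s0; have [hc hs] := pd_FT (fun _ : 'I_d => integrable_dil s0)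
  (fun _ => dil_FTpair s0) z 0.
rewrite dotr0 mulr0 cos0 mulr1 sin0 mulr0 in hc hs.
split; first by rewrite /gd -hc; apply: eq_Rintegral => w _; rewrite dotr0B mulrN cosN dotrC.
rewrite -[RHS]oppr0 -[X in _ = - X]hs -mulN1r -RintegralZl//.
  by apply: eq_Rintegral => w _; rewrite dotr0B mulrN sinN dotrC /dd; ring.
by have [] := integrable_pd_cos 0 z (fun _ : 'I_d => integrable_dil s0).
Qed.

Lemma pd_bounded (u : R -> R) (M : R) : (forall t : R, `|u t| <= M) ->
  forall x, `|pd (fun _ : 'I_d => u) x| <= M ^+ d.
Proof.
move=> uM x; rewrite /pd normr_prod.
apply: (@le_trans _ _ (\prod_(i < d) M)); last by rewrite prodr_const card_ord.
by apply: ler_prod => i _; rewrite normr_ge0 uM.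
Qed.

Lemma gs_bounded s : 0 < s -> exists M : R, forall t : R, `|gs s t| <= M.
Proof.
by move=> s0; have [M _ h] := gs_schwartz 0 0 s0; exists M => t; have := h t; rewrite mul1r.
Qed.

Lemma L2r_dd s (k : V -> R) : 0 < s -> measurable_fun setT k ->
  (forall x, `|k x| <= 1) -> L2r mu (fun w => dd s w * k w).
Proof.
move=> s0 mk k1; have [M M0 hM] := dil_bounded s0.
apply: (@L2r_bounded _ _ _ mu _ (M ^+ d)).
  exact: (integrable_bounded (integrable_dd s0) mk k1).
move=> x; rewrite normrM -[leRHS]mulr1 ler_pM//.
exact: pd_bounded.
Qed.

Lemma measurable_gdB s x : 0 < s -> measurable_fun setT (fun y => gd s (x - y)).
Proof.
move=> s0; apply: measurable_bigprod => i.
apply: (measurableT_comp (cont_measurable (cont_gs s0))).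
exact: measurable_rVB.
Qed.

Lemma measurable_phase x :
  measurable_fun setT (fun p : V * V => 2 * pi * dotr (x - p.2) p.1).
Proof.
apply: measurable_funM => //; apply: measurable_dotr => i.
  exact: measurableT_comp (measurable_rVB x i) measurable_snd.
exact: measurableT_comp (measurable_coord i) measurable_fst.
Qed.

(** After Fubini the integral in w is evaluated by [dd_cos]: the cosine gives the kernel, and the
    sine gives 0 because [dd s] is even. *)
Lemma multiplication_formula v s x : 0 < s -> mu.-integrable setT (EFin \o v) ->
  \int[mu]_w (dd s w * \int[mu]_y (v y * cos (2 * pi * dotr (x - y) w))) =
    \int[mu]_y (v y * gd s (x - y)) /\
  \int[mu]_w (dd s w * \int[mu]_y (v y * sin (2 * pi * dotr (x - y) w))) = 0.
Proof.
move=> s0 vi; have id := integrable_dd s0; split.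
- rewrite (@Rfubini_kernel _ _ _ _ _ mu mu (dd s) v
    (fun p : V * V => cos (2 * pi * dotr (x - p.2) p.1)) 1)//.
  + by apply: eq_Rintegral => y _; rewrite /= (dd_cos _ s0).1.
  + by apply: measurable_cosf; exact: measurable_phase.
  + by move=> p; exact: cos_norm_le1.
- rewrite (@Rfubini_kernel _ _ _ _ _ mu mu (dd s) v
    (fun p : V * V => sin (2 * pi * dotr (x - p.2) p.1)) 1)//.
  + rewrite (_ : (fun y => _) = (fun=> 0)) ?Rintegral_cst ?mul0r//.
    by apply/funext => y; rewrite /= (dd_cos _ s0).2 mulr0.
  + by apply: measurable_sinf; exact: measurable_phase.
  + by move=> p; exact: sin_norm_le1.
Qed.

(** Real and imaginary parts of z exp(iX), kept apart since the integral estimates are for real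
    functions. *)
Definition rot_re (X : R) (z : R[i]) : R := complex.Re z * cos X - complex.Im z * sin X.
Definition rot_im (X : R) (z : R[i]) : R := complex.Im z * cos X + complex.Re z * sin X.

Lemma measurable_phase_param v x : measurable_fun setT v ->
  measurable_fun setT (fun w => \int[mu]_y (v y * cos (2 * pi * dotr (x - y) w))) /\
  measurable_fun setT (fun w => \int[mu]_y (v y * sin (2 * pi * dotr (x - y) w))).
Proof.
move=> mv; split.
- have := @measurable_Rintegral_param _ _ _ _ R mu (fun p : V * V =>
    v p.2 * cos (2 * pi * dotr (x - p.2) p.1)).
  apply; apply: measurable_funM; first exact: measurableT_comp mv measurable_snd.
  by apply: measurable_cosf; exact: measurable_phase.
- have := @measurable_Rintegral_param _ _ _ _ R mu (fun p : V * V =>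
    v p.2 * sin (2 * pi * dotr (x - p.2) p.1)).
  apply; apply: measurable_funM; first exact: measurableT_comp mv measurable_snd.
  by apply: measurable_sinf; exact: measurable_phase.
Qed.

Lemma integrable_phase v x w : mu.-integrable setT (EFin \o v) ->
  mu.-integrable setT (EFin \o (fun y => v y * cos (2 * pi * dotr (x - y) w))) /\
  mu.-integrable setT (EFin \o (fun y => v y * sin (2 * pi * dotr (x - y) w))).
Proof.
move=> vi; split; apply: (integrable_bounded (M := 1)) => //.
- by apply: measurable_cosf; exact: measurable_dotrB.
- by move=> t; exact: cos_norm_le1.
- by apply: measurable_sinf; exact: measurable_dotrB.
- by move=> t; exact: sin_norm_le1.
Qed.

(** The phase -w.y is written with 0 - y so that the measurability and integrability lemmas for
    [dotr (x - y) w] apply at x = 0. *)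
Lemma fourier_phase (u : V -> R[i]) w : cintegrable setT u ->
  complex.Re (fourier u w) =
    \int[mu]_y (complex.Re (u y) * cos (2 * pi * dotr (0 - y) w)) -
    \int[mu]_y (complex.Im (u y) * sin (2 * pi * dotr (0 - y) w)) /\
  complex.Im (fourier u w) =
    \int[mu]_y (complex.Im (u y) * cos (2 * pi * dotr (0 - y) w)) +
    \int[mu]_y (complex.Re (u y) * sin (2 * pi * dotr (0 - y) w)).
Proof.
move=> [ui1 ui2].
have [i1 i2] := integrable_phase 0 w ui1; have [j1 j2] := integrable_phase 0 w ui2.
split.
- rewrite -RintegralB//; apply: eq_Rintegral => y _.
  rewrite /expo dotr0B mulrN cosN sinN dotrC.
  by case: (u y) => a b /=; ring.
- rewrite -RintegralD//; apply: eq_Rintegral => y _.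
  rewrite /expo dotr0B mulrN cosN sinN dotrC.
  by case: (u y) => a b /=; ring.
Qed.

(** Multiplying the transform by exp(2 pi i x.w) moves the origin of the phase to x, where
    [multiplication_formula] can be used. *)
Lemma rot_fourier (u : V -> R[i]) x w : cintegrable setT u ->
  rot_re (2 * pi * dotr x w) (fourier u w) =
    \int[mu]_y (complex.Re (u y) * cos (2 * pi * dotr (x - y) w)) -
    \int[mu]_y (complex.Im (u y) * sin (2 * pi * dotr (x - y) w)) /\
  rot_im (2 * pi * dotr x w) (fourier u w) =
    \int[mu]_y (complex.Im (u y) * cos (2 * pi * dotr (x - y) w)) +
    \int[mu]_y (complex.Re (u y) * sin (2 * pi * dotr (x - y) w)).
Proof.
move=> ui; rewrite /rot_re /rot_im.
have [-> ->] := fourier_phase w ui; case: ui => ui1 ui2.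
have phE y : 2 * pi * dotr (x - y) w = 2 * pi * dotr x w + 2 * pi * dotr (0 - y) w.
  rewrite -mulrDr; congr (_ * _).
  by rewrite /dotr -big_split; apply: eq_bigr => i _ /=; rewrite !mxE; ring.
have cB v : mu.-integrable setT (EFin \o v) ->
    \int[mu]_y (v y * cos (2 * pi * dotr (x - y) w)) =
    cos (2 * pi * dotr x w) * \int[mu]_y (v y * cos (2 * pi * dotr (0 - y) w)) -
    sin (2 * pi * dotr x w) * \int[mu]_y (v y * sin (2 * pi * dotr (0 - y) w)).
  move=> vi; have [i1 i2] := integrable_phase 0 w vi.
  rewrite -!RintegralZl// -RintegralB//; try exact: RintegrableZ.
  by apply: eq_Rintegral => y _; rewrite phE cosD; ring.
have sB v : mu.-integrable setT (EFin \o v) ->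
    \int[mu]_y (v y * sin (2 * pi * dotr (x - y) w)) =
    sin (2 * pi * dotr x w) * \int[mu]_y (v y * cos (2 * pi * dotr (0 - y) w)) +
    cos (2 * pi * dotr x w) * \int[mu]_y (v y * sin (2 * pi * dotr (0 - y) w)).
  move=> vi; have [i1 i2] := integrable_phase 0 w vi.
  rewrite -!RintegralZl// -RintegralD//; try exact: RintegrableZ.
  by apply: eq_Rintegral => y _; rewrite phE sinD; ring.
by rewrite !cB// !sB//; split; ring.
Qed.

End band_limited.

(** * Convolution with g for L^2 functions *)

Section band_limited_convolution.
Variables (R : realType) (d : nat).
Local Notation lam := (@lebesgue_measure R).
Local Notation mu := (lebesgue_rV R d).
Local Notation V := 'rV[R]_d.
Implicit Types (f h u : V -> R[i]) (v : V -> R) (x y w : V) (s r : R).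

Lemma absc2 (z : R[i]) : absc z ^+ 2 = complex.Re z ^+ 2 + complex.Im z ^+ 2.
Proof.
by case: z => a b; rewrite /absc/= sqr_sqrtr// addr_ge0// sqr_ge0.
Qed.

Lemma measurable_absc2 f : cmeasurable setT f ->
  measurable_fun setT (fun x => absc (f x) ^+ 2).
Proof.
move=> [m1 m2]; under eq_fun do rewrite absc2.
by apply: measurable_funD; exact: measurable_funX.
Qed.

Lemma L2_parts f : L2 setT f ->
  L2r mu (fun x => complex.Re (f x)) /\ L2r mu (fun x => complex.Im (f x)).
Proof.
move=> [mf sf]; have [m1 m2] := mf.
have ma := measurable_absc2 mf.
have ia : mu.-integrable setT (EFin \o (fun x => absc (f x) ^+ 2)).
  apply/integrableP; split; first exact/measurable_EFinP.
  by under eq_integral do rewrite /= ger0_norm ?sqr_ge0//.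
split; split=> //; apply: (le_integrable_norm _ _ ia) => //.
- exact: measurable_funX.
- by move=> x _; rewrite ger0_norm ?sqr_ge0// absc2 lerDl sqr_ge0.
- exact: measurable_funX.
- by move=> x _; rewrite ger0_norm ?sqr_ge0// absc2 lerDr sqr_ge0.
Qed.

Lemma ReB (z1 z2 : R[i]) : complex.Re (z1 - z2) = complex.Re z1 - complex.Re z2.
Proof. by case: z1 => ? ?; case: z2. Qed.

Lemma ImB (z1 z2 : R[i]) : complex.Im (z1 - z2) = complex.Im z1 - complex.Im z2.
Proof. by case: z1 => ? ?; case: z2. Qed.

Lemma cmeasurableB f h : cmeasurable setT f -> cmeasurable setT h ->
  cmeasurable setT (fun x => f x - h x).
Proof.
move=> [f1 f2] [h1 h2]; split.
  by under eq_fun do rewrite ReB; exact: measurable_funB.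
by under eq_fun do rewrite ImB; exact: measurable_funB.
Qed.

Lemma sqnorm_parts_cvg (u : nat -> V -> R[i]) f :
  (forall n, cmeasurable setT (u n)) -> cmeasurable setT f ->
  sqnormL2 setT (fun x => u n x - f x) @[n --> \oo] --> 0%E ->
  ((\int[mu]_x ((complex.Re (u n x) - complex.Re (f x)) ^+ 2)%:E)%E @[n --> \oo] --> 0%E) /\
  ((\int[mu]_x ((complex.Im (u n x) - complex.Im (f x)) ^+ 2)%:E)%E @[n --> \oo] --> 0%E).
Proof.
move=> mu_ mf cv.
have sq (v : nat -> V -> R) : (forall n, measurable_fun setT (v n)) ->
    (forall n x, v n x ^+ 2 <= absc (u n x - f x) ^+ 2) ->
    (\int[mu]_x (v n x ^+ 2)%:E)%E @[n --> \oo] --> 0%E.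
  move=> mv vle; apply: (squeeze_cvge _ (cvg_cst 0%E) cv).
  apply: nearW => n; apply/andP; split.
    by apply: integral_ge0 => x _; rewrite lee_fin sqr_ge0.
  apply: ge0_le_integral => //.
  - by move=> x _; rewrite lee_fin sqr_ge0.
  - by apply/measurable_EFinP; exact: measurable_funX.
  - by apply/measurable_EFinP; apply: measurable_absc2; exact: cmeasurableB.
  - by move=> x _; rewrite lee_fin.
split; apply: sq.
- by move=> n; apply: measurable_funB; [exact: (mu_ n).1|exact: mf.1].
- by move=> n x; rewrite absc2 ReB lerDl sqr_ge0.
- by move=> n; apply: measurable_funB; [exact: (mu_ n).2|exact: mf.2].
- by move=> n x; rewrite absc2 ImB lerDr sqr_ge0.
Qed.

Lemma gs_lorentz s : 0 < s -> exists2 C : R, 0 <= C & forall t : R, `|gs s t| <= C * lorentz t.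
Proof.
move=> s0; have [C C0 h] := gs_decay 0 s0; exists C => // t.
rewrite (le_trans (h t))// ler_wpM2l//.
by rewrite expr2 ler_piMl ?lorentz_le1// ltW// lorentz_gt0.
Qed.

Lemma lorentz_shift_int (c : R) :
  lam.-integrable setT (EFin \o (fun t => lorentz (t - c))) /\
  \int[lam]_t lorentz (t - c) <= pi.
Proof.
have := @integral_lorentz R 1 (- c) ltr01.
rewrite (_ : (fun z : R => _) = (fun t : R => lorentz (t - c)))//.
by apply/funext => t; rewrite !mul1r.
Qed.

Lemma integrable_gs_shift s (c : R) : 0 < s ->
  lam.-integrable setT (EFin \o (fun t => gs s (c - t))).
Proof.
move=> s0; have [C C0 h] := gs_lorentz s0; have [i1 _] := lorentz_shift_int c.
apply: (le_integrable_norm _ _ (RintegrableZ C measurableT i1)) => //.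
  by apply: cont_measurable; apply: (cont_comp (cont_gs s0)); cont.
by move=> t _; rewrite -[c - t]opprB gsN.
Qed.

Lemma gdB_pd s x y : gd s (x - y) = pd (fun i t => gs s (x ord0 i - t)) y.
Proof. by apply: eq_bigr => i _; rewrite rV_subE. Qed.

Lemma integrable_gdB s x : 0 < s -> mu.-integrable setT (EFin \o (fun y => gd s (x - y))).
Proof.
move=> s0; under [X in EFin \o X]eq_fun do rewrite gdB_pd.
by have [] := integrable_pd (fun i => integrable_gs_shift (x ord0 i) s0).
Qed.

Lemma gd_bounded s : 0 < s -> exists M : R, forall x, `|gd s x| <= M.
Proof.
move=> s0; have [M h] := gs_bounded s0; exists (M ^+ d) => x.
exact: pd_bounded.
Qed.

Lemma L2r_gdB s x : 0 < s -> L2r mu (fun y => gd s (x - y)).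
Proof.
move=> s0; have [M h] := gd_bounded s0.
exact: (L2r_bounded (M := M) (integrable_gdB x s0)).
Qed.

Lemma Rintegral_cos_bounded v x w : mu.-integrable setT (EFin \o v) ->
  `|\int[mu]_y (v y * cos (2 * pi * dotr (x - y) w))| <= \int[mu]_y `|v y| /\
  `|\int[mu]_y (v y * sin (2 * pi * dotr (x - y) w))| <= \int[mu]_y `|v y|.
Proof.
move=> vi; have [i1 i2] := integrable_phase x w vi.
have iv := integrable_abse vi.
split.
- apply: le_trans (le_normr_Rintegral measurableT i1) _.
  apply: le_Rintegral => //; first exact: (integrable_abse i1).
  by move=> y _; rewrite normrM -[leRHS]mulr1 ler_pM// cos_norm_le1.
- apply: le_trans (le_normr_Rintegral measurableT i2) _.
  apply: le_Rintegral => //; first exact: (integrable_abse i2).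
  by move=> y _; rewrite normrM -[leRHS]mulr1 ler_pM// sin_norm_le1.
Qed.

(** Boundedness makes the product of the transform with any integrable function integrable, as the
    passage to the limit in [conv_gd_L2] requires. *)
Lemma fourier_regular u : cintegrable setT u -> cmeasurable setT (fourier u) /\
  exists M : R, forall w, `|complex.Re (fourier u w)| <= M /\ `|complex.Im (fourier u w)| <= M.
Proof.
move=> ui; have [u1 u2] := ui.
have [m1 m2] := measurable_phase_param 0 (integrable_mfun u1).
have [n1 n2] := measurable_phase_param 0 (integrable_mfun u2).
split.
  split.
    under eq_fun do rewrite (fourier_phase _ ui).1.
    exact: measurable_funB.
  under eq_fun do rewrite (fourier_phase _ ui).2.
  exact: measurable_funD.
exists (\int[mu]_y `|complex.Re (u y)| + \int[mu]_y `|complex.Im (u y)|) => w.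
have [-> ->] := fourier_phase w ui.
have [b1 b2] := Rintegral_cos_bounded 0 w u1.
have [b3 b4] := Rintegral_cos_bounded 0 w u2.
split; first by rewrite (le_trans (ler_normB _ _))// lerD.
by rewrite addrC (le_trans (ler_normD _ _))// lerD.
Qed.

Lemma measurable_cosX x : measurable_fun setT (fun w => cos (2 * pi * dotr x w)).
Proof.
apply: measurable_cosf; apply: measurable_funM => //.
by apply: measurable_dotr => i //; exact: measurable_coord.
Qed.

Lemma measurable_sinX x : measurable_fun setT (fun w => sin (2 * pi * dotr x w)).
Proof.
apply: measurable_sinf; apply: measurable_funM => //.
by apply: measurable_dotr => i //; exact: measurable_coord.
Qed.

Lemma conv_gd_L1 u s x : 0 < s -> cintegrable setT u ->
  \int[mu]_w (dd s w * rot_re (2 * pi * dotr x w) (fourier u w)) =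
    \int[mu]_y (complex.Re (u y) * gd s (x - y)) /\
  \int[mu]_w (dd s w * rot_im (2 * pi * dotr x w) (fourier u w)) =
    \int[mu]_y (complex.Im (u y) * gd s (x - y)).
Proof.
move=> s0 ui; have [u1 u2] := ui.
have ia v : mu.-integrable setT (EFin \o v) ->
  mu.-integrable setT (EFin \o (fun w => dd s w * \int[mu]_y (v y * cos (2 * pi * dotr (x - y) w)))) /\
  mu.-integrable setT (EFin \o (fun w => dd s w * \int[mu]_y (v y * sin (2 * pi * dotr (x - y) w)))).
  move=> vi; have [m1 m2] := measurable_phase_param x (integrable_mfun vi).
  split; apply: (integrable_bounded (integrable_dd _ s0) (M := \int[mu]_y `|v y|)) => // w.
    by have [] := Rintegral_cos_bounded x w vi.
  by have [] := Rintegral_cos_bounded x w vi.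
have [a1 a2] := ia _ u1; have [b1 b2] := ia _ u2.
have [c1 c2] := multiplication_formula x s0 u1.
have [e1 e2] := multiplication_formula x s0 u2.
split.
- rewrite -c1 -[RHS]subr0 -[X in _ - X]e2 -RintegralB//.
  by apply: eq_Rintegral => w _; rewrite (rot_fourier _ _ ui).1 mulrBr.
- rewrite -e1 -[RHS]addr0 -[X in _ + X]c2 -RintegralD//.
  by apply: eq_Rintegral => w _; rewrite (rot_fourier _ _ ui).2 mulrDr.
Qed.

(** Splits the rotated integral into pairings of the real and imaginary parts of h with fixed real
    functions, the form in which [L2_weak_cvg] applies. *)
Lemma rot_split h s x :
  mu.-integrable setT (EFin \o (fun w => complex.Re (h w) * (dd s w * cos (2 * pi * dotr x w)))) ->
  mu.-integrable setT (EFin \o (fun w => complex.Re (h w) * (dd s w * sin (2 * pi * dotr x w)))) ->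
  mu.-integrable setT (EFin \o (fun w => complex.Im (h w) * (dd s w * cos (2 * pi * dotr x w)))) ->
  mu.-integrable setT (EFin \o (fun w => complex.Im (h w) * (dd s w * sin (2 * pi * dotr x w)))) ->
  \int[mu]_w (dd s w * rot_re (2 * pi * dotr x w) (h w)) =
    \int[mu]_w (complex.Re (h w) * (dd s w * cos (2 * pi * dotr x w))) -
    \int[mu]_w (complex.Im (h w) * (dd s w * sin (2 * pi * dotr x w))) /\
  \int[mu]_w (dd s w * rot_im (2 * pi * dotr x w) (h w)) =
    \int[mu]_w (complex.Im (h w) * (dd s w * cos (2 * pi * dotr x w))) +
    \int[mu]_w (complex.Re (h w) * (dd s w * sin (2 * pi * dotr x w))).
Proof.
move=> h1 h2 h3 h4; split.
- by rewrite -RintegralB//; apply: eq_Rintegral => w _; rewrite /rot_re; ring.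
- by rewrite -RintegralD//; apply: eq_Rintegral => w _; rewrite /rot_im; ring.
Qed.

(** Both sides are combinations of pairings with fixed L^2 functions, so [conv_gd_L1] for the
    approximating sequence contained in [fourierL2] passes to the limit on each side. *)
Lemma conv_gd_L2 f h s x : 0 < s -> fourierL2 f h ->
  \int[mu]_w (dd s w * rot_re (2 * pi * dotr x w) (h w)) =
    \int[mu]_y (complex.Re (f y) * gd s (x - y)) /\
  \int[mu]_w (dd s w * rot_im (2 * pi * dotr x w) (h w)) =
    \int[mu]_y (complex.Im (f y) * gd s (x - y)).
Proof.
move=> s0 [Lf Lh [u [ui cu cFu]]].
have [f1 f2] := L2_parts Lf; have [h1 h2] := L2_parts Lh.
have [cu1 cu2] := sqnorm_parts_cvg (fun n => (ui n).2.1) Lf.1 cu.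
have mF n := (fourier_regular (ui n).1).1.
have [cF1 cF2] := sqnorm_parts_cvg mF Lh.1 cFu.
have Lg := L2r_gdB x s0.
have [Mg hMg] := gd_bounded s0; have mg := measurable_gdB x s0.
have Lc := L2r_dd s0 (measurable_cosX x) (fun w => cos_norm_le1 _).
have Ls := L2r_dd s0 (measurable_sinX x) (fun w => sin_norm_le1 _).
have ic := integrable_bounded (integrable_dd _ s0) (measurable_cosX x) (fun w => cos_norm_le1 _).
have is_ := integrable_bounded (integrable_dd _ s0) (measurable_sinX x) (fun w => sin_norm_le1 _).
have iF n (k : V -> R) : mu.-integrable setT (EFin \o k) ->
    mu.-integrable setT (EFin \o (fun w => complex.Re (fourier (u n) w) * k w)) /\
    mu.-integrable setT (EFin \o (fun w => complex.Im (fourier (u n) w) * k w)).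
  move=> ki; have [M hM] := (fourier_regular (ui n).1).2.
  split.
    under [X in EFin \o X]eq_fun do rewrite mulrC.
    by apply: (integrable_bounded (M := M)) => //; [exact: (mF n).1|move=> w; exact: (hM w).1].
  under [X in EFin \o X]eq_fun do rewrite mulrC.
  by apply: (integrable_bounded (M := M)) => //; [exact: (mF n).2|move=> w; exact: (hM w).2].
have [R1 R2] := rot_split (L2r_mul h1 Lc) (L2r_mul h1 Ls) (L2r_mul h2 Lc) (L2r_mul h2 Ls).
have Rn n := rot_split (iF n _ ic).1 (iF n _ is_).1 (iF n _ ic).2 (iF n _ is_).2.
have k1 := L2_weak_cvg (fun n => (mF n).1) h1.1 Lc (fun n => (iF n _ ic).1) (L2r_mul h1 Lc) cF1.
have k2 := L2_weak_cvg (fun n => (mF n).1) h1.1 Ls (fun n => (iF n _ is_).1) (L2r_mul h1 Ls) cF1.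
have k3 := L2_weak_cvg (fun n => (mF n).2) h2.1 Lc (fun n => (iF n _ ic).2) (L2r_mul h2 Lc) cF2.
have k4 := L2_weak_cvg (fun n => (mF n).2) h2.1 Ls (fun n => (iF n _ is_).2) (L2r_mul h2 Ls) cF2.
have l1 := L2_weak_cvg (fun n => (ui n).2.1.1) f1.1 Lg
  (fun n => integrable_bounded (ui n).1.1 mg (fun y => hMg _)) (L2r_mul f1 Lg) cu1.
have l2 := L2_weak_cvg (fun n => (ui n).2.1.2) f2.1 Lg
  (fun n => integrable_bounded (ui n).1.2 mg (fun y => hMg _)) (L2r_mul f2 Lg) cu2.
split.
- rewrite R1; have E1 n : \int[mu]_y (complex.Re (u n y) * gd s (x - y)) =
      \int[mu]_w (complex.Re (fourier (u n) w) * (dd s w * cos (2 * pi * dotr x w))) -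
      \int[mu]_w (complex.Im (fourier (u n) w) * (dd s w * sin (2 * pi * dotr x w))).
    by rewrite -(conv_gd_L1 x s0 (ui n).1).1 (Rn n).1.
  rewrite -(cvg_lim _ l1)//; apply/esym/cvg_lim => //.
  by under eq_fun do rewrite E1; exact: cvgB.
- rewrite R2; have E1 n : \int[mu]_y (complex.Im (u n y) * gd s (x - y)) =
      \int[mu]_w (complex.Im (fourier (u n) w) * (dd s w * cos (2 * pi * dotr x w))) +
      \int[mu]_w (complex.Re (fourier (u n) w) * (dd s w * sin (2 * pi * dotr x w))).
    by rewrite -(conv_gd_L1 x s0 (ui n).1).2 (Rn n).2.
  rewrite -(cvg_lim _ l2)//; apply/esym/cvg_lim => //.
  by under eq_fun do rewrite E1; exact: cvgD.
Qed.

Lemma Rintegral_ae_eq v (v' : V -> R) : measurable_fun setT v -> measurable_fun setT v' ->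
  {ae mu, forall x, v x = v' x} -> \int[mu]_x v x = \int[mu]_x v' x.
Proof.
move=> mv mv' vv'; congr fine; apply: ae_eq_integral => //.
- exact/measurable_EFinP.
- exact/measurable_EFinP.
- by apply: filterS vv' => x -> _.
Qed.

Lemma measurable_dd s : measurable_fun setT (dd s : V -> R).
Proof. by apply: measurable_pd => i; apply: cont_measurable; exact: cont_dil. Qed.

(* On the Fourier side both convolutions multiply by functions equal to 1 on [E]. *)
Lemma bandlimited_conv (E : set V) f r s x : 0 < r -> r <= s ->
  (forall w, E w -> forall i, `|w ord0 i| <= r) -> bandlimited E f ->
  \int[mu]_y (complex.Re (f y) * gd s (x - y)) =
    \int[mu]_y (complex.Re (f y) * gd r (x - y)) /\
  \int[mu]_y (complex.Im (f y) * gd s (x - y)) =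
    \int[mu]_y (complex.Im (f y) * gd r (x - y)).
Proof.
move=> r0 rs Er [h fh h0]; have s0 := lt_le_trans r0 rs.
have [A1 A2] := conv_gd_L2 x s0 fh; have [B1 B2] := conv_gd_L2 x r0 fh.
have [_ [mh _] _] := fh; have [m1 m2] := mh.
have ddE w t : E w -> r <= t -> dd t w = 1.
  move=> Ew rt; rewrite /dd /pd big1// => i _; apply: dil1.
    exact: lt_le_trans r0 rt.
  exact: le_trans (Er w Ew i) rt.
have mR k : measurable_fun setT (fun w => dd k w * rot_re (2 * pi * dotr x w) (h w)).
  apply: measurable_funM; first exact: measurable_dd.
  by apply: measurable_funB; apply: measurable_funM => //;
    [exact: measurable_cosX|exact: measurable_sinX].
have mI k : measurable_fun setT (fun w => dd k w * rot_im (2 * pi * dotr x w) (h w)).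
  apply: measurable_funM; first exact: measurable_dd.
  by apply: measurable_funD; apply: measurable_funM => //;
    [exact: measurable_cosX|exact: measurable_sinX].
split; [apply: (etrans (esym A1)); apply: (etrans _ B1)|
  apply: (etrans (esym A2)); apply: (etrans _ B2)]; apply: Rintegral_ae_eq => //.
- apply: filterS h0 => w h0; have [Ew|/h0 ->] := pselect (E w).
    by rewrite !ddE.
  by rewrite /rot_re/= !mul0r subr0 !mulr0.
- apply: filterS h0 => w h0; have [Ew|/h0 ->] := pselect (E w).
    by rewrite !ddE.
  by rewrite /rot_im/= !mul0r addr0 !mulr0.
Qed.

End band_limited_convolution.

(** * Functions with vanishing integrals over boxes *)

Section density_measure.
Context d (T : measurableType d) (R : realType).
Variable mu : {measure set T -> \bar R}.
Variable v : T -> R.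

(* The hypotheses are arguments so that the measure structure can be inferred. *)
Definition density_measure of mu.-integrable setT (EFin \o v) & (forall x, 0 <= v x) :=
  fun A : set T => (\int[mu]_(x in A) (v x)%:E)%E.

Variables (vi : mu.-integrable setT (EFin \o v)) (v0 : forall x, 0 <= v x).
Local Notation nu := (density_measure vi v0).

Let density0 : nu set0 = 0%E.
Proof. by rewrite /density_measure integral_set0. Qed.

Let density_ge0 A : (0 <= nu A)%E.
Proof. by apply: integral_ge0 => x _; rewrite lee_fin. Qed.

Let density_sigma_additive : semi_sigma_additive nu.
Proof.
move=> /= A mA tA mUA; rewrite /density_measure integral_bigcup//=; last first.
  exact: (integrableS measurableT mUA (@subsetT _ _) vi).
by apply: is_cvg_ereal_nneg_natsum_cond => n _ _; exact: density_ge0.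
Qed.

HB.instance Definition _ := isMeasure.Build _ _ _
  nu density0 density_ge0 density_sigma_additive.

End density_measure.

Section boxes.
Variables (R : realType) (d : nat).
Local Notation lam := (@lebesgue_measure R).
Local Notation mu := (lebesgue_rV R d).
Local Notation V := 'rV[R]_d.
Implicit Types (a b : 'I_d -> R) (u v : V -> R) (x y : V).

Definition box a b : set V := [set x | forall i, a i < x ord0 i <= b i].

Lemma boxE a b : box a b = \bigcap_(i in [set: 'I_d]) ((fun x : V => x ord0 i) @^-1` `]a i, b i]%classic).
Proof.
apply/seteqP; split => x /= h; first by move=> i _ /=; rewrite in_itv/=; exact: h.
by move=> i; have := h i I; rewrite /= in_itv.
Qed.

Lemma measurable_box a b : measurable (box a b).
Proof.
rewrite boxE; apply: fin_bigcap_measurable; first exact: finite_finset.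
move=> i _; rewrite -[X in measurable X]setTI.
exact: (@measurable_coord _ R).
Qed.

Lemma boxI a b a' b' : box a b `&` box a' b' =
  box (fun i => Num.max (a i) (a' i)) (fun i => Num.min (b i) (b' i)).
Proof.
apply/seteqP; split => x /=.
  by move=> [h h'] i; have /andP[? ?] := h i; have /andP[? ?] := h' i;
     rewrite gt_max le_min; apply/andP; split; apply/andP.
by move=> h; split=> i; have := h i; rewrite gt_max le_min =>
  /andP[/andP[? ?] /andP[? ?]]; apply/andP.
Qed.

Definition nbox (n : nat) : set V := box (fun=> - n%:R) (fun=> n%:R).

Lemma nbox_cover : \bigcup_n nbox n = setT.
Proof.
apply/seteqP; split => // x _.
have [n hn] : exists n : nat, forall i, `|x ord0 i| < n%:R.
  exists (\max_i (Num.truncn `|x ord0 i|).+1)%N => i.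
  apply: (@lt_le_trans _ _ (Num.truncn `|x ord0 i|).+1%:R).
    by rewrite truncnS_gt.
  by rewrite ler_nat; exact: (@leq_bigmax _ (fun i => (Num.truncn `|x ord0 i|).+1)).
exists n => // i; have := hn i; rewrite ltr_norml => /andP[-> /ltW ->] //.
Qed.

Definition boxes : set (set V) := [set A | exists a b, A = box a b].

Lemma measurable_boxes : @measurable _ V = <<s boxes >>.
Proof.
apply/seteqP; split; last first.
  apply: smallest_sub; first exact: sigma_algebra_measurable.
  by move=> _ [a [b ->]]; exact: measurable_box.
have sA := smallest_sigma_algebra setT boxes.
have coordm (i : 'I_d) (Y : set R) : measurable Y ->
    <<s boxes >> ((fun x : V => x ord0 i) @^-1` Y).
  apply: (@smallest_sub _ _ _ [set Y | <<s boxes >> ((fun x : V => x ord0 i) @^-1` Y)]).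
    split => [|A|F] /=.
    - by rewrite preimage_set0; case: sA.
    - by rewrite setTD preimage_setC => hA; case: sA => _ + _; rewrite -setTD; exact.
    - by move=> hF; rewrite preimage_bigcup; case: sA => _ _; exact.
  move=> _ [[a b] _ <-] /=.
  (* A slab is the countable union of boxes whose other sides run from -n to n. *)
  rewrite [X in <<s _ >> X](_ : _ = \bigcup_n
    (box (fun j => if j == i then a else - n%:R) (fun j => if j == i then b else n%:R))).
    by case: sA => _ _; apply => n; apply: sub_sigma_algebra; eexists; eexists.
  apply/seteqP; split => x /=.
    rewrite in_itv/= => xab.
    have [n _ hn] : (\bigcup_n nbox n) x by rewrite nbox_cover.
    by exists n => // j /=; case: eqP => [->|_] //; exact: hn.
  by move=> [n _ /(_ i)]; rewrite eqxx in_itv.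
apply: smallest_sub => //; rewrite -bigcup_seq => A [i _ [Y mY <-]].
by rewrite setTI; exact: coordm.
Qed.

Lemma boxes_setI : setI_closed boxes.
Proof.
by move=> _ _ [a [b ->]] [a' [b' ->]]; rewrite boxI; eexists; eexists.
Qed.

(** On each cube [nbox n] the positive and negative parts of u are densities of two measures that
    agree on boxes. Boxes are stable under intersection and generate, so the measures coincide, and
    then so do the densities almost everywhere. *)
Lemma ae_eq0_box u : measurable_fun setT u ->
  (forall n, mu.-integrable setT (EFin \o (fun x => \1_(nbox n) x * u x))) ->
  (forall a b, \int[mu]_x (\1_(box a b) x * u x) = 0) ->
  {ae mu, forall x, u x = 0}.
Proof.
move=> mf ui u0.
suff h n : {ae mu, forall x, \1_(nbox n) x * u x = 0}.
  have := ae_foralln h; apply: filterS => x hx.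
  have [n _ hn] : (\bigcup_n nbox n) x by rewrite nbox_cover.
  by have := hx n; rewrite indicE mem_set// mul1r.
set v := fun x => \1_(nbox n) x * u x.
have vi : mu.-integrable setT (EFin \o v) by exact: ui.
have mv := integrable_mfun vi.
pose vp x := Num.max (v x) 0; pose vn x := Num.max (- v x) 0.
have vpn x : v x = vp x - vn x.
  by rewrite /vp /vn; case: (leP (v x) 0) => h; case: (leP (- v x) 0) => h'; lra.
have vp0 x : 0 <= vp x by rewrite /vp le_max lexx orbT.
have vn0 x : 0 <= vn x by rewrite /vn le_max lexx orbT.
have vp_le x : vp x <= `|v x| by rewrite /vp ge_max normr_ge0 ler_norm.
have vn_le x : vn x <= `|v x| by rewrite /vn ge_max normr_ge0 -normrN ler_norm.
have ip : mu.-integrable setT (EFin \o vp).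
  apply: (le_integrable_norm _ _ (integrable_abse vi)) => //.
    by apply: measurable_maxr.
  by move=> x _; rewrite (ger0_norm (vp0 x)); exact: vp_le.
have in_ : mu.-integrable setT (EFin \o vn).
  apply: (le_integrable_norm _ _ (integrable_abse vi)) => //.
    by apply: measurable_maxr => //; exact: measurable_funN.
  by move=> x _; rewrite (ger0_norm (vn0 x)); exact: vn_le.
have bE A : measurable A -> (\int[mu]_(x in A) (vp x)%:E = \int[mu]_(x in A) (vn x)%:E)%E.
  apply: (@measure_unique _ R V boxes nbox measurable_boxes boxes_setI _ nbox_cover
    (density_measure ip vp0) (density_measure in_ vn0)).
  - by move=> n'; exists (fun=> - n'%:R), (fun=> n'%:R).
  - move=> _ [a [b ->]]; rewrite /= /density_measure.
    have mA := measurable_box a b.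
    have ipA := integrableS measurableT mA (@subsetT _ _) ip.
    have inA := integrableS measurableT mA (@subsetT _ _) in_.
    rewrite -[LHS]fineK ?integrable_fin_num// -[RHS]fineK ?integrable_fin_num//.
    congr EFin; apply/eqP; rewrite -subr_eq0 -RintegralB//; apply/eqP.
    under eq_Rintegral do rewrite -vpn.
    (* [v] already carries the indicator of [nbox n]; the intersection with the box of a and b is
       the box with these bounds. *)
    rewrite Rintegral_mkcond -[RHS](u0 (fun i => Num.max (a i) (- n%:R)) (fun i => Num.min (b i) n%:R)).
    apply: eq_Rintegral => x _; rewrite -boxI -/(nbox n) patchE indicI /v /=.
    by case: ifPn => xA; rewrite [\1_(box a b) x]indicE ?xA ?(negbTE xA) ?mul1r ?mul0r// mulrA.
  - move=> k; rewrite /= /density_measure.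
    have mA := measurable_box (fun=> - k%:R) (fun=> k%:R).
    have ipA := integrableS measurableT mA (@subsetT _ _) ip.
    by have := integrable_fin_num mA ipA; rewrite ge0_fin_numE// integral_ge0// => x _; rewrite lee_fin.
have := @integral_ae_eq _ V R mu setT measurableT (EFin \o vn) (EFin \o vp) ip
  (measurable_int _ in_) (fun A _ mA => bE A mA).
apply: filterS => x /(_ I) /= [] h.
by rewrite -/(v x) vpn h subrr.
Qed.

End boxes.

(** * Approximate identities *)

Section box_kernels.
Variable R : realType.
Local Notation lam := (@lebesgue_measure R).
Implicit Types (s t y z a b : R).

(** Peetre's inequality for this weight: for t in a bounded set, decay in t - y becomes decay in
    y. *)
Lemma lorentz_shift t y : lorentz (t - y) <= 2 * (1 + t ^+ 2) * lorentz y.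
Proof.
have h z : 0 < 1 + z ^+ 2 by rewrite ltr_pwDl// sqr_ge0.
rewrite /lorentz ler_pdivlMr// mulrC ler_pdivrMr//.
have := sqr_ge0 (t * (t - y)); have := sqr_ge0 (2 * t - y); nra.
Qed.

(** The convolution of [gs s] with the indicator of ]a, b], which tends to that indicator away from
    the endpoints as s grows. *)
Definition kap s a b y : R := \int[lam]_t (\1_(`]a, b]%classic) t * gs s (t - y)).

Lemma cont_gs_shift s y : 0 < s -> continuous (fun t : R => gs s (t - y)).
Proof. by move=> s0; apply: (cont_comp (cont_gs s0)); cont. Qed.

Lemma kap0 s a b y : b <= a -> kap s a b y = 0.
Proof.
move=> ba; rewrite /kap set_itv_ge ?bnd_simp -?leNgt//.
by under eq_Rintegral do rewrite indic0 mul0r; rewrite Rintegral_cst ?mul0r.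
Qed.

Lemma kapE s a b y : 0 < s -> a < b -> kap s a b y = itg a b (fun t => gs s (t - y)).
Proof.
move=> s0 ab; rewrite /itg -Rintegral_itv_obnd_cbnd; last first.
  apply: integrableS (cont_integrable a b (cont_gs_shift (y := y) s0)) => //.
  by apply: subset_itvr; rewrite bnd_simp.
rewrite [RHS]Rintegral_mkcond; apply: eq_Rintegral => t _.
by rewrite patchE indicE; case: ifPn => tab; rewrite ?(mem_set tab) ?mul1r ?mul0r.
Qed.

(** Uniform in s >= 1, for use as a dominating function. Of the two factors [lorentz (s * (t - y))],
    one gives decay in y by [lorentz_shift], the other, together with s, has integral at most pi. *)
Lemma kap_bound a b : exists2 D : R, 0 <= D &
  forall s y, 1 <= s -> `|kap s a b y| <= D * lorentz y.
Proof.
have [C C0 hC] := @gs_uniform_decay R.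
have [ba|ab] := leP b a.
  by exists 0 => // s y _; rewrite kap0// normr0 mul0r.
(* M bounds t^2 on [a, b]. *)
have [M M0 hM] := cont_bounded a b (contM (@cont_id R) (@cont_id R)).
have D0 : 0 <= C * (2 * (1 + M)) by rewrite !mulr_ge0// addr_ge0.
exists (C * (2 * (1 + M)) * pi) => [|s y s1]; first by rewrite mulr_ge0// pi_ge0.
have s0 : 0 < s by rewrite (lt_le_trans ltr01).
have cl : continuous (fun t => s * lorentz (s * t + - (s * y))).
  by apply: contM; [exact: cont_cst|apply: (cont_comp (@continuous_lorentz R)); cont].
have cg := cont_gs_shift (y := y) s0.
rewrite kapE//; have -> : C * (2 * (1 + M)) * pi * lorentz y = C * (2 * (1 + M)) * lorentz y * pi by ring.
have D1 : 0 <= C * (2 * (1 + M)) * lorentz y by rewrite mulr_ge0// ltW// lorentz_gt0.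
have h := itg_lorentz_le s (- (s * y)) (ltW ab).
apply: le_trans (ler_wpM2l D1 h); rewrite -itgZ//.
apply: (@le_trans _ _ (itg a b (fun t => `|gs s (t - y)|))).
  by apply: le_normr_Rintegral => //; exact: cont_integrable.
apply: le_itg; [exact: cont_norm|by apply: contM; [exact: cont_cst|]|].
move=> t tab; rewrite (le_trans (hC s (t - y) s0))//.
rewrite -!mulrA ler_wpM2l// expr2 (mulrCA s) (mulrA (lorentz y)) mulrA (mulrA 2).
rewrite (_ : s * t + - (s * y) = s * (t - y)); last by ring.
have hl : lorentz (s * (t - y)) <= 2 * (1 + M) * lorentz y.
  apply: (@le_trans _ _ (lorentz (t - y))).
    rewrite /lorentz lef_pV2 ?posrE ?ltr_pwDl ?sqr_ge0// lerD2l exprMn.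
    by rewrite ler_peMl ?sqr_ge0// expr_ge1// (le_trans ler01).
  apply: le_trans (lorentz_shift t y) _; apply: ler_wpM2r; first exact/ltW/lorentz_gt0.
  by rewrite ler_wpM2l// lerD2l expr2; apply: le_trans (hM t tab); rewrite ler_norm.
rewrite [leLHS](_ : _ = lorentz (s * (t - y)) * (s * lorentz (s * (t - y)))); last by ring.
rewrite [leRHS](_ : _ = 2 * (1 + M) * lorentz y * (s * lorentz (s * (t - y)))); last by ring.
by apply: ler_wpM2r => //; rewrite mulr_ge0 ?ltW// lorentz_gt0.
Qed.

(** Fourier inversion at frequency 0, where the plateau equals 1. *)
Lemma integral_gs1 : \int[lam]_t gs 1 t = 1 :> R.
Proof.
have := @gs_inversion R 1 0 0 ltr01; rewrite mul0r mulr0 cos0 mulr1 dil1 ?normr0// => h.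
rewrite -[RHS]h; apply: eq_Rintegral => t _; rewrite mulr0 mulr0 cos0 mulr1//.
Qed.

(** If y is at distance at least dl > 0 from [a, b], the integrand there is at most C/(s dl^2). *)
Lemma kap_cvg_out a b y : y < a \/ b < y -> kap n.+1%:R a b y @[n --> \oo] --> 0.
Proof.
move=> yab; have [C C0 hC] := @gs_uniform_decay R.
have [ba|ab] := leP b a.
  by under eq_fun do rewrite kap0//; exact: cvg_cst.
have [dl dl0 hd] : exists2 dl, 0 < dl & forall t, a <= t <= b -> dl <= `|t - y|.
  case: yab => h; [exists (a - y)|exists (y - b)]; rewrite ?subr_gt0// => t /andP[ta tb].
    by apply: le_trans (ler_norm _); rewrite lerD2r.
  by rewrite distrC; apply: le_trans (ler_norm _); rewrite lerD2l lerN2.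
pose B := C * (dl ^+ 2)^-1 * (b - a).
apply: (@norm_cvg0 _ _ _).
apply: (@squeeze_cvgr _ _ _ _ (fun=> 0) (fun n => B * n.+1%:R^-1)); last 2 first.
- exact: cvg_cst.
- by rewrite -[0](mulr0 B); apply: cvgM; [exact: cvg_cst|exact: cvg_harmonic].
apply: nearW => n; rewrite normr_ge0/= kapE//.
rewrite /B -mulrA (mulrC (b - a)) mulrA; apply: itg_norm_le; first exact: ltW.
  exact: cont_gs_shift.
move=> t tab; have n0 : 0 < n.+1%:R :> R by [].
rewrite (le_trans (hC _ (t - y) n0))// -mulrA ler_wpM2l//.
set s := n.+1%:R in n0 *.
have hz : dl ^+ 2 <= (t - y) ^+ 2 by rewrite -[leRHS]real_normK ?num_real// ler_sqr ?nnegrE ?hd// ltW.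
have z0 : 0 < (t - y) ^+ 2 by apply: lt_le_trans hz; rewrite exprn_gt0.
have l0 := lorentz_gt0 (s * (t - y)).
apply: (@le_trans _ _ (s * lorentz (s * (t - y)))).
  by rewrite ler_wpM2l ?(ltW n0)// expr2 ler_piMl ?lorentz_le1// ltW.
rewrite -invfM /lorentz ler_pdivrMr ?ltr_pwDl ?sqr_ge0// mulrC ler_pdivlMr ?mulr_gt0// ?exprn_gt0//.
rewrite exprMn (_ : s * (dl ^+ 2 * s) = s ^+ 2 * dl ^+ 2); last by rewrite expr2; ring.
by rewrite (@le_trans _ _ (s ^+ 2 * (t - y) ^+ 2))// ?ler_wpM2l ?sqr_ge0// lerDr.
Qed.

(** Substituting s(t - y) gives integrals of [gs 1] over intervals that grow to the whole line. *)
Lemma kap_cvg_in a b y : a < y < b -> kap n.+1%:R a b y @[n --> \oo] --> (1 : R).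
Proof.
move=> /andP[ay yb]; have ab := lt_trans ay yb.
rewrite (_ : (fun n => _) = fun n => itg (n.+1%:R * (a - y)) (n.+1%:R * (b - y)) (gs 1)); last first.
  apply/funext => n; have n0 : 0 < n.+1%:R :> R by [].
  have := itg_affine (- (n.+1%:R * y)) (cont_gs (@ltr01 R)) n0 (ltW ab).
  rewrite -!mulrN -!mulrDr => ->; rewrite kapE// -itgZ; last first.
    by apply: (cont_comp (cont_gs (@ltr01 R))); cont.
  by apply: eq_itg => t _; rewrite gs_scale// mulrN mulrBr.
have nn : (n.+1%:R : R) @[n --> \oo] --> +oo.
  have /cvgryPge h := @cvgr_idn R; apply/cvgryPge => A; have [N _ hN] := h A; exists N => // n /= Nn; exact: hN (leqW Nn).
have nnM (M : R) : 0 < M -> n.+1%:R * M @[n --> \oo] --> +oo.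
  move=> M0; move/cvgryPge : nn => h; apply/cvgryPge => A.
  by apply: filterS (h (A / M)) => n; rewrite ler_pdivrMr.
rewrite -[X in _ --> X]integral_gs1.
apply: (cvg_itg_line (cont_measurable (cont_gs (@ltr01 R)))).
- have := integrable_gs (@ltr01 R) (@cont_cst R 1) (fun x => _).
  by under eq_fun do rewrite mulr1; apply => x; rewrite normr1.
- under eq_fun do rewrite -opprB mulrN; apply/cvgNry.
  rewrite (_ : - _ = fun n => n.+1%:R * (y - a)); last by apply/funext => n; exact: opprK.
  by apply: nnM; rewrite subr_gt0.
- by apply: nnM; rewrite subr_gt0.
Qed.

Lemma kap_cvg a b y : y <> a -> y <> b ->
  kap n.+1%:R a b y @[n --> \oo] --> (\1_(`]a, b]%classic) y : R).
Proof.
move=> ya yb; rewrite indicE; have [yab|yab] := boolP (a < y < b).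
  rewrite mem_set/=; first exact: kap_cvg_in.
  by rewrite in_itv/=; move: yab => /andP[-> /ltW].
rewrite memNset/=.
  apply: kap_cvg_out; move: yab; rewrite negb_and -!leNgt => /orP[h|h]; [left|right];
  by rewrite lt_neqAle h andbT; apply/eqP; auto.
rewrite in_itv/= => /andP[ay yb']; move: yab; rewrite ay lt_neqAle yb' andbT/= => /negP.
by apply; apply/eqP.
Qed.

End box_kernels.

Section measure_lemmas.
Context d (T : measurableType d) (R : realType).
Variable nu : {measure set T -> \bar R}.

Lemma Rdominated_convergence_ae (f_ : nat -> T -> R) (f g : T -> R) :
  (forall n, measurable_fun setT (f_ n)) -> measurable_fun setT f ->
  {ae nu, forall t, f_ n t @[n --> \oo] --> f t} ->
  nu.-integrable setT (EFin \o g) -> (forall n t, `|f_ n t| <= g t) ->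
  \int[nu]_x f_ n x @[n --> \oo] --> \int[nu]_x f x.
Proof.
move=> mf_ mf ff ig fg.
have h1 n : measurable_fun setT (fun x => (f_ n x)%:E) by exact/measurable_EFinP.
have h2 : measurable_fun setT (EFin \o f) by exact/measurable_EFinP.
have h3 : {ae nu, forall t, setT t -> (f_ n t)%:E @[n --> \oo] --> (f t)%:E}.
  by apply: filterS ff => t h _; apply: cvg_EFin; [exact: nearW|exact: h].
have h4 t n : setT t -> (`|(f_ n t)%:E| <= (EFin \o g) t)%E by move=> _; exact: fg.
have [i1 _ i2] := dominated_convergence measurableT h1 h2 h3 ig (aeW _ h4).
by apply: fine_cvg; rewrite fineK; [exact: i2|exact: integrable_fin_num].
Qed.

Lemma integrable_kernel_section d2 (T2 : measurableType d2) (v : T -> R) (k : T2 * T -> R) (M : R) x :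
  nu.-integrable setT (EFin \o v) -> measurable_fun setT k -> (forall p, `|k p| <= M) ->
  nu.-integrable setT (EFin \o (fun y => v y * k (x, y))).
Proof.
by move=> vi mk kM; apply: (integrable_bounded (M := M)) => //; exact: measurableT_comp mk _.
Qed.

End measure_lemmas.

Lemma cvg_bigprod (R : realType) (I : Type) (s : seq I) (f : I -> nat -> R) (l : I -> R) :
  (forall i, f i n @[n --> \oo] --> l i) ->
  \prod_(i <- s) f i n @[n --> \oo] --> \prod_(i <- s) l i.
Proof.
move=> fl; elim: s => [|i s IH].
  by rewrite big_nil; under eq_fun do rewrite big_nil; exact: cvg_cst.
by rewrite big_cons; under eq_fun do rewrite big_cons; apply: cvgM.
Qed.

Section approximate_identity.
Variables (R : realType) (d : nat).
Local Notation lam := (@lebesgue_measure R).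
Local Notation mu := (lebesgue_rV R d).
Local Notation V := 'rV[R]_d.
Implicit Types (a b : 'I_d -> R) (x y : V) (s r : R).

Lemma integrable_lorentz : lam.-integrable setT (EFin \o @lorentz R).
Proof.
have [h _] := @lorentz_shift_int R 0.
by apply: eq_integrable h => // t _; rewrite /= subr0.
Qed.

Lemma integrable_indic1 (A : set R) : measurable A -> (lam A < +oo)%E ->
  lam.-integrable setT (EFin \o (\1_A : R -> R)) /\ \int[lam]_t (\1_A t) = fine (lam A).
Proof.
move=> mA Aoo; split; last by rewrite /Rintegral integral_indic// setIT.
apply/integrableP; split; first exact/measurable_EFinP.
by under eq_integral do rewrite /= ger0_norm//; rewrite integral_indic// setIT.
Qed.

(** Integrate the product of the indicator of {c} in coordinate i with the weights [lorentz] in the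
    others. The integral is 0 as a product of integrals, while the integrand is positive on the
    hyperplane. *)
Lemma hyperplane_null (i : 'I_d) (c : R) : {ae mu, forall x, x ord0 i <> c}.
Proof.
pose u (j : 'I_d) : R -> R := if j == i then \1_[set c] else @lorentz R.
have cf : (lam [set c] < +oo)%E by rewrite lebesgue_measure_set1.
have [c1 c2] := integrable_indic1 (measurable_set1 c) cf.
have ui j : lam.-integrable setT (EFin \o u j).
  by rewrite /u; case: ifP => _; [exact: c1|exact: integrable_lorentz].
have [i1 i2] := integrable_pd ui.
have := i2; rewrite (bigD1 i)//= {2}/u eqxx c2 lebesgue_measure_set1 mul0r => i3.
have u0 x : 0 <= pd u x.
  by apply: prodr_ge0 => j _; rewrite /u; case: ifP => _ //; exact/ltW/lorentz_gt0.
have : (\int[mu]_(x in setT) `|(EFin \o pd u) x| = 0)%E.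
  have fn := integrable_fin_num measurableT i1.
  under eq_integral do rewrite /= ger0_norm//.
  by rewrite -[LHS]fineK//; congr EFin.
move/ae_eq_integral_abs => /(_ measurableT (measurable_int _ i1)).
apply: filterS => x /(_ I) [] /eqP; rewrite prodf_seq_eq0 => /hasP[j _ /=].
have -> : u j (x ord0 j) = (if j == i then \1_[set c] (x ord0 j) else lorentz (x ord0 j)).
  by rewrite /u; case: ifP.
case: (eqVneq j i) => [->|_]; last by rewrite gt_eqF// lorentz_gt0.
by rewrite indicE; case: (boolP (_ \in _)); rewrite ?oner_eq0//= notin_setE => h _ xc; apply: h.
Qed.

Lemma indic_box a b x : \1_(box a b) x = pd (fun i => \1_(`]a i, b i]%classic)) x :> R.
Proof.
rewrite indicE; case: (boolP (x \in _)) => [/set_mem xab|].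
  by rewrite /pd big1// => i _; rewrite indicE mem_set//= in_itv/=; exact: xab.
rewrite notin_setE => /existsNP[i xi]; apply/esym/eqP; rewrite prodf_seq_eq0.
by apply/hasP; exists i; rewrite ?mem_index_enum//= indicE memNset//= in_itv.
Qed.

Lemma integrable_box a b : mu.-integrable setT (EFin \o (\1_(box a b) : V -> R)).
Proof.
rewrite (_ : \1_(box a b) = pd (fun i => \1_(`]a i, b i]%classic))); last first.
  by apply/funext => x; rewrite indic_box.
apply: (integrable_pd _).1 => i; apply: (integrable_indic1 _ _).1 => //.
by rewrite lebesgue_measure_itv/=; case: ifP => _; rewrite ?ltry// -EFinD ltry.
Qed.

Lemma measurable_kap s (a b : R) : 0 < s -> measurable_fun setT (kap s a b).
Proof.
move=> s0; have := @measurable_Rintegral_param _ _ _ _ R lam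
  (fun p : R * R => \1_(`]a, b]%classic) p.2 * gs s (p.2 - p.1)).
apply; apply: measurable_funM; first by apply: (measurableT_comp _ measurable_snd).
apply: (measurableT_comp (cont_measurable (cont_gs s0))).
exact: measurable_funB.
Qed.

Lemma measurable_gd_sub s : 0 < s ->
  measurable_fun setT (fun p : V * V => gd s (p.1 - p.2) : R).
Proof.
move=> s0; apply: measurable_bigprod => i.
apply: (measurableT_comp (cont_measurable (cont_gs s0))).
under eq_fun do rewrite rV_subE.
by apply: measurable_funB; apply: (measurableT_comp (measurable_coord i)).
Qed.

Lemma pd_lorentz_gt0 x : 0 < pd (fun=> @lorentz R) x.
Proof. by apply: prodr_gt0 => i _; exact: lorentz_gt0. Qed.

(** [lorentz_shift] in each coordinate, the box bounding the square of x_i by the sum of the squares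
    of its two end points. *)
Lemma gd_box_bound s a b : 0 < s -> exists2 M : R, 0 <= M & forall x y, box a b x ->
  `|gd s (x - y)| <= M * pd (fun=> @lorentz R) y.
Proof.
move=> s0; have [C C0 hC] := gs_lorentz s0.
have h0 i : 0 <= C * (2 * (1 + (a i ^+ 2 + b i ^+ 2))).
  by rewrite !mulr_ge0// !addr_ge0// sqr_ge0.
exists (\prod_i (C * (2 * (1 + (a i ^+ 2 + b i ^+ 2))))); first exact: prodr_ge0.
move=> x y xab; rewrite gdB_pd /pd normr_prod -big_split /=.
apply: ler_prod => i _; rewrite normr_ge0/= (le_trans (hC _))// -mulrA ler_wpM2l//.
apply: le_trans (lorentz_shift _ _) _; apply: ler_wpM2r; first exact/ltW/lorentz_gt0.
rewrite ler_wpM2l// lerD2l; have := xab i; move: (x ord0 i) (a i) (b i) => t p q /andP[h1 h2].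
have [t0|t0] := leP 0 t.
  have : t ^+ 2 <= q ^+ 2 by rewrite ler_sqr ?nnegrE// (le_trans t0).
  by have := sqr_ge0 p; lra.
have : t ^+ 2 <= p ^+ 2 by nra.
by have := sqr_ge0 q; lra.
Qed.

Section conv.
Variables (f : V -> R) (r : R).
Hypotheses (Lf : L2r mu f) (r0 : 0 < r).

(** f is square integrable but perhaps not integrable. Fubini is therefore applied to f P, which is
    integrable, and to the kernel [ker], which is divided by P and stays bounded because x is
    confined to a box. *)
Let P : V -> R := pd (fun=> @lorentz R).

Let Pbound x : `|P x| <= 1.
Proof.
rewrite (ger0_norm (ltW (pd_lorentz_gt0 x))) (_ : 1 = \prod_(i < d) 1); last by rewrite big1. apply: ler_prod => i _.
by rewrite lorentz_le1 ltW// lorentz_gt0.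
Qed.

Let fP : mu.-integrable setT (EFin \o (fun y => f y * P y)).
Proof.
apply: L2r_mul => //; apply: (L2r_bounded (M := 1)) => //.
  exact: (integrable_pd (fun=> integrable_lorentz)).1.
Qed.

Definition conv s x : R := \int[mu]_y (f y * gd s (x - y)).

Lemma measurable_conv s : 0 < s -> measurable_fun setT (conv s).
Proof.
move=> s0; have := @measurable_Rintegral_param _ _ _ _ R mu
  (fun p : V * V => f p.2 * gd s (p.1 - p.2)).
apply; apply: measurable_funM; last exact: measurable_gd_sub.
exact: (measurableT_comp Lf.1).
Qed.

Let ker s a b (p : V * V) : R := \1_(box a b) p.1 * gd s (p.1 - p.2) / P p.2.

Let ker_bound s a b : 0 < s -> exists2 M : R, 0 <= M & forall p, `|ker s a b p| <= M.
Proof.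
move=> s0; have [M M0 h] := gd_box_bound a b s0; exists M => // -[x y].
rewrite /ker/= indicE; case: (boolP (_ \in _)) => [/set_mem xab|_].
  rewrite mul1r normrM normfV (gtr0_norm (pd_lorentz_gt0 y)).
  by rewrite ler_pdivrMr ?pd_lorentz_gt0//; exact: h.
by rewrite mul0r mul0r normr0.
Qed.

Let measurable_ker s a b : 0 < s -> measurable_fun setT (ker s a b).
Proof.
move=> s0; apply: measurable_funM.
  apply: measurable_funM; last exact: measurable_gd_sub.
  apply: (measurableT_comp _ measurable_fst).
  by apply: measurable_indic; exact: measurable_box.
apply: (measurableT_comp (f := fun y => (P y)^-1) _ measurable_snd).
apply: (eq_measurable_fun (pd (fun=> fun t => 1 + t * t))).
  by move=> y _; rewrite /P /pd -prodfV; apply: eq_bigr => i _; rewrite /lorentz invrK.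
by apply: measurable_pd => i; apply: cont_measurable; cont.
Qed.

Let conv_ker s a b x : \1_(box a b) x * conv s x = \int[mu]_y (f y * P y * ker s a b (x, y)).
Proof.
rewrite indicE; case: (boolP (_ \in _)) => xab.
  rewrite mul1r; apply: eq_Rintegral => y _; rewrite /ker indicE xab mul1r.
  by field; rewrite gt_eqF// pd_lorentz_gt0.
rewrite mul0r; under eq_Rintegral do rewrite /ker indicE (negbTE xab) !mul0r mulr0.
by rewrite Rintegral_cst ?mul0r.
Qed.

Lemma integrable_box_conv s a b : 0 < s ->
  mu.-integrable setT (EFin \o (fun x => \1_(box a b) x * conv s x)).
Proof.
move=> s0; have [M M0 hM] := ker_bound a b s0; have mk := measurable_ker a b s0.
apply: (@le_integrable_norm _ _ _ mu setT _
  (fun x => (M * \int[mu]_y `|f y * P y|) * \1_(box a b) x)) => //.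
- apply: measurable_funM; last exact: measurable_conv.
  by apply: measurable_indic; exact: measurable_box.
- by apply: RintegrableZ => //; exact: integrable_box.
move=> x _; rewrite [in leRHS]indicE; case: (boolP (_ \in _)) => xab; last first.
  by rewrite indicE (negbTE xab) mul0r mulr0 normr0.
rewrite mulr1 conv_ker.
have ik : mu.-integrable setT (EFin \o (fun y => f y * P y * ker s a b (x, y))).
  exact: (integrable_kernel_section x fP mk hM).
apply: le_trans (le_normr_Rintegral measurableT ik) _.
rewrite -RintegralZl//; last exact: (integrable_abse fP).
apply: le_Rintegral => //; first exact: (integrable_abse ik).
  by apply: RintegrableZ => //; exact: (integrable_abse fP).
by move=> y _; rewrite normrM mulrC ler_wpM2r.
Qed.

(** After exchanging the integrals the inner one is a product over the coordinates, with one [kap]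
    for each side of the box. *)
Lemma box_conv s a b : 0 < s -> \int[mu]_x (\1_(box a b) x * conv s x) =
  \int[mu]_y (f y * \prod_i kap s (a i) (b i) (y ord0 i)).
Proof.
move=> s0; have [M M0 hM] := ker_bound a b s0; have mk := measurable_ker a b s0.
transitivity (\int[mu]_x (\1_(box a b) x * \int[mu]_y (f y * P y * ker s a b (x, y)))).
  apply: eq_Rintegral => x _; rewrite -conv_ker indicE.
  by case: (_ \in _); rewrite ?mul1r ?mul0r.
have := @Rfubini_kernel _ _ _ _ _ mu mu (\1_(box a b)) (fun y => f y * P y) (ker s a b) M.
move=> /(_ (integrable_box a b) fP mk hM) ->.
apply: eq_Rintegral => y _; have P0 := pd_lorentz_gt0 y.
pose u (i : 'I_d) (t : R) : R := \1_(`]a i, b i]%classic) t * gs s (t - y ord0 i).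
have ui i : lam.-integrable setT (EFin \o u i).
  have := integrable_gs_shift (y ord0 i) s0.
  under [X in EFin \o X]eq_fun do rewrite -gsN opprB.
  move=> h; under [X in EFin \o X]eq_fun do rewrite /u mulrC.
  apply: (integrable_bounded (M := 1)) => //.
  by move=> t; rewrite indicE; case: (_ \in _); rewrite ?normr1 ?normr0.
have [i1 i2] := integrable_pd ui.
rewrite -i2 (_ : (fun x => _) = fun x => (P y)^-1 * pd u x); last first.
  apply/funext => x.
  have -> : pd u x = \1_(box a b) x * gd s (x - y).
    by rewrite indic_box /gd /pd -big_split/=; apply: eq_bigr => i _; rewrite rV_subE.
  by rewrite /ker/= indicE; case: (_ \in _); rewrite ?mul0r ?mulr0 // !mul1r mulrC.
by rewrite RintegralZl//; field; rewrite gt_eqF.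
Qed.

Hypothesis conv_eq : forall s x, r <= s -> conv s x = conv r x.

(* Since [conv s] does not depend on [s >= r], the limit s -> oo of the box integrals computes those
   of [conv r]. *)
Lemma box_conv_limit a b : \int[mu]_x (\1_(box a b) x * conv r x) =
  \int[mu]_y (f y * \1_(box a b) y).
Proof.
pose u n y := f y * \prod_i kap n.+1%:R (a i) (b i) (y ord0 i).
have key s : r <= s ->
    \int[mu]_y (f y * \prod_i kap s (a i) (b i) (y ord0 i)) = \int[mu]_x (\1_(box a b) x * conv r x).
  move=> rs; rewrite -(box_conv a b (lt_le_trans r0 rs)).
  by apply: eq_Rintegral => x _; rewrite conv_eq.
have lim1 : \int[mu]_y u n y @[n --> \oo] --> \int[mu]_x (\1_(box a b) x * conv r x).
  apply: cvg_near_cst; exists (Num.truncn r).+1 => // n /= rn.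
  rewrite /u; apply: key; by rewrite (le_trans (ltW (truncnS_gt r)))// ler_nat (leq_trans rn).
apply: (cvg_unique _ lim1) => //.
have [D hD] : exists D : 'I_d -> R, forall i, 0 <= D i /\
    forall s t, 1 <= s -> `|kap s (a i) (b i) t| <= D i * lorentz t.
  have h0 i := kap_bound (a i) (b i).
  exists (fun i => s2val (cid2 (h0 i))) => i.
  by case: (cid2 (h0 i)) => D D0 h /=.
have mfn n : measurable_fun setT (u n).
  apply: measurable_funM; first exact: Lf.1.
  by apply: (@measurable_pd R d (fun i => kap n.+1%:R (a i) (b i))) => i; exact: measurable_kap.
apply: (@Rdominated_convergence_ae _ _ _ mu u _ (fun y => (\prod_i D i) * `|f y * P y|)) => //.
- apply: measurable_funM; first exact: Lf.1.
  by apply: measurable_indic; exact: measurable_box.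
- have h i : {ae mu, forall y, y ord0 i <> a i /\ y ord0 i <> b i}.
    by apply: filterS2 (hyperplane_null i (a i)) (hyperplane_null i (b i)).
  have : {ae mu, forall y, forall i, y ord0 i <> a i /\ y ord0 i <> b i}.
    (* [ae_foralln] intersects over the natural numbers, so a coordinate is reached through its
       value. *)
    pose Q (n : nat) y := forall i : 'I_d, val i = n -> y ord0 i <> a i /\ y ord0 i <> b i.
    have : {ae mu, forall y, forall n, Q n y}.
      apply: ae_foralln => n; have [nd|nd] := ltnP n d.
        by apply: filterS (h (Ordinal nd)) => y hy i ni; rewrite (_ : i = Ordinal nd)//; exact: val_inj.
      by apply: aeW => y i ni; have := ltn_ord i; rewrite ni ltnNge nd.
    by apply: filterS => y Qy i; exact: (Qy i i erefl).
  apply: filterS => y hy; apply: cvgM; first exact: cvg_cst.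
  rewrite indic_box /pd; apply: (@cvg_bigprod R _ _ (fun i n => kap n.+1%:R (a i) (b i) (y ord0 i))) => i.
  by have [h1 h2] := hy i; exact: kap_cvg.
- apply: (RintegrableZ _ measurableT); exact: (integrable_abse fP).
- move=> n y; rewrite /u !normrM (ger0_norm (ltW (pd_lorentz_gt0 y))) mulrCA ler_wpM2l//.
  rewrite normr_prod /P /pd -big_split; apply: ler_prod => i _; rewrite normr_ge0/=.
  by have [_ ->] := hD i => //; rewrite ler1n.
Qed.

Lemma approx_identity : {ae mu, forall x, conv r x = f x}.
Proof.
have mc := measurable_conv r0; have [mf fi] := Lf.
have i2 a b : mu.-integrable setT (EFin \o (fun x => \1_(box a b) x * f x)).
  apply: L2r_mul => //; apply: (L2r_bounded (M := 1)); first exact: integrable_box.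
  by move=> x; rewrite indicE; case: (_ \in _); rewrite ?normr1 ?normr0.
have E a b : (fun x => \1_(box a b) x * (conv r x - f x)) =
    fun x => \1_(box a b) x * conv r x - \1_(box a b) x * f x.
  by apply/funext => x; rewrite mulrBr.
have := @ae_eq0_box R d (fun x => conv r x - f x) (measurable_funB mc mf) _ _.
move=> h; apply: (filterS _ (h _ _)) => [x /eqP|n|a b]; first by rewrite subr_eq0 => /eqP.
  by rewrite E; apply: RintegrableB => //; exact: integrable_box_conv.
rewrite E RintegralB//; last exact: integrable_box_conv.
by rewrite box_conv_limit; apply/eqP; rewrite subr_eq0; apply/eqP/eq_Rintegral => x _; rewrite mulrC.
Qed.

End conv.
End approximate_identity.

(** * Unconditional sums and l^2 families *)

Section unconditional_sums.
Variables (R : realType) (J : choiceType).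
Implicit Types (F G : {fset J}) (f g b c : J -> R) (s M S : R) (k n : J).

#[local] Existing Instance totally_filter.

Lemma near_totallyP (P : {fset J} -> Prop) :
  (\forall F \near @totally J, P F) <->
  exists F0 : {fset J}, forall F, (F0 `<=` F)%fset -> P F.
Proof.
by split=> [[F0 _ h]|[F0 h]]; exists F0.
Qed.

Lemma le_cvg_totally (u v : {fset J} -> R) s M F0 : u @ @totally J --> s -> v @ @totally J --> M ->
  (forall F, (F0 `<=` F)%fset -> u F <= v F) -> s <= M.
Proof.
move=> us vM uv; have h : (fun F : {fset J} => v F - u F) @ @totally J --> M - s by exact: cvgB.
rewrite -subr_ge0 -(cvg_lim (@norm_hausdorff _ R) h); apply: limr_ge; first by apply/cvg_ex; eexists; exact: h.
by apply/near_totallyP; exists F0 => F F0F; rewrite /= subr_ge0 uv.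
Qed.

Lemma partial_sumE (Z : zmodType) (f : J -> Z) F : partial_sum f F = \sum_(k <- F) f k.
Proof. by rewrite big_seq_fsetE. Qed.

Lemma fsum_subset F G f : (F `<=` G)%fset ->
  \sum_(k <- G) f k = \sum_(k <- F) f k + \sum_(k <- G | k \notin F) f k.
Proof.
move=> FG; rewrite (bigID (mem F))/=; congr (_ + _).
rewrite -big_filter; apply: perm_big; apply: uniq_perm => [||k].
- exact: filter_uniq.
- exact: fset_uniq.
- rewrite mem_filter; case: (boolP (k \in F)) => //= kF.
  exact: (fsubsetP FG).
Qed.

Lemma le_fsum F G f : (forall k, 0 <= f k) -> (F `<=` G)%fset ->
  \sum_(k <- F) f k <= \sum_(k <- G) f k.
Proof. by move=> f0 FG; rewrite (fsum_subset f FG) lerDl sumr_ge0. Qed.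

Definition hsum f s := (fun F : {fset J} => \sum_(k <- F) f k) @ @totally J --> s.

Definition tsum f : R := lim ((fun F : {fset J} => \sum_(k <- F) f k) @ @totally J).

(** Absolute summability with an explicit bound, over finite sets so that no limit enters. *)
Definition asum f M := forall F, \sum_(k <- F) `|f k| <= M.

Lemma hsum_tsum f s : hsum f s -> tsum f = s.
Proof. by move=> h; exact: cvg_lim. Qed.

Lemma hsum0 : hsum (fun=> 0) 0.
Proof.
rewrite /hsum (_ : (fun F => _) = fun=> 0); first exact: cvg_cst.
by apply/funext => F; rewrite big1.
Qed.

Lemma hsumD f g s M : hsum f s -> hsum g M -> hsum (fun k => f k + g k) (s + M).
Proof. by move=> hf hg; rewrite /hsum; under eq_fun do rewrite big_split/=; exact: cvgD. Qed.

Lemma hsumZ f s M : hsum f s -> hsum (fun k => M * f k) (M * s).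
Proof.
move=> hf; rewrite /hsum; under eq_fun do rewrite -mulr_sumr.
by apply: cvgM => //; exact: cvg_cst.
Qed.

Lemma hsumB f g s M : hsum f s -> hsum g M -> hsum (fun k => f k - g k) (s - M).
Proof. by move=> hf hg; rewrite /hsum; under eq_fun do rewrite sumrB; exact: cvgB. Qed.

Lemma hsum_sum (I : Type) (r : seq I) (f : I -> J -> R) (s : I -> R) :
  (forall i, hsum (f i) (s i)) -> hsum (fun k => \sum_(i <- r) f i k) (\sum_(i <- r) s i).
Proof.
move=> h; elim: r => [|i r IH].
  rewrite big_nil /hsum (_ : (fun F => _) = fun=> 0); first exact: cvg_cst.
  by apply/funext => F; rewrite big1// => k _; rewrite big_nil.
rewrite big_cons (_ : (fun k => _) = fun k => f i k + \sum_(j <- r) f j k); first exact: hsumD.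
by apply/funext => k; rewrite big_cons.
Qed.

Lemma hsum_ge f s F : (forall k, 0 <= f k) -> hsum f s -> \sum_(k <- F) f k <= s.
Proof.
by move=> f0 hf; apply: (le_cvg_totally (F0 := F) (cvg_cst _) hf) => G FG; exact: le_fsum.
Qed.

Lemma hsum_ex_ge0 f M : (forall k, 0 <= f k) -> asum f M -> exists s, hsum f s.
Proof.
move=> f0 fM; pose A := [set \sum_(k <- F) f k | F in [set: {fset J}]].
have hA : has_sup A.
  split; first by exists (\sum_(k <- fset0) f k), fset0.
  exists M => _ [F _ <-]; apply: le_trans (fM F).
  by rewrite le_eqVlt; apply/orP; left; apply/eqP; apply: eq_bigr => k _; rewrite ger0_norm.
exists (sup A); apply/cvgrPdist_le => e e0.
have [_ [F0 _ <-] hF] := sup_adherent e0 hA.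
apply/near_totallyP; exists F0 => F F0F.
rewrite ger0_norm; last by rewrite subr_ge0; apply: ub_le_sup; [exact: hA.2|exists F].
by rewrite lerBlDl -lerBlDr (le_trans (ltW hF))// le_fsum.
Qed.

(** f is the difference of the nonnegative families |f| + f and |f|. *)
Lemma asum_hsum f M : asum f M -> hsum f (tsum f).
Proof.
move=> fM; have [s1 h1] : exists s, hsum (fun k => `|f k|) s.
  by apply: (hsum_ex_ge0 (M := M)) => // F; under eq_bigr do rewrite normr_id; exact: fM.
have [s2 h2] : exists s, hsum (fun k => `|f k| + f k) s.
  apply: (hsum_ex_ge0 (M := M + M)) => [k|F].
    by rewrite -lerBlDr sub0r -normrN ler_norm.
  apply: (@le_trans _ _ (\sum_(k <- F) (`|f k| + `|f k|))).
    by apply: ler_sum => k _; rewrite (le_trans (ler_normD _ _))// normr_id.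
  by rewrite big_split/= lerD.
have : hsum f (s2 - s1).
  by have := hsumB h2 h1; congr (hsum _ _); apply/funext => k; ring.
by move=> h; rewrite (hsum_tsum h).
Qed.

Lemma hsum_cvg f s (B : nat -> {fset J}) : hsum f s ->
  (forall F, \forall N \near \oo, (F `<=` B N)%fset) ->
  \sum_(k <- B N) f k @[N --> \oo] --> s.
Proof.
move=> hf hB; apply/cvgrPdist_le => e e0.
move/cvgrPdist_le : hf => /(_ e e0) /near_totallyP[F0 h].
by apply: filterS (hB F0) => N; exact: h.
Qed.

(** Absolute summability upgrades convergence along a single exhausting sequence of finite sets,
    such as growing cubes, to unconditional convergence. *)
Lemma hsum_of_cvg f M s (B : nat -> {fset J}) : asum f M ->
  (forall F, \forall N \near \oo, (F `<=` B N)%fset) ->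
  \sum_(k <- B N) f k @[N --> \oo] --> s -> hsum f s.
Proof.
move=> /asum_hsum h hB hs; have := hsum_cvg h hB.
by move=> h'; rewrite (_ : s = tsum f)//; apply: (cvg_unique _ hs h').
Qed.

Lemma hsum_restrict f G : hsum (fun k => if k \in G then f k else 0) (\sum_(k <- G) f k).
Proof.
apply/cvgrPdist_le => e e0; apply/near_totallyP; exists G => F GF.
rewrite (fsum_subset _ GF) [X in _ - (_ + X)]big1 => [|k /negbTE -> //].
rewrite addr0 [X in X - _]big_seq [X in _ - X]big_seq.
rewrite [X in _ - X](eq_bigr f) => [|k ->//].
by rewrite subrr normr0 ltW.
Qed.

Lemma hsum_tail f s G : hsum f s ->
  hsum (fun k => if k \in G then 0 else f k) (s - \sum_(k <- G) f k).
Proof.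
move=> hf; have := hsumB hf (@hsum_restrict f G).
by congr (hsum _ _); apply/funext => k; case: ifP => _; rewrite ?subrr ?subr0.
Qed.

Lemma hsum_reindex f s (sg sg' : J -> J) : cancel sg sg' -> cancel sg' sg ->
  hsum f s -> hsum (fun k => f (sg k)) s.
Proof.
move=> sgK sgK' hf; apply/cvgrPdist_le => e e0.
move/cvgrPdist_le : hf => /(_ e e0) /near_totallyP[F0 h].
apply/near_totallyP; exists [fset sg' k | k in F0]%fset => F F0F.
have := h [fset sg k | k in F]%fset.
rewrite big_imfset/=; last by move=> x y _ _; exact: can_inj sgK _ _.
apply; apply/fsubsetP => k kF0; apply/imfsetP; exists (sg' k); rewrite ?sgK'//.
by apply: (fsubsetP F0F); apply/imfsetP; exists k.
Qed.

Lemma cauchy_schwarz_seq (r : seq J) (P : pred J) f g :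
  (\sum_(k <- r | P k) f k * g k) ^+ 2 <=
  (\sum_(k <- r | P k) f k ^+ 2) * (\sum_(k <- r | P k) g k ^+ 2).
Proof.
set A := \sum_(k <- r | P k) f k ^+ 2; set B := \sum_(k <- r | P k) g k ^+ 2.
set C := \sum_(k <- r | P k) f k * g k.
have h m : 0 <= A - 2 * m * C + m ^+ 2 * B.
  have -> : A - 2 * m * C + m ^+ 2 * B = \sum_(k <- r | P k) (f k - m * g k) ^+ 2.
    rewrite /A /B /C !mulr_sumr -sumrB -big_split/=; apply: eq_bigr => k _; ring.
  by apply: sumr_ge0 => k _; exact: sqr_ge0.
have B0 : 0 <= B by apply: sumr_ge0 => k _; exact: sqr_ge0.
have A0 : 0 <= A by apply: sumr_ge0 => k _; exact: sqr_ge0.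
have [B1|B1] := eqVneq B 0.
  have [->|C0] := eqVneq C 0; first by rewrite expr0n/= mulr_ge0.
  (* With B = 0 the nonnegative polynomial is affine in m, and this m gives it the value -1. *)
  have := h ((A + 1) / (2 * C)); rewrite B1 mulr0 addr0.
  have -> : 2 * ((A + 1) / (2 * C)) * C = A + 1 by field.
  lra.
have Bp : 0 < B by rewrite lt_neqAle eq_sym B1.
have := h (C / B); have -> : A - 2 * (C / B) * C + (C / B) ^+ 2 * B = A - C ^+ 2 / B by field.
by rewrite subr_ge0 ler_pdivrMr.
Qed.

(** Cauchy-Schwarz for sqrt |f| and sqrt |f| |g|, the form on which Schur's test relies. *)
Lemma cauchy_schwarz_weight (r : seq J) (P : pred J) f g :
  (\sum_(k <- r | P k) f k * g k) ^+ 2 <=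
  (\sum_(k <- r | P k) `|f k|) * (\sum_(k <- r | P k) `|f k| * g k ^+ 2).
Proof.
have := cauchy_schwarz_seq r P (fun k => Num.sqrt `|f k|) (fun k => Num.sqrt `|f k| * `|g k|).
under [X in _ <= X * _ -> _]eq_bigr do rewrite sqr_sqrtr//.
under [X in _ <= _ * X -> _]eq_bigr do rewrite exprMn sqr_sqrtr// real_normK ?num_real//.
apply: le_trans; rewrite -[leLHS]real_normK ?num_real// -[leRHS]real_normK ?num_real//.
rewrite ler_sqr ?nnegrE// (le_trans (ler_norm_sum _ _ _))// (le_trans _ (ler_norm _))//.
apply: ler_sum => k _; rewrite mulrA -expr2 sqr_sqrtr// normrM//.
Qed.

Definition l2b c S := forall F, \sum_(k <- F) c k ^+ 2 <= S.

Lemma l2b_ge0 c S : l2b c S -> 0 <= S.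
Proof. by move=> /(_ fset0); rewrite big_seq_fset0. Qed.

Lemma l2b_pt c S k : l2b c S -> c k ^+ 2 <= S.
Proof. by move=> /(_ [fset k]%fset); rewrite big_seq_fset1. Qed.

Lemma l2bD b c S M : l2b b S -> l2b c M -> l2b (fun k => b k + c k) (2 * S + 2 * M).
Proof.
move=> bS cM F; apply: (@le_trans _ _ (\sum_(k <- F) (2 * b k ^+ 2 + 2 * c k ^+ 2))).
  apply: ler_sum => k _; have := sqr_ge0 (b k - c k); nra.
by rewrite big_split/= -!mulr_sumr lerD// ler_pM2l.
Qed.

Lemma l2b_le b c S : l2b c S -> (forall k, b k ^+ 2 <= c k ^+ 2) -> l2b b S.
Proof. by move=> cS bc F; apply: le_trans (cS F); apply: ler_sum. Qed.

Lemma l2b_cvg (u : nat -> J -> R) b S :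
  (forall k, u n k @[n --> \oo] --> b k) -> (\forall n \near \oo, l2b (u n) S) -> l2b b S.
Proof.
move=> ub uS F.
have h : \sum_(k <- F) u n k ^+ 2 @[n --> \oo] --> \sum_(k <- F) b k ^+ 2.
  elim: (enum_fset F) => [|k r IH].
    by rewrite big_nil; under eq_fun do rewrite big_nil; exact: cvg_cst.
  rewrite big_cons; under eq_fun do rewrite big_cons; apply: cvgD => //.
  by apply: cvgM; exact: ub.
by apply: (ler_cvg_to h (cvg_cst S)); apply: filterS uS => n; exact.
Qed.

Lemma l2b_tail c S : l2b c S -> forall e, 0 < e -> exists F0 : {fset J}, forall F,
  (F0 `<=` F)%fset -> l2b (fun k => if k \in F then 0 else c k) e.
Proof.
move=> cS e e0.
have [s hs] : exists s, hsum (fun k => c k ^+ 2) s.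
  apply: (hsum_ex_ge0 (M := S)) => [k|F]; first exact: sqr_ge0.
  by under eq_bigr do rewrite ger0_norm ?sqr_ge0//; exact: cS.
move/cvgrPdist_le : (hs) => /(_ e e0) /near_totallyP[F0 h]; exists F0 => F /h hF G.
have := hsum_ge (F `|` G)%fset (fun k => sqr_ge0 (c k)) hs.
rewrite (fsum_subset _ (fsubsetUl F G)) => h2.
have h3 : \sum_(k <- G) (if k \in F then 0 else c k) ^+ 2 <=
    \sum_(k <- (F `|` G)%fset | k \notin F) c k ^+ 2.
  rewrite [leRHS]big_mkcond/=.
  apply: (@le_trans _ _ (\sum_(k <- (F `|` G)%fset) (if k \in F then 0 else c k) ^+ 2)).
    by apply: le_fsum; [move=> k; exact: sqr_ge0|exact: fsubsetUr].
  by apply: ler_sum => k _; case: ifP; rewrite ?expr0n.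
have := le_trans (ler_norm _) hF; lra.
Qed.

Lemma l2b_asum c f S M : l2b c S -> l2b f M -> asum (fun k => c k * f k) (S + M).
Proof.
move=> cS fM F; apply: (@le_trans _ _ (\sum_(k <- F) (c k ^+ 2 + f k ^+ 2))).
  apply: ler_sum => k _; rewrite -[c k ^+ 2]real_normK ?num_real// -[f k ^+ 2]real_normK ?num_real//.
  by rewrite normrM; have := sqr_ge0 (`|c k| - `|f k|);
    have := mulr_ge0 (normr_ge0 (c k)) (normr_ge0 (f k)); nra.
by rewrite big_split/= lerD.
Qed.

Lemma hsum_sqr_le c f S M s : l2b c S -> l2b f M -> hsum (fun k => c k * f k) s ->
  s ^+ 2 <= S * M.
Proof.
move=> cS fM hs; have h2 : (fun F : {fset J} => (\sum_(k <- F) c k * f k) ^+ 2) @ @totally J --> s ^+ 2.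
  exact: cvgM.
apply: (le_cvg_totally (F0 := fset0) h2 (cvg_cst _)) => F _.
apply: le_trans (cauchy_schwarz_seq _ _ _ _) _; apply: ler_pM => //.
- by apply: sumr_ge0 => k _; exact: sqr_ge0.
- by apply: sumr_ge0 => k _; exact: sqr_ge0.
Qed.

End unconditional_sums.

(** * Moving coefficients to the good points *)

Section neumann.
Variables (R : realType) (J : choiceType) (X : Type).
Variables (N : J -> J -> R) (h df : J -> X -> R) (M : R).
Implicit Types (F G : {fset J}) (b c u : J -> R) (S e : R) (k n : J) (x : X).

#[local] Existing Instance totally_filter.

Hypothesis M0 : 0 < M.
Hypothesis Nrow : forall k, asum (N k) (1 / 2).
Hypothesis Ncol : forall n, asum (N^~ n) (1 / 2).
Hypothesis hM : forall x, l2b (h^~ x) M.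
Hypothesis Ndf : forall n x, hsum (fun k => N k n * h k x) (df n x).

Definition op b k : R := tsum (fun n => N k n * b n).

Let N_le1 k n : `|N k n| <= 1.
Proof.
have := Nrow k [fset n]%fset; rewrite big_seq_fset1 => /le_trans; apply.
by rewrite ler_pdivrMr// mul1r ler1n.
Qed.

Let Nl2 k : l2b (N k) (1 / 2).
Proof.
move=> F; apply: le_trans (Nrow k F); apply: ler_sum => n _.
by rewrite -real_normK ?num_real// expr2 ler_piMl.
Qed.

Lemma op_hsum b S k : l2b b S -> hsum (fun n => N k n * b n) (op b k).
Proof. by move=> bS; apply: (asum_hsum (M := 1 / 2 + S)); exact: l2b_asum. Qed.

(* Schur's test. *)
Lemma op_l2b b S : l2b b S -> l2b (op b) (S / 4).
Proof.
move=> bS F.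
have hc : (fun G : {fset J} => \sum_(k <- F) (\sum_(n <- G) N k n * b n) ^+ 2) @ @totally J -->
    \sum_(k <- F) op b k ^+ 2.
  elim: (enum_fset F) => [|k r IH].
    by rewrite big_nil; under eq_fun do rewrite big_nil; exact: cvg_cst.
  rewrite big_cons; under eq_fun do rewrite big_cons; apply: cvgD => //.
  by apply: cvgM; exact: op_hsum bS.
apply: (le_cvg_totally (F0 := fset0) hc (cvg_cst _)) => G _.
apply: (@le_trans _ _ (\sum_(k <- F) 1 / 2 * \sum_(n <- G) `|N k n| * b n ^+ 2)).
  apply: ler_sum => k _; apply: le_trans (cauchy_schwarz_weight _ _ _ _) _.
  rewrite ler_wpM2r//; last exact: Nrow.
  by apply: sumr_ge0 => n _; rewrite mulr_ge0// sqr_ge0.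
rewrite -mulr_sumr exchange_big/=.
apply: (@le_trans _ _ (1 / 2 * \sum_(n <- G) 1 / 2 * b n ^+ 2)).
  rewrite ler_wpM2l//; apply: ler_sum => n _; rewrite -mulr_suml ler_wpM2r ?sqr_ge0//.
  exact: Ncol.
by rewrite -mulr_sumr; have := bS G; lra.
Qed.

Lemma opB b c S S' k : l2b b S -> l2b c S' -> op (fun n => b n - c n) k = op b k - op c k.
Proof.
move=> bS cS; apply: hsum_tsum; have := hsumB (@op_hsum b S k bS) (@op_hsum c S' k cS).
by congr (hsum _ _); apply/funext => n; rewrite mulrBr.
Qed.

(* The two sides agree for finitely supported [b] and are continuous in the l2-norm. *)
Lemma hsum_op b S x : l2b b S ->
  hsum (fun n => b n * df n x) (tsum (fun k => op b k * h k x)).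
Proof.
move=> bS; apply/cvgrPdist_le => e e0.
have e1 : 0 < e ^+ 2 / M by rewrite divr_gt0// exprn_gt0.
have [G0 hG] := l2b_tail bS e1; apply/near_totallyP; exists G0 => G /hG bG.
(* The error is N applied to this tail and paired with h, so its square is at most (e^2/M/4) M =
   e^2/4. *)
pose b' n := if n \in G then 0 else b n.
have opE k : op b' k = op b k - \sum_(n <- G) N k n * b n.
  apply: hsum_tsum; have := @hsum_tail _ _ _ _ G (@op_hsum b S k bS).
  by congr (hsum _ _); apply/funext => n; rewrite /b'; case: ifP => _; rewrite ?mulr0.
have h0 : hsum (fun k => op b k * h k x) (tsum (fun k => op b k * h k x)).
  by apply: (asum_hsum (M := S / 4 + M)); apply: l2b_asum => //; exact: op_l2b.
have h1 : hsum (fun k => \sum_(n <- G) b n * (N k n * h k x)) (\sum_(n <- G) b n * df n x).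
  by apply: hsum_sum => n; apply: hsumZ; exact: Ndf.
have h2 := hsumB h0 h1; rewrite -ler_sqr ?nnegrE ?(ltW e0)// real_normK ?num_real//.
have : (tsum (fun k => op b k * h k x) - \sum_(n <- G) b n * df n x) ^+ 2 <= e ^+ 2 / M / 4 * M.
  apply: (@hsum_sqr_le _ _ (op b') (h^~ x)); [exact: op_l2b|exact: hM|].
  move: h2; congr (hsum _ _); apply/funext => k; rewrite opE mulrBl mulr_suml.
  by congr (_ - _); apply: eq_bigr => n _; ring.
move/le_trans; apply; rewrite (_ : _ * M = e ^+ 2 / 4); last by field; rewrite gt_eqF.
by have := sqr_ge0 e; lra.
Qed.

(** The iterates of u -> c + N u from 0 are the partial sums of the Neumann series. They converge
    coordinatewise, and [l2b_cvg] hands their l^2 bounds to the limit. *)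
Lemma neumann c S : l2b c S -> exists2 u, l2b u (4 * S) & forall k, u k = c k + op u k.
Proof.
move=> cS.
pose U m := iter m (fun (u : J -> R) k => c k + op u k) (fun=> 0).
have S0 := l2b_ge0 cS.
(* The bound reproduces itself: 2S + 2(4S/4) = 4S. *)
have US m : l2b (U m) (4 * S).
  elim: m => [|m IH]; first by move=> F; rewrite big1 ?mulr_ge0// => k _; rewrite /= expr0n.
  by move=> F; have := l2bD cS (op_l2b IH) F; rewrite (_ : 2 * S + _ = 4 * S)//; field.
(* This difference is N^l applied to [U m]; each application divides the squared norm bound by 4. *)
have UU l m : l2b (fun k => U (l + m)%N k - U l k) (4 * S / 4 ^+ l).
  elim: l => [|l IH].
    by rewrite add0n expr0 divr1; apply: (l2b_le (US m)) => k; rewrite /= subr0.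
  have := op_l2b IH; rewrite exprS invfM (mulrC 4^-1) mulrA => h'.
  apply: (l2b_le h') => k; rewrite addSn /= (opB _ (US _) (US _)).
  by rewrite (_ : _ - _ = op (U (l + m)%N) k - op (U l) k)//; ring.
have g0 : (fun l => 4 * S / 4 ^+ l) @ \oo --> (0 : R).
  rewrite -(mulr0 (4 * S)); apply: cvgM; first exact: cvg_cst.
  under eq_fun do rewrite -exprVn; apply: cvg_expr.
  by rewrite ger0_norm ?invr_ge0// invf_lt1// ltr1n.
have Ucv k : cvg (U m k @[m --> \oo]).
  apply/cauchy_cvgP/cauchyP => e e0; have e2 : 0 < e ^+ 2 by rewrite exprn_gt0.
  have /cvgrPdist_lt/(_ _ e2) [l _ hl] := g0.
  exists (U l k); exists l => // m /= lm; rewrite /ball/= -(subnKC lm) distrC.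
  rewrite -ltr_sqr ?nnegrE ?(ltW e0)// real_normK ?num_real//.
  apply: le_lt_trans (l2b_pt k (UU l (m - l)%N)) _.
  by have := hl l (leqnn l); rewrite sub0r normrN; apply: le_lt_trans (ler_norm _).
pose u k := lim (U m k @[m --> \oo]).
have uU l : l2b (fun k => u k - U l k) (4 * S / 4 ^+ l).
  apply: (@l2b_cvg _ _ (fun m k => U (l + m)%N k - U l k)); last by apply: nearW => m; exact: UU.
  move=> k; apply: cvgB; last exact: cvg_cst.
  by under eq_fun do rewrite addnC; have := Ucv k; rewrite -(cvg_shiftn l).
have uS : l2b u (4 * S) by apply: (l2b_cvg (u := U)) => //; apply: nearW.
exists u => // k.
have h1 : op (U m) k @[m --> \oo] --> op u k.
  apply/cvgrPdist_le => e e0; have e2 : 0 < e ^+ 2 by rewrite exprn_gt0.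
  have /cvgrPdist_lt/(_ _ e2) := g0; apply: filterS => l hl.
  rewrite -(opB k uS (US l)) -ler_sqr ?nnegrE ?(ltW e0)// real_normK ?num_real//.
  apply: le_trans (l2b_pt k (op_l2b (uU l))) _.
  move: hl; rewrite sub0r normrN => /(le_lt_trans (ler_norm _)).
  have : 0 <= 4 * S / 4 ^+ l by rewrite divr_ge0// ?mulr_ge0// exprn_ge0.
  lra.
have h2 : U m.+1 k @[m --> \oo] --> c k + op u k by apply: cvgD => //; exact: cvg_cst.
have h3 : U m.+1 k @[m --> \oo] --> u k by have := Ucv k; rewrite -cvg_shiftS.
exact: (cvg_unique _ h3 h2).
Qed.

(** [sg] is the shift to the neighbour. It is a bijection of the whole index set, so that reindexing
    by it keeps sums and l^2 bounds. *)
Variables (bad : pred J) (sg sg' : J -> J).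
Hypotheses (sgK : cancel sg sg') (sgK' : cancel sg' sg).
Hypothesis sg_good : forall n, bad n -> ~~ bad (sg n).
Hypothesis dfE : forall n x, df n x = if bad n then h n x - h (sg n) x else 0.

(* With u = c + N u, the function synthesised from [u] minus the one synthesised from [N u] is the
   one synthesised from [c]; on bad indices this replaces h_n by h_(sg n). *)
Lemma synthesis_good c S : l2b c S -> exists2 a, l2b a (16 * S) &
  (forall n, bad n -> a n = 0) /\
  forall x s, hsum (fun n => c n * h n x) s -> hsum (fun n => a n * h n x) s.
Proof.
move=> cS; have [u uS uE] := neumann cS.
pose b1 n := if bad n then 0 else u n; pose b2 n := if bad n then u n else 0.
(* A good index keeps its own coefficient and also receives that of [sg' n] when that index is bad;
   by [sg_good] nothing is sent to a bad index. *)
pose a n := if bad n then 0 else u n + b2 (sg' n).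
have b1S : l2b b1 (4 * S).
  by apply: (l2b_le uS) => n; rewrite /b1; case: ifP => // _; rewrite expr0n sqr_ge0.
have b2S : l2b b2 (4 * S).
  by apply: (l2b_le uS) => n; rewrite /b2; case: ifP => // _; rewrite expr0n sqr_ge0.
have b2S' : l2b (fun n => b2 (sg' n)) (4 * S).
  move=> F; have := b2S [fset sg' n | n in F]%fset; rewrite big_imfset//=.
  by move=> ? ? _ _; exact: can_inj sgK' _ _.
have aE n : a n = b1 n + b2 (sg' n).
  rewrite /a /b1; case: ifP => // bn; rewrite /b2 ifF ?addr0//.
  by apply/negP => /sg_good; rewrite sgK' bn.
exists a; last split.
- move=> F; under eq_bigr do rewrite aE; have := l2bD b1S b2S' F.
  by rewrite (_ : 2 * (4 * S) + _ = 16 * S)//; ring.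
- by move=> n bn; rewrite /a bn.
move=> x s hs.
have uh : hsum (fun n => u n * h n x) (tsum (fun n => u n * h n x)).
  by apply: (asum_hsum (M := 4 * S + M)); exact: l2b_asum.
have oh : hsum (fun n => op u n * h n x) (tsum (fun n => op u n * h n x)).
  by apply: (asum_hsum (M := 4 * S / 4 + M)); apply: l2b_asum => //; exact: op_l2b.
have sE : s = tsum (fun n => u n * h n x) - tsum (fun n => op u n * h n x).
  have := hsumB uh oh; move/hsum_tsum => <-; rewrite -(hsum_tsum hs); congr tsum.
  by apply/funext => n; rewrite [in RHS]uE; ring.
have h1 := hsumB uh (@hsum_op u (4 * S) x uS); rewrite -sE in h1.
have p1 : hsum (fun n => b1 n * h n x) (tsum (fun n => b1 n * h n x)).
  by apply: (asum_hsum (M := 4 * S + M)); exact: l2b_asum.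
have p2 : hsum (fun n => b2 n * h (sg n) x) (tsum (fun n => b2 n * h (sg n) x)).
  apply: (asum_hsum (M := 4 * S + M)); apply: l2b_asum => // F.
  have := hM x [fset sg n | n in F]%fset; rewrite big_imfset//=.
  by move=> ? ? _ _; exact: can_inj sgK _ _.
have := hsumD p1 (hsum_reindex sgK' sgK p2).
(* For bad n, h n - df n is h (sg n), so u (h - df) is the sum of the two families termwise; its
   total is s by h1. *)
have -> : tsum (fun n => b1 n * h n x) + tsum (fun n => b2 n * h (sg n) x) = s.
  rewrite -(hsum_tsum (hsumD p1 p2)) -(hsum_tsum h1); congr tsum; apply/funext => n.
  by rewrite dfE /b1 /b2; case: ifP => _; ring.
by congr (hsum _ _); apply/funext => n; rewrite aE sgK' mulrDl.
Qed.

End neumann.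

(** * Lattice expansions *)

Section lattice.
Variables (R : realType) (d : nat).
Local Notation lam := (@lebesgue_measure R).
Local Notation mu := (lebesgue_rV R d).
Local Notation V := 'rV[R]_d.
Local Notation J := {ffun 'I_d -> int}.
Implicit Types (n : J) (x y z : V) (s r e : R) (F : {fset J}) (N : nat) (i : 'I_d).

Definition pt e n : V := \row_i (e * (n i)%:~R).

(** Ordinals below 2N + 1 recentred to -N..N, as in [symsum]. Indexing the cube by functions into
    ordinals lets distributivity turn its sums into products of one-dimensional sums. *)
Definition lat N (k : {ffun 'I_d -> 'I_(2 * N).+1}) : J := [ffun i => (k i)%:Z - N%:Z].

Definition boxs N : {fset J} := [fset lat k | k in {ffun 'I_d -> 'I_(2 * N).+1}]%fset.

Lemma boxs_cover F : \forall N \near \oo, (F `<=` boxs N)%fset.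
Proof.
pose B := (\max_(n <- F) \max_i `|n i|)%N.
exists B => // N /= BN; apply/fsubsetP => n nF.
have nN i : (`|n i| <= N)%N.
  have h1 : (\max_i `|n i| <= B)%N.
    by apply: (leq_bigmax_seq (F := fun n : J => (\max_i `|n i|)%N)).
  by apply: leq_trans (leq_trans h1 BN); exact: (@leq_bigmax _ (fun i => `|n i|%N)).
apply/imfsetP; exists [ffun i => inord (absz (n i + N%:Z))] => //.
apply/ffunP => i; rewrite !ffunE inordK; have := nN i; lia.
Qed.

Lemma lat_inj N : injective (@lat N).
Proof.
move=> k k' /ffunP h; apply/ffunP => i; apply: val_inj.
by have := h i; rewrite !ffunE /=; lia.
Qed.

Lemma sum_boxs N (phi : 'I_d -> R -> R) :
  \sum_(n <- boxs N) \prod_i phi i (n i)%:~R = \prod_i symsum N (phi i).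
Proof.
rewrite big_imfset/=; last by move=> ? ? _ _; exact: lat_inj.
rewrite /symsum bigA_distr_bigA/= big_enum/=; apply: eq_bigr => k _.
by apply: eq_bigr => i _; rewrite ffunE intrB.
Qed.

(** Every finite set lies in some cube, and over a cube the sum of products factorises. *)
Lemma sum_lattice_le (phi : 'I_d -> R -> R) (B : 'I_d -> R) :
  (forall i t, 0 <= phi i t) -> (forall i N, symsum N (phi i) <= B i) ->
  forall F, \sum_(n <- F) \prod_i phi i (n i)%:~R <= \prod_i B i.
Proof.
move=> phi0 hB F; have [N _ /(_ N (leqnn N)) FN] := boxs_cover F.
apply: (@le_trans _ _ (\sum_(n <- boxs N) \prod_i phi i (n i)%:~R)).
  by apply: le_fsum => // n; exact: prodr_ge0.
by rewrite sum_boxs; apply: ler_prod => i _; rewrite hB andbT; apply: sumr_ge0.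
Qed.

Lemma pd_normE (u : 'I_d -> R -> R) x : `|pd u x| = pd (fun i t => `|u i t|) x.
Proof. exact: normr_prod. Qed.

Lemma exp_pd e (u : 'I_d -> R -> R) x : e ^+ d * pd u x = \prod_i (e * u i (x ord0 i)).
Proof. by rewrite /pd big_split/= prodr_const card_ord. Qed.

Lemma gd_lattice_bound s : 0 < s -> exists2 M : R, 0 < M &
  forall e y F, 0 < e -> e <= 1 -> \sum_(n <- F) e ^+ d * `|gd s (pt e n - y)| <= M.
Proof.
move=> s0; have [M M0 hM] := symsum_gs_bounded s0.
exists ((M + 1) ^+ d); first by rewrite exprn_gt0// ltr_wpDl.
move=> e y F e0 e1.
have -> : (M + 1) ^+ d = \prod_(i < d) (M + 1) by rewrite prodr_const card_ord.
pose phi (i : 'I_d) (t : R) := e * `|gs s (e * t - y ord0 i)|.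
rewrite (eq_bigr (fun n => \prod_i phi i (n i)%:~R)).
  apply: sum_lattice_le => [i t|i N]; first by rewrite mulr_ge0// ltW.
  by apply: le_trans (hM e N (y ord0 i) e0 e1) _; rewrite lerDl.
move=> n _; rewrite /gd pd_normE exp_pd; apply: eq_bigr => i _.
by rewrite !mxE.
Qed.

Lemma gdN s x : gd s (- x) = gd s x.
Proof. by apply: eq_bigr => i _; rewrite mxE gsN. Qed.

Lemma gd_subC s x y : gd s (x - y) = gd s (y - x).
Proof. by rewrite -gdN opprB. Qed.

Lemma sampling_nd e r x y : 0 < e -> e <= 1 -> 0 < r -> 4 * r <= (2 * e)^-1 ->
  \sum_(n <- boxs N) (e ^+ d * gd (2 * r) (pt e n - y)) * gd r (x - pt e n) @[N --> \oo] -->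
  gd r (x - y).
Proof.
move=> e0 e1 r0 re.
pose phi (i : 'I_d) (t : R) := e * gs (2 * r) (e * t - y ord0 i) * gs r (x ord0 i - e * t).
rewrite (_ : (fun N => _) = fun N => \prod_i symsum N (phi i)).
  rewrite /gd /pd; apply: (@cvg_bigprod R _ _ (fun i N => symsum N (phi i))) => i.
  by rewrite rV_subE; exact: sampling.
apply/funext => N; rewrite -sum_boxs; apply: eq_bigr => n _.
by rewrite /gd exp_pd /pd -big_split/=; apply: eq_bigr => i _; rewrite !mxE.
Qed.

(* [lorentz a * lorentz b <= 2 * lorentz (a + b)] turns one factor of decay in [k] into decay in
   [x - y]. *)
Lemma gs_pair_bound r : 0 < r -> exists2 D : R, 0 <= D & forall e N (x y : R), 0 < e -> e <= 1 ->
  symsum N (fun k => `|e * gs (2 * r) (e * k - y) * gs r (x - e * k)|) <= D * lorentz (x - y).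
Proof.
move=> r0; have r20 : 0 < 2 * r by rewrite mulr_gt0.
have [C C0 hC] := gs_decay 0 r20; have [D D0 hD] := gs_lorentz r0.
exists (C * D * 2 * (3 * pi)); first by rewrite !mulr_ge0// pi_ge0.
move=> e N x y e0 e1.
apply: (@le_trans _ _ (C * D * 2 * lorentz (x - y) * symsum N (fun k => e * lorentz (e * k - y)))).
  rewrite -symsumZ; apply: le_symsum => k.
  rewrite !normrM (gtr0_norm e0).
  set a := e * k - y; set b := x - e * k.
  have hab : lorentz a * lorentz b <= 2 * lorentz (x - y).
    have -> : x - y = a + b by rewrite /a /b; ring.
    have p t : 0 < 1 + t ^+ 2 :> R by rewrite ltr_pwDl// sqr_ge0.
    rewrite /lorentz -invfM ler_pdivlMr// mulrC ler_pdivrMr ?mulr_gt0//.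
    have := sqr_ge0 (a * b); have := sqr_ge0 (a - b); nra.
  have la := lorentz_gt0 a; have lb := lorentz_gt0 b.
  apply: (@le_trans _ _ (e * (C * lorentz a ^+ 2) * (D * lorentz b))).
    by apply: ler_pM; rewrite ?mulr_ge0 ?(ltW e0)// ler_wpM2l ?(ltW e0)//; exact: hC.
  rewrite [leLHS](_ : _ = C * D * e * lorentz a * (lorentz a * lorentz b)); last by ring.
  rewrite [leRHS](_ : _ = C * D * e * lorentz a * (2 * lorentz (x - y))); last by ring.
  by apply: ler_wpM2l => //; rewrite !mulr_ge0// ltW.
rewrite [leRHS](_ : _ = C * D * 2 * lorentz (x - y) * (3 * pi)); last by ring.
apply: ler_wpM2l; last exact: symsum_lorentz_le.
by rewrite !mulr_ge0// ltW// lorentz_gt0.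
Qed.

Lemma gd_pair_bound r : 0 < r -> exists2 D : R, 0 <= D & forall e F x y, 0 < e -> e <= 1 ->
  \sum_(n <- F) `|e ^+ d * gd (2 * r) (pt e n - y) * gd r (x - pt e n)| <=
  D * pd (fun=> @lorentz R) (x - y).
Proof.
move=> r0; have [D D0 hD] := gs_pair_bound r0; exists (D ^+ d) => [|e F x y e0 e1].
  exact: exprn_ge0.
pose phi (i : 'I_d) (t : R) := `|e * gs (2 * r) (e * t - y ord0 i) * gs r (x ord0 i - e * t)|.
rewrite (eq_bigr (fun n => \prod_i phi i (n i)%:~R)).
  have -> : D ^+ d * pd (fun=> @lorentz R) (x - y) = \prod_i (D * lorentz (x ord0 i - y ord0 i)).
    by rewrite exp_pd; apply: eq_bigr => i _; rewrite rV_subE.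
  by apply: sum_lattice_le => [i t|i N]; [exact: normr_ge0|exact: hD].
move=> n _; rewrite /gd exp_pd /pd -big_split/= normr_prod; apply: eq_bigr => i _.
by rewrite !mxE.
Qed.

Definition dlt (i0 : 'I_d) e : V := \row_i (if i == i0 then e else 0).

(** Only the factor of coordinate i0 changes, and [gs_diff] gains a factor e there; the other
    factors are bounded by [symsum_gs_bounded]. *)
Lemma gd_diff_bound (i0 : 'I_d) s : 0 < s -> exists2 C : R, 0 <= C & forall e y F, 0 < e -> e <= 1 ->
  \sum_(n <- F) `|e ^+ d * (gd s (pt e n - y) - gd s (pt e n - y - dlt i0 e))| <= e * C.
Proof.
move=> s0; have [M M0 hM] := symsum_gs_bounded s0; have [C C0 hC] := gs_diff s0.
exists (C * (3 * pi) * \prod_(i < d | i != i0) M).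
  by rewrite !mulr_ge0 ?pi_ge0// prodr_ge0.
move=> e y F e0 e1.
(* In coordinate i0 one factor e belongs to the Riemann sum and the other is the gain. *)
pose phi (i : 'I_d) (t : R) := if i == i0 then e * (e * C * lorentz (e * t - y ord0 i))
  else e * `|gs s (e * t - y ord0 i)|.
pose B (i : 'I_d) := if i == i0 then e * (C * (3 * pi)) else M.
have -> : e * (C * (3 * pi) * \prod_(i < d | i != i0) M) = \prod_i B i.
  rewrite [RHS](bigD1 i0)//= {1}/B eqxx mulrA; congr (_ * _).
  by apply: eq_bigr => i /negbTE ii; rewrite /B ii.
apply: (@le_trans _ _ (\sum_(n <- F) \prod_i phi i (n i)%:~R)); last first.
  apply: sum_lattice_le => [i t|i N]; rewrite /phi /B; case: ifP => _ //.
  - by rewrite !mulr_ge0 ?(ltW e0)// ltW// lorentz_gt0.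
  - by rewrite mulr_ge0// ltW.
  - rewrite (_ : (fun t : R => _) = fun t => e * C * (e * lorentz (e * t - y ord0 i))); last first.
      by apply/funext => t; ring.
    by rewrite symsumZ -mulrA ler_wpM2l ?(ltW e0)// ler_wpM2l// symsum_lorentz_le.
  - exact: hM.
apply: ler_sum => n _.
rewrite mulrBr /gd !exp_pd (bigD1 i0)//= [X in _ - X](bigD1 i0)//=.
rewrite [X in _ - _ * X](eq_bigr (fun i => e * gs s ((pt e n - y) ord0 i))); last first.
  by move=> i /negbTE ii; rewrite !mxE ii subr0.
set P := \prod_(i < d | i != i0) _.
rewrite -(mulrBl P) normrM [leRHS](bigD1 i0)//= /P normr_prod ler_pM//.
- by apply: prodr_ge0.
- rewrite /phi eqxx -mulrBr normrM (gtr0_norm e0) ler_wpM2l ?(ltW e0)//.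
  by rewrite !mxE eqxx; exact: hC.
- rewrite le_eqVlt; apply/orP; left; apply/eqP; apply: eq_bigr => i /negbTE ii.
  by rewrite /phi ii normrM (gtr0_norm e0) !mxE.
Qed.

End lattice.

(** * Finite sums and weighted Cauchy-Schwarz for integrals *)

Section integral_lemmas.
Context d (T : measurableType d) (R : realType).
Variable nu : {measure set T -> \bar R}.
Implicit Types (f g : T -> R).

Lemma Rintegral_sum_seq (I : Type) (r : seq I) (g : I -> T -> R) :
  (forall i, nu.-integrable setT (EFin \o g i)) ->
  nu.-integrable setT (EFin \o (fun y => \sum_(i <- r) g i y)) /\
  \int[nu]_y (\sum_(i <- r) g i y) = \sum_(i <- r) \int[nu]_y g i y.
Proof.
move=> gi; elim: r => [|i r [IH1 IH2]].
  rewrite (_ : (fun y => _) = fun=> 0); last by apply/funext => y; rewrite big_nil.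
  by rewrite big_nil Rintegral_cst ?mul0r//; split=> //; exact: integrable0.
rewrite (_ : (fun y => _) = fun y => g i y + \sum_(j <- r) g j y); last first.
  by apply/funext => y; rewrite big_cons.
split; first exact: RintegrableD.
by rewrite big_cons RintegralD// IH2.
Qed.

Lemma Rintegral_cauchy_schwarz f g (W : R) : 0 < W ->
  nu.-integrable setT (EFin \o (fun y => f y * g y)) ->
  nu.-integrable setT (EFin \o (fun y => f y ^+ 2 * `|g y|)) ->
  nu.-integrable setT (EFin \o (fun y => `|g y|)) -> \int[nu]_y `|g y| <= W ->
  (\int[nu]_y (f y * g y)) ^+ 2 <= W * \int[nu]_y (f y ^+ 2 * `|g y|).
Proof.
move=> W0 i1 i2 i3 gW.
have i1' : nu.-integrable setT (EFin \o (fun y => `|f y * g y|)) by exact: (integrable_abse i1).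
set S := \int[nu]_y `|f y * g y|; set Q := \int[nu]_y (f y ^+ 2 * `|g y|).
have h1 : `|\int[nu]_y (f y * g y)| <= S by exact: le_normr_Rintegral.
(* The minimiser of Q - 2 m S + m^2 W, where the mass of |g| is replaced by its bound W. *)
pose m := S / W.
have : 0 <= \int[nu]_y (f y ^+ 2 * `|g y| - 2 * m * `|f y * g y| + m ^+ 2 * `|g y|).
  apply: Rintegral_ge0 => y _; rewrite normrM.
  have -> : f y ^+ 2 * `|g y| - 2 * m * (`|f y| * `|g y|) + m ^+ 2 * `|g y| =
            (`|f y| - m) ^+ 2 * `|g y| by rewrite -[f y ^+ 2]real_normK ?num_real//; ring.
  by rewrite mulr_ge0// sqr_ge0.
rewrite RintegralD//; last 2 first.
- by apply: RintegrableB => //; exact: RintegrableZ.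
- exact: RintegrableZ.
rewrite RintegralB//; last exact: RintegrableZ.
rewrite !RintegralZl// -/S -/Q => h2.
have h3 : m ^+ 2 * \int[nu]_y `|g y| <= m ^+ 2 * W by rewrite ler_wpM2l ?sqr_ge0.
rewrite -[leLHS]real_normK ?num_real//.
apply: (@le_trans _ _ (S ^+ 2)); first by rewrite ler_sqr ?nnegrE// (le_trans _ h1).
have h4 : 0 <= Q - 2 * m * S + m ^+ 2 * W by lra.
have h5 : Q - 2 * m * S + m ^+ 2 * W = Q - S ^+ 2 / W by rewrite /m; field; rewrite gt_eqF.
by move: h4; rewrite h5 subr_ge0 ler_pdivrMr// mulrC.
Qed.

End integral_lemmas.

(** * Expansion over the full lattice *)

Section expansion.
Variables (R : realType) (d : nat).
Local Notation lam := (@lebesgue_measure R).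
Local Notation mu := (lebesgue_rV R d).
Local Notation V := 'rV[R]_d.
Local Notation J := {ffun 'I_d -> int}.
Implicit Types (n : J) (x y z : V) (s r e : R) (F : {fset J}) (N : nat) (i : 'I_d) (f : V -> R).

Lemma gd_L1 s : 0 < s -> exists2 W : R, 0 < W & forall x,
  mu.-integrable setT (EFin \o (fun y => `|gd s (x - y)|)) /\
  \int[mu]_y `|gd s (x - y)| <= W.
Proof.
move=> s0; have [C C0 hC] := @gs_lorentz R s s0.
exists ((C * pi + 1) ^+ d); first by rewrite exprn_gt0// ltr_wpDl// mulr_ge0// pi_ge0.
move=> x; pose u (i : 'I_d) (t : R) := C * lorentz (t - x ord0 i).
have ui i : lam.-integrable setT (EFin \o u i).
  by apply: RintegrableZ => //; exact: (lorentz_shift_int _).1.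
have [i1 i2] := integrable_pd ui.
have i3 : mu.-integrable setT (EFin \o (fun y => `|gd s (x - y)|)).
  exact: (integrable_abse (integrable_gdB x s0)).
split=> //; apply: (@le_trans _ _ (\int[mu]_y pd u y)).
  apply: le_Rintegral => // y _; rewrite gd_subC /gd pd_normE; apply: ler_prod => i _.
  by rewrite normr_ge0/= rV_subE; exact: hC.
rewrite i2 -[d in leRHS]card_ord -prodr_const; apply: ler_prod => i _.
have [j1 j2] := lorentz_shift_int (x ord0 i).
rewrite RintegralZl//; apply/andP; split.
  by rewrite mulr_ge0// Rintegral_ge0// => t _; exact/ltW/lorentz_gt0.
by rewrite ler_wpDr// ler_wpM2l.
Qed.

Section coefficients.
Variables (f : V -> R) (r e : R).
Hypotheses (Lf : L2r mu f) (r0 : 0 < r) (e0 : 0 < e) (e1 : e <= 1) (re : 4 * r <= (2 * e)^-1).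

Let r20 : 0 < 2 * r. Proof. by rewrite mulr_gt0. Qed.

Definition coef n : R := e ^+ d * conv f (2 * r) (pt e n).

(** Schur's test between the lattice and R^d: Cauchy-Schwarz with weight |G| bounds each
    coefficient, using the L^1 norm of G, and [gd_lattice_bound] sums the weights over the lattice
    under the integral. *)
Lemma coef_l2b : exists S, l2b coef S.
Proof.
have [M M0 hM] := @gd_lattice_bound R d _ r20; have [W W0 hW] := gd_L1 r20.
have [B hB] := @gd_bounded R d _ r20.
have [mf fi] := Lf.
have iQ n : mu.-integrable setT (EFin \o (fun y => f y ^+ 2 * `|gd (2 * r) (pt e n - y)|)).
  apply: (integrable_bounded (M := B)) => //; last by move=> y; rewrite normr_id.
  by apply: measurableT_comp => //; exact: measurable_gdB.
exists (W * (M * \int[mu]_y (f y ^+ 2))) => F.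
pose q n y := e ^+ d * (f y ^+ 2 * `|gd (2 * r) (pt e n - y)|).
have iq n : mu.-integrable setT (EFin \o q n) by exact: RintegrableZ.
apply: (@le_trans _ _ (\sum_(n <- F) W * \int[mu]_y q n y)).
  apply: ler_sum => n _; rewrite /coef exprMn RintegralZl// [leRHS]mulrCA.
  have [j1 j2] := hW (pt e n).
  have cs := Rintegral_cauchy_schwarz W0 (L2r_mul Lf (L2r_gdB (pt e n) r20)) (iQ n) j1 j2.
  (* One of the two factors e^d is discarded since e <= 1; the other is needed by
     [gd_lattice_bound]. *)
  rewrite expr2 -mulrA ler_wpM2l ?exprn_ge0 ?(ltW e0)//.
  apply: le_trans cs; rewrite ler_piMl ?sqr_ge0//.
  by rewrite exprn_ile1// ltW.
rewrite -mulr_sumr ler_wpM2l ?(ltW W0)//.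
have [k1 k2] := Rintegral_sum_seq (enum_fset F) iq.
rewrite -k2 -RintegralZl//; apply: le_Rintegral => //; first exact: RintegrableZ.
move=> y _; rewrite /q.
rewrite (eq_bigr (fun n => f y ^+ 2 * (e ^+ d * `|gd (2 * r) (pt e n - y)|))).
  by rewrite -mulr_sumr mulrC ler_wpM2r ?sqr_ge0//; exact: hM.
by move=> n _; rewrite mulrCA.
Qed.

(** Integrate [sampling_nd] in y against f. By [gd_pair_bound] the partial sums are at most D P(y)
    with P square integrable, so D |f P| dominates. *)
Lemma coef_interp x : \sum_(n <- boxs d N) coef n * gd r (x - pt e n) @[N --> \oo] --> conv f r x.
Proof.
have [D D0 hD] := @gd_pair_bound R d _ r0; have mf := Lf.1.
pose w n y := e ^+ d * gd (2 * r) (pt e n - y) * gd r (x - pt e n).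
have iw n : mu.-integrable setT (EFin \o (fun y => f y * w n y)).
  rewrite (_ : (fun y => _) = fun y =>
      (e ^+ d * gd r (x - pt e n)) * (f y * gd (2 * r) (pt e n - y))).
    exact: RintegrableZ measurableT (L2r_mul Lf (L2r_gdB (pt e n) r20)).
  by apply/funext => y; rewrite /w; move: (gd (2 * r) _) (gd r _) => a b; ring.
have E N : \sum_(n <- boxs d N) coef n * gd r (x - pt e n) =
    \int[mu]_y (f y * \sum_(n <- boxs d N) w n y).
  under eq_Rintegral do rewrite mulr_sumr.
  rewrite (Rintegral_sum_seq _ iw).2; apply: eq_bigr => n _.
  have ig := L2r_mul Lf (L2r_gdB (pt e n) r20).
  rewrite /coef mulrAC; apply: etrans (esym (RintegralZl _ measurableT ig)) _.
  by apply: eq_Rintegral => y _; rewrite /w mulrCA [in RHS]mulrAC.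
rewrite (_ : (fun N => _) = fun N => \int[mu]_y (f y * \sum_(n <- boxs d N) w n y)); last exact/funext.
pose P y := pd (fun=> @lorentz R) (x - y).
have LP : L2r mu P.
  pose u (i : 'I_d) (t : R) := lorentz (t - x ord0 i).
  have PE : P = pd u.
    apply/funext => y; apply: eq_bigr => i _; rewrite rV_subE /u /lorentz; congr (1 + _)^-1; ring.
  rewrite PE; apply: (L2r_bounded (M := 1)).
    exact: (integrable_pd (fun i => (lorentz_shift_int (x ord0 i)).1)).1.
  move=> y; rewrite pd_normE /pd [leRHS](_ : 1 = \prod_(i < d) 1); last by rewrite big1.
  apply: ler_prod => i _; rewrite normr_ge0 ger0_norm ?lorentz_le1//.
  exact/ltW/lorentz_gt0.
apply: (@Rdominated_convergence_ae _ _ _ mu (fun N y => f y * \sum_(n <- boxs d N) w n y)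
  (fun y => f y * gd r (x - y)) (fun y => D * `|f y * P y|)).
- move=> N.
apply: measurable_funM => //; apply: measurable_bigsum => n.
  apply: measurable_funM => //; apply: measurable_funM => //.
  exact: measurable_gdB.
- by apply: measurable_funM => //; exact: measurable_gdB.
- by apply: aeW => y; apply: cvgM; [exact: cvg_cst|exact: sampling_nd].
- by apply: RintegrableZ => //; exact: (integrable_abse (L2r_mul Lf LP)).
- move=> N y; rewrite !normrM mulrCA ler_wpM2l// (le_trans (ler_norm_sum _ _ _))//.
  by rewrite ger0_norm ?(ltW (pd_lorentz_gt0 _))//; exact: hD.
Qed.

Lemma coef_hsum x : hsum (fun n => coef n * gd r (x - pt e n)) (conv f r x).
Proof.
have [S cS] := coef_l2b; have [M M0 hM] := @gd_lattice_bound R d _ r0.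
have [B hB] := @gd_bounded R d _ r0.
have gl : l2b (fun n => gd r (x - pt e n)) (B * ((e ^+ d)^-1 * M)).
  move=> F; have B0 : 0 <= B by apply: le_trans (hB 0).
  have ed : 0 < e ^+ d by rewrite exprn_gt0.
  apply: le_trans (ler_wpM2l B0 (ler_wpM2l _ (hM e x F e0 e1))); last by rewrite invr_ge0 ltW.
  rewrite -mulr_sumr mulKf ?gt_eqF// mulr_sumr; apply: ler_sum => n _.
  by rewrite -real_normK ?num_real// expr2 gd_subC ler_wpM2r.
by apply: (hsum_of_cvg (l2b_asum cS gl) (@boxs_cover d)); exact: coef_interp.
Qed.

End coefficients.
End expansion.

(** * Expansion over the good points *)

Section good_lattice.
Variables (R : realType) (d : nat) (i0 : 'I_d).
Local Notation mu := (lebesgue_rV R d).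
Local Notation V := 'rV[R]_d.
Local Notation J := {ffun 'I_d -> int}.
Implicit Types (n k : J) (x y z : V) (s r e : R) (F : {fset J}) (i : 'I_d) (f : V -> R).

Definition next n : J := [ffun i => if i == i0 then n i + 1 else n i].
Definition prev n : J := [ffun i => if i == i0 then n i - 1 else n i].

Lemma nextK : cancel next prev.
Proof. by move=> n; apply/ffunP => i; rewrite !ffunE; case: (i == i0); rewrite ?addrK ?subrK. Qed.

Lemma prevK : cancel prev next.
Proof. by move=> n; apply/ffunP => i; rewrite !ffunE; case: (i == i0); rewrite ?addrK ?subrK. Qed.

Lemma pt_next e n : pt e (next n) = pt e n + dlt i0 e.
Proof.
apply/rowP => i; rewrite !mxE ffunE; case: ifP => _; last by rewrite addr0.
by rewrite intrD mulrDr mulr1.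
Qed.

Lemma gd_sampling_hsum e r x y : 0 < e -> e <= 1 -> 0 < r -> 4 * r <= (2 * e)^-1 ->
  hsum (fun k => (e ^+ d * gd (2 * r) (pt e k - y)) * gd r (x - pt e k)) (gd r (x - y)).
Proof.
move=> e0 e1 r0 re; have [D D0 hD] := @gd_pair_bound R d _ r0.
apply: (hsum_of_cvg (M := D * pd (fun=> @lorentz R) (x - y)) _ (@boxs_cover d)).
  by move=> F; exact: hD.
exact: sampling_nd.
Qed.

Lemma gd_lattice_sum e r : 0 < e -> e <= 1 -> 0 < r -> exists2 M : R, 0 < M &
  forall x F, \sum_(n <- F) `|gd r (x - pt e n)| <= M.
Proof.
move=> e0 e1 r0; have [M M0 hM] := @gd_lattice_bound R d _ r0.
have ed : 0 < e ^+ d by rewrite exprn_gt0.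
exists ((e ^+ d)^-1 * M) => [|x F]; first by rewrite mulr_gt0// invr_gt0.
rewrite ler_pdivlMl// mulr_sumr; under eq_bigr do rewrite gd_subC; exact: hM.
Qed.

Lemma gd_lattice_l2b e r : 0 < e -> e <= 1 -> 0 < r -> exists2 M : R, 0 < M &
  forall x, l2b (fun n => gd r (x - pt e n)) M.
Proof.
move=> e0 e1 r0; have [M M0 hM] := gd_lattice_sum e0 e1 r0.
have [B hB] := @gd_bounded R d _ r0; have B0 : 0 <= B by apply: le_trans (hB 0).
exists ((B + 1) * M) => [|x F]; first by rewrite mulr_gt0// ltr_wpDl.
have B1 : 0 <= B + 1 by rewrite addr_ge0.
apply: le_trans (ler_wpM2l B1 (hM x F)).
rewrite mulr_sumr; apply: ler_sum => n _.
by rewrite -real_normK ?num_real// expr2 ler_wpM2r// ler_wpDr.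
Qed.

(** The threshold depends on r and d only. The bad set is given after e because it is defined from
    the lattice of step e. *)
Lemma good_lattice_expansion r : 0 < r -> exists2 e0 : R, 0 < e0 & forall e, 0 < e -> e <= e0 ->
  forall bad : pred J, (forall n, bad n -> ~~ bad (next n)) ->
  forall f, L2r mu f -> exists S (a : J -> R), [/\ l2b a S, forall n, bad n -> a n = 0 &
    forall x, hsum (fun n => a n * gd r (x - pt e n)) (conv f r x)].
Proof.
move=> r0; have r20 : 0 < 2 * r by rewrite mulr_gt0.
have [C C0 hC] := gd_diff_bound i0 r20.
(* The three bounds give e <= 1, the sampling condition 4r <= 1/(2e), and e C <= 1/2; the 1 added to
   C keeps the last one meaningful when C = 0. *)
exists (Num.min 1 (Num.min (8 * r)^-1 (2 * (C + 1))^-1)).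
  by rewrite !lt_min ltr01 !invr_gt0 !mulr_gt0// ltr_wpDl.
move=> e e0; rewrite !le_min => /and3P[e1 er eC] bad bad_next f Lf.
have re : 4 * r <= (2 * e)^-1.
  rewrite -[4 * r]invrK lef_pV2 ?posrE ?invr_gt0 ?mulr_gt0//.
  by rewrite (_ : (4 * r)^-1 = 2 * (8 * r)^-1) ?ler_wpM2l//; field; rewrite gt_eqF.
have eC2 : e * C <= 1 / 2.
  apply: (@le_trans _ _ ((2 * (C + 1))^-1 * (C + 1))).
    by apply: ler_pM => //; [exact: ltW|rewrite lerDl].
  by rewrite [leLHS](_ : _ = 1 / 2)//; field; rewrite gt_eqF// ltr_wpDl.
have [M M0 hM] := gd_lattice_l2b e0 e1 r0.
have [S cS] := coef_l2b Lf r0 e0 e1.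
pose G := gd (2 * r) : V -> R.
(* The difference of the sampling coefficients for the bad point n and for its neighbour. Columns of
   good points are 0, as nothing is moved from there. *)
pose N k n := if bad n then e ^+ d * (G (pt e k - pt e n) - G (pt e k - pt e (next n))) else 0.
pose df n x := if bad n then gd r (x - pt e n) - gd r (x - pt e (next n)) else 0.
have NE k n : `|N k n| <= `|e ^+ d * (G (pt e k - pt e n) - G (pt e k - pt e (next n)))|.
  by rewrite /N; case: ifP => // _; rewrite normr0.
have Ncol n : asum (N^~ n) (1 / 2).
  move=> F; apply: le_trans eC2; apply: le_trans (hC e (pt e n) F e0 e1).
  apply: ler_sum => k _; apply: le_trans (NE k n) _.
  by rewrite pt_next opprD addrA.
(* Since G is even, the roles of k and n can be exchanged, and a row sum becomes the sum of
   [gd_diff_bound] based at [pt e k - dlt i0 e]. *)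
have Nrow k : asum (N k) (1 / 2).
  move=> F; apply: le_trans eC2; apply: le_trans (hC e (pt e k - dlt i0 e) F e0 e1).
  apply: ler_sum => n _; apply: le_trans (NE k n) _.
  rewrite /G gd_subC (gd_subC _ (pt e k)) pt_next.
  rewrite (_ : pt e n - (pt e k - dlt i0 e) = pt e n + dlt i0 e - pt e k); last first.
    by rewrite opprB addrA.
  rewrite (_ : pt e n + _ - _ - dlt i0 e = pt e n - pt e k); last first.
    by rewrite addrAC addrK.
  by rewrite !normrM distrC.
have Ndf n x : hsum (fun k => N k n * gd r (x - pt e k)) (df n x).
  rewrite /N /df; case: (bad n); last first.
    rewrite (_ : (fun k => _) = fun=> 0); last by apply/funext => k; rewrite mul0r.
    exact: hsum0.
  have := hsumB (@gd_sampling_hsum e r x (pt e n) e0 e1 r0 re)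
    (@gd_sampling_hsum e r x (pt e (next n)) e0 e1 r0 re).
  by congr (hsum _ _); apply/funext => k; rewrite mulrBr mulrBl.
have [|a aS [abad ah]] := @synthesis_good R J V N (fun n x => gd r (x - pt e n)) df M
  M0 Nrow Ncol hM Ndf bad next prev nextK prevK bad_next _ _ _ cS; first by [].
by exists (16 * S), a; split=> // x; apply: ah; exact: coef_hsum.
Qed.

End good_lattice.

(** * Tensor products as Schwartz functions *)

Section tensor_schwartz.
Variables (R : realType) (d : nat).
Local Notation V := 'rV[R]_d.
Implicit Types (u : 'I_d -> R -> R) (x : V) (i j : 'I_d) (s : seq 'I_d).

Lemma is_derive_pd u x i (D : R) : is_derive (x ord0 i) (1 : R) (u i) D ->
  is_derive x (delta_mx ord0 i : V) (pd u) (D * \prod_(j | j != i) u j (x ord0 j)).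
Proof.
move=> [du Du]; set Q := \prod_(j | j != i) _.
have h1 : (fun h : R => h^-1 *: ((u i \o shift (x ord0 i)) (h *: (1 : R)) - u i (x ord0 i))) @ 0^' --> D.
  by rewrite -Du; exact: du.
have E : (fun h : R => h^-1 *: ((pd u \o shift x) (h *: (delta_mx ord0 i : V)) - pd u x)) =
    fun h => (h^-1 *: ((u i \o shift (x ord0 i)) (h *: (1 : R)) - u i (x ord0 i))) * Q.
  apply/funext => h; rewrite /pd /= (bigD1 i)//= [X in _ - X](bigD1 i)//= -/Q.
  rewrite [X in _ * X - _](_ : _ = Q); last first.
    apply: eq_bigr => j ji; congr (u j _).
    by rewrite !mxE eqxx (negbTE ji) mulr0 add0r.
  by rewrite !mxE !eqxx -mulrBl scalerAl.
have h2 : (fun h : R => h^-1 *: ((pd u \o shift x) (h *: (delta_mx ord0 i : V)) - pd u x)) @ 0^' --> D * Q.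
  by rewrite E; apply: cvgM => //; exact: cvg_cst.
by apply: DeriveDef; [apply/cvg_ex; eexists; exact: h2|exact: cvg_lim h2].
Qed.

Lemma continuous_pd u : (forall i, continuous (u i)) -> continuous (pd u).
Proof.
move=> cu; suff h (r : seq 'I_d) : continuous (fun y : V => \prod_(i <- r) u i (y ord0 i)) by exact: h.
elim: r => [|i r IH] x.
  rewrite (_ : (fun y : V => _) = fun=> 1); first exact: cst_continuous.
  by apply/funext => y; rewrite big_nil.
rewrite (_ : (fun y : V => _) = fun y : V => u i (y ord0 i) * \prod_(j <- r) u j (y ord0 j)).
  apply: continuousM; last exact: IH.
  apply: (@continuous_comp _ _ _ (fun y : V => y ord0 i) (u i)); last exact: cu.
  exact: coord_continuous.
by apply/funext => y; rewrite big_cons.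
Qed.

(** A partial derivative acts on a single factor, so only the multiplicity of each coordinate in [s]
    counts. *)
Lemma iter_partial_pd u s : (forall i, cinfty (u i)) ->
  iter_partial s (pd u) = pd (fun i => derive1n (count_mem i s) (u i)).
Proof.
move=> cu; elim: s => [//|i s IH] /=; rewrite IH; apply/funext => x.
rewrite /partial_deriv.
have cn n j : cinfty (derive1n n (u j)).
  by elim: n => [|n IHn]; [exact: cu|rewrite derive1nS; have [] := cinfty_derive IHn].
have [D1 _] := cinfty_derive (cn (count_mem i s) i).
have := @is_derive_pd (fun j => derive1n (count_mem j s) (u j)) x i _ (D1 (x ord0 i)).
move=> [_ ->]; rewrite /pd [RHS](bigD1 i)//= eqxx add1n derive1nS; congr (_ * _).
by apply: eq_bigr => j /negbTE ji; rewrite eq_sym ji.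
Qed.

Lemma smooth_pd u : (forall i, cinfty (u i)) -> smooth (pd u).
Proof.
move=> cu s; have cn n j : cinfty (derive1n n (u j)).
  by elim: n => [|n IHn]; [exact: cu|rewrite derive1nS; have [] := cinfty_derive IHn].
rewrite iter_partial_pd//; split=> [|x i].
  by apply: continuous_pd => i; exact: cinfty_continuous.
have [D1 _] := cinfty_derive (cn (count_mem i s) i).
by have [] := @is_derive_pd (fun j => derive1n (count_mem j s) (u j)) x i _ (D1 (x ord0 i)).
Qed.

Lemma rapidly_decreasing_pd u : (forall i, cinfty (u i)) ->
  (forall i k n, exists M : R, forall t, `|t ^+ k * derive1n n (u i) t| <= M) ->
  rapidly_decreasing (pd u).
Proof.
move=> cu hu b s.
pose M i := xget 0 [set M : R | forall t, `|t ^+ b i * derive1n (count_mem i s) (u i) t| <= M].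
have hM i t : `|t ^+ b i * derive1n (count_mem i s) (u i) t| <= M i.
  by move: t; rewrite /M; case: xgetP => [m -> //|h]; have [m hm] := hu i (b i) (count_mem i s); case: (h m).
exists (\prod_i M i) => x; rewrite iter_partial_pd// /pd -big_split/= normr_prod.
by apply: ler_prod => i _; rewrite normr_ge0 hM.
Qed.

Lemma iter_partial0 s : iter_partial s (fun _ : V => 0 : R) = fun=> 0.
Proof.
elim: s => [//|i s IH] /=; rewrite IH; apply/funext => x.
by rewrite /partial_deriv derive_cst.
Qed.

Definition gC (r : R) : V -> R[i] := fun x => ((gd r x)%:C)%C.

Lemma schwartz_gC r : 0 < r -> schwartz (gC r).
Proof.
move=> r0; have cg (i : 'I_d) := cinfty_gs r0; split.
- exact: smooth_pd.
- move=> s; rewrite (_ : (fun x => _) = fun _ : V => 0 : R)// iter_partial0.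
  by split=> [x|x i]; [exact: cst_continuous|exact: derivable_cst].
- apply: rapidly_decreasing_pd => // i k n.
  by have [M _ hM] := gs_schwartz k n r0; exists M.
- move=> b s; exists 0 => x; rewrite (_ : (fun x => _) = fun _ : V => 0 : R)//.
  by rewrite iter_partial0 mulr0 normr0.
Qed.

Lemma fourier_gC r w : 0 < r -> fourier (gC r) w = ((dd r w)%:C)%C.
Proof.
move=> r0.
have ig : cintegrable setT (gC r).
  split; first exact: integrable_gd.
  exact: integrable0.
have [hc hs] := pd_FT (fun _ : 'I_d => integrable_gs1 r0) (fun _ => gs_FTpair r0) w 0.
have [h1 h2] := fourier_phase w ig.
apply/eqP; rewrite eq_complex h1 h2 /=.
have z0 (k : V -> R) : \int[lebesgue_rV R d]_y (0 * k y) = 0.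
  by under eq_Rintegral do rewrite mul0r; rewrite Rintegral_cst ?mul0r.
rewrite !z0 -/(gd r) hc hs (dotr0 w) mulr0 cos0 sin0 mulr1 mulr0 subr0 addr0.
by rewrite !eqxx.
Qed.

Lemma compact_fourier_gC r : 0 < r -> compact (csupport (fourier (gC r))).
Proof.
move=> r0; pose B : set V := [set w | forall i, `[- (2 * r), 2 * r]%classic (w ord0 i)].
have cB : compact B.
  by apply: (@rV_compact R d (fun=> `[- (2 * r), 2 * r]%classic)) => i; exact: segment_compact.
apply: subclosed_compact cB _; first exact: closed_closure.
have clB : closed B.
  rewrite (_ : B = \bigcap_(i in setT) ((fun w : V => w ord0 i) @^-1` `[- (2 * r), 2 * r]%classic)).
    apply: closed_bigI => i _; apply: closed_comp => [w _|]; first exact: coord_continuous.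
    exact: interval_closed.
  by apply/seteqP; split => w /= h i; [move=> _|]; exact: h.
rewrite closure_id in clB; rewrite clB; apply: closureS => w /=.
rewrite fourier_gC// => h i; rewrite /= in_itv/= -ler_norml leNgt; apply/negP => hi.
apply: h; rewrite /dd /pd (bigD1 i)//= dil0 ?mul0r//; exact: ltW.
Qed.

End tensor_schwartz.

(** * Convergence of the expansions *)

Section synthesis_convergence.
Context d (T : measurableType d) (R : realType).
Variable mu : {measure set T -> \bar R}.
Variables (J : choiceType) (h : J -> T -> R) (a : J -> R) (f : T -> R) (B : nat -> {fset J}).
Variables (M M1 W S : R).
Implicit Types (F G : {fset J}) (e : R).

Hypothesis aS : l2b a S.
Hypothesis hM : forall x, l2b (h^~ x) M.
Hypothesis hM1 : forall x, asum (h^~ x) M1.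
Hypothesis ih : forall n, mu.-integrable setT (EFin \o h n).
Hypothesis hW : forall n, \int[mu]_x `|h n x| <= W.
Hypothesis fE : forall x, hsum (fun n => a n * h n x) (f x).
Hypothesis M0 : 0 < M.
Hypothesis W0 : 0 < W.
Hypothesis M10 : 0 < M1.
Hypothesis Bcover : forall F, \forall N \near \oo, (F `<=` B N)%fset.

(** Cauchy-Schwarz on the tail: the l^2 norms of the families h_n(x) are bounded independently of
    x. *)
Lemma synthesis_uniform e : 0 < e -> exists F0, forall F, (F0 `<=` F)%fset ->
  forall x, `|f x - \sum_(n <- F) a n * h n x| <= e.
Proof.
move=> e0; have e1 : 0 < e ^+ 2 / M by rewrite divr_gt0// exprn_gt0.
have [F0 hF] := l2b_tail aS e1; exists F0 => F /hF aF x.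
rewrite -ler_sqr ?nnegrE ?(ltW e0)// real_normK ?num_real//.
have -> : e ^+ 2 = e ^+ 2 / M * M by rewrite divfK// gt_eqF.
apply: (hsum_sqr_le aF (hM x)); have := @hsum_tail _ _ _ _ F (@fE x).
by congr (hsum _ _); apply/funext => k; case: ifP => _; rewrite ?mul0r.
Qed.

(** Fatou reduces the tail to finite sums. For these, Cauchy-Schwarz with weight |h_n(x)| uses the
    bound M1 on sums over n and the bound W on integrals over x, which is Schur's test again and
    explains the constant e/(M1 W). *)
Lemma synthesis_L2 e : 0 < e -> exists F0, forall F, (F0 `<=` F)%fset ->
  (\int[mu]_x ((f x - \sum_(n <- F) a n * h n x) ^+ 2)%:E <= e%:E)%E.
Proof.
move=> e0; have e1 : 0 < e / (M1 * W) by rewrite divr_gt0// mulr_gt0.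
have [F0 hF] := l2b_tail aS e1; exists F0 => F /hF aF.
pose b k := if k \in F then 0 else a k.
have mh n : measurable_fun setT (h n) by exact: integrable_mfun (ih n).
have iabs n : mu.-integrable setT (EFin \o (fun x => `|h n x|)) by exact: integrable_abse (ih n).
apply: (@fatou_le _ _ _ mu (fun m x => (\sum_(k <- B m) b k * h k x) ^+ 2)).
- by move=> m; apply: measurable_funX; apply: measurable_bigsum => k; exact: measurable_funM.
- by move=> m x; exact: sqr_ge0.
- move=> x; have : \sum_(k <- B m) b k * h k x @[m --> \oo] --> f x - \sum_(n <- F) a n * h n x.
    apply: hsum_cvg => //; have := @hsum_tail _ _ _ _ F (@fE x).
    by congr (hsum _ _); apply/funext => k; rewrite /b; case: ifP => _; rewrite ?mul0r.
  by move=> hb; apply: cvgM.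
move=> m; pose q k x := b k ^+ 2 * `|h k x|.
have iq k : mu.-integrable setT (EFin \o q k) by exact: RintegrableZ.
have [j1 j2] := Rintegral_sum_seq (enum_fset (B m)) iq.
have i1 := RintegrableZ M1 measurableT j1.
apply: (@le_trans _ _ (\int[mu]_x (M1 * \sum_(k <- B m) q k x)%:E)%E).
  apply: ge0_le_integral => //.
  - by move=> x _; rewrite lee_fin sqr_ge0.
  - apply/measurable_EFinP; apply: measurable_funX; apply: measurable_bigsum => k.
    exact: measurable_funM.
  - exact: measurable_int i1.
  move=> x _; rewrite lee_fin; under eq_bigr do rewrite mulrC.
  apply: le_trans (cauchy_schwarz_weight _ _ _ _) _.
  rewrite [X in _ * X <= _](eq_bigr (fun k => q k x)) => [|k _]; last by rewrite /q mulrC.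
  apply: ler_wpM2r; last exact: hM1.
  by apply: sumr_ge0 => k _; rewrite mulr_ge0// sqr_ge0.
have fin := integrable_fin_num measurableT i1.
rewrite -[leLHS]fineK// lee_fin.
have -> : fine (\int[mu]_x (M1 * \sum_(k <- B m) q k x)%:E) =
    M1 * \sum_(k <- B m) \int[mu]_x q k x by rewrite -j2 -RintegralZl.
have : \sum_(k <- B m) \int[mu]_x q k x <= e / (M1 * W) * W.
  apply: (@le_trans _ _ ((\sum_(k <- B m) b k ^+ 2) * W)); last first.
    by apply: ler_wpM2r; [exact: ltW|exact: aF].
  rewrite mulr_suml; apply: ler_sum => k _.
  by rewrite RintegralZl// ler_wpM2l ?sqr_ge0.
move/(ler_wpM2l (ltW M10))/le_trans; apply.
by rewrite le_eqVlt; apply/orP; left; apply/eqP; field; rewrite !gt_eqF.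
Qed.

End synthesis_convergence.

(** * Separated sequences and coordinate bounds *)

Section geometry.
Variables (R : realType) (d : nat).
Local Notation V := 'rV[R]_d.
Implicit Types (x y : V) (i : 'I_d).

Lemma enorm_ge_coord x i : `|x ord0 i| <= enorm x.
Proof.
rewrite /enorm -[leLHS]ger0_norm// -sqrtr_sqr; apply: ler_wsqrtr.
rewrite real_normK ?num_real// /dotr (bigD1 i)//= -expr2 lerDl.
by apply: sumr_ge0 => j _; rewrite -expr2 sqr_ge0.
Qed.

Lemma enorm_lt x (c dl : R) : 0 <= c -> 0 < dl -> d%:R * c ^+ 2 < dl ^+ 2 ->
  (forall i, `|x ord0 i| <= c) -> enorm x < dl.
Proof.
move=> c0 dl0 cd xc; rewrite -(ger0_norm (ltW dl0)) -sqrtr_sqr /enorm ltr_sqrt ?exprn_gt0//.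
apply: le_lt_trans cd; rewrite -[d in leRHS]card_ord -sum1_card natr_sum mulr_suml.
apply: ler_sum => i _; rewrite mul1r -expr2 -real_normK ?num_real//.
by rewrite ler_sqr ?nnegrE.
Qed.

Lemma separated_seqP (K : Type) (l : K -> V) : separated_seq l <->
  exists2 dl : R, 0 < dl & forall k k', k <> k' -> dl <= enorm (l k - l k').
Proof.
rewrite /separated_seq; set A := [set _ | _ in _]; split=> [h|[dl dl0 h]].
  have AP k k' : k <> k' -> (ereal_inf A <= (enorm (l k - l k'))%:E)%E.
    by move=> kk'; apply: ereal_inf_lbound; exists (k, k').
  (* If the infimum is infinite there are no two distinct indices, and any positive constant will
     do. *)
  move: h AP; case: (ereal_inf A) => [r|_|//]; last first.
    by move=> AP; exists 1 => // k k' /AP; rewrite leye_eq.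
  by rewrite lte_fin => r0 AP; exists r => // k k' /AP; rewrite lee_fin.
apply: (@lt_le_trans _ _ dl%:E); first by rewrite lte_fin.
by apply: le_ereal_inf_tmp => _ [[k k'] /= kk' <-]; rewrite lee_fin; exact: h.
Qed.

Lemma bounded_coord (E : set V) : bounded_set E ->
  exists2 r : R, 0 < r & forall w, E w -> forall i, `|w ord0 i| <= r.
Proof.
move=> [M [Mreal hM]]; have hM' : M < `|M| + 1 by rewrite ltr_pwDr// ler_norm.
exists (`|M| + 1) => [|w Ew i]; first by rewrite ltr_wpDl.
apply: le_trans (hM _ hM' w Ew).
have /mapP[j Hj ->] : `|w ord0 i| \in [seq `|w x.1 x.2| | x : 'I_1 * 'I_d].
  by apply/mapP; exists (ord0, i) => //=; rewrite mem_enum.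
by rewrite [leRHS]/Num.norm /= mx_normrE; apply/bigmax_geP; right => /=; exists j.
Qed.

End geometry.

(** * The extended sequence *)

Section transfer.
Variables (K J : countType) (bad : pred J).
Local Notation good := {n : J | ~~ bad n}.

Definition extend0 (Z : zmodType) (phi : J -> Z) (k : K + good) : Z :=
  match k with inl _ => 0 | inr n => phi (val n) end.

(** Transfers limits over finite sets of lattice indices to the extended index set. One F serves all
    [phi] in all groups, as it is used for complex sums and for the real sums of squares. *)
Lemma extend0_sum (n0 : J) (F0 : {fset J}) : exists F0' : {fset K + good}, forall F' : {fset K + good},
  (F0' `<=` F')%fset -> exists2 F : {fset J}, (F0 `<=` F)%fset &
    forall (Z : zmodType) (phi : J -> Z), (forall n, bad n -> phi n = 0) ->
      \sum_(k <- F') extend0 phi k = \sum_(n <- F) phi n.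
Proof.
pose is_good (k : K + good) := if k is inr _ then true else false.
(* [n0] is a dummy value: [proj] is only applied to elements coming from the lattice. *)
pose proj (k : K + good) : J := if k is inr n then val n else n0.
exists [fset k in pmap (fun n : J => omap (@inr K good) (insub n)) (enum_fset F0)]%fset => F' F0F'.
(* The bad elements of F0 are added by hand so that F contains F0; [phi] vanishes on them. *)
exists ([fset proj k | k in [fset k in F' | is_good k]] `|` [fset n in F0 | bad n])%fset.
  apply/fsubsetP => n nF0; rewrite !inE nF0 /=.
  case: (boolP (bad n)) => bn; rewrite ?orbT// orbF.
  apply/imfsetP; exists (inr (Sub n bn : good)) => //=.
  rewrite !inE /= andbT; apply: (fsubsetP F0F'); rewrite !inE mem_pmap.
  by apply/mapP; exists n => //; rewrite insubT.
move=> Z phi phi0.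
rewrite (bigID is_good)/= [X in _ + X]big1 ?addr0; last by case.
rewrite big_fset_condE/=.
rewrite -(big_fset_incl _ (fsubsetUl _ _)); last first.
  by move=> n; rewrite inE => /orP[-> //|]; rewrite !inE => /andP[_ bn] _; exact: phi0.
rewrite [RHS]big_imfset/=; last first.
  move=> [k|k] [l|l]; rewrite !inE /= ?andbF// => _ _ h.
  by congr inr; exact: val_inj.
by rewrite big_seq [RHS]big_seq; apply: eq_bigr => -[k|k]; rewrite !inE /= ?andbF.
Qed.

End transfer.

(** * Complex sums through real and imaginary parts *)

Section complex_sums.
Variable R : realType.
#[local] Existing Instance totally_filter.

Lemma Re_sum (I : Type) (s : seq I) (u : I -> R[i]) :
  complex.Re (\sum_(k <- s) u k) = \sum_(k <- s) complex.Re (u k).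
Proof.
elim: s => [|k s IH]; first by rewrite !big_nil.
by rewrite !big_cons -IH; case: (u k) => a b; case: (\sum_(j <- s) u j).
Qed.

Lemma Im_sum (I : Type) (s : seq I) (u : I -> R[i]) :
  complex.Im (\sum_(k <- s) u k) = \sum_(k <- s) complex.Im (u k).
Proof.
elim: s => [|k s IH]; first by rewrite !big_nil.
by rewrite !big_cons -IH; case: (u k) => a b; case: (\sum_(j <- s) u j).
Qed.

Lemma absc_le (z : R[i]) : absc z <= `|complex.Re z| + `|complex.Im z|.
Proof.
rewrite -ler_sqr ?nnegrE ?addr_ge0//; last first.
  by case: z => a b; exact: sqrtr_ge0.
rewrite absc2 -[complex.Re z ^+ 2]real_normK ?num_real// -[complex.Im z ^+ 2]real_normK ?num_real//.
have := mulr_ge0 (normr_ge0 (complex.Re z)) (normr_ge0 (complex.Im z)); nra.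
Qed.

Lemma cvg0_totally (K : choiceType) (u : {fset K} -> \bar R) : (forall F, (0 <= u F)%E) ->
  (forall e : R, 0 < e -> exists F0, forall F, (F0 `<=` F)%fset -> (u F <= e%:E)%E) ->
  u @ @totally K --> 0%E.
Proof.
move=> u0 h; have fin : \forall F \near @totally K, u F \is a fin_num.
  have [F0 hF] := h 1 ltr01; apply/near_totallyP; exists F0 => F /hF uF.
  by rewrite ge0_fin_numE//; exact: le_lt_trans uF (ltry _).
apply/fine_cvgP; split=> //.
apply/cvgrPdist_le => e e0; have [F0 hF] := h e e0.
apply/near_totallyP; exists F0 => F /hF uF /=.
rewrite sub0r normrN ger0_norm; last by rewrite fine_ge0.
rewrite -lee_fin fineK// ge0_fin_numE//; exact: le_lt_trans uF (ltry _).
Qed.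

Lemma ell2_bound (K : countType) (a : K -> R[i]) (S : R) :
  (forall F : {fset K}, \sum_(k <- F) absc (a k) ^+ 2 <= S) -> ell2 a.
Proof.
move=> h; apply: (@le_lt_trans _ _ S%:E); last exact: ltry.
apply: ge_ereal_sup => _ [A [fA _] <-].
by rewrite fsbig_finite//= sumEFin lee_fin; exact: h.
Qed.

End complex_sums.

(** * Convergence of the lattice series *)

Section lattice_synthesis.
Variables (R : realType) (d : nat).
Local Notation mu := (lebesgue_rV R d).
Local Notation V := 'rV[R]_d.
Local Notation J := {ffun 'I_d -> int}.
Variables (e r : R) (a : J -> R) (S : R) (f F0 : V -> R).
Hypotheses (e0 : 0 < e) (e1 : e <= 1) (r0 : 0 < r) (aS : l2b a S).
Hypothesis aF0 : forall x, hsum (fun n => a n * gd r (x - pt e n)) (F0 x).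

Lemma lattice_synthesis_uniform (c : R) : 0 < c -> exists F1 : {fset J}, forall F, (F1 `<=` F)%fset ->
  forall x, `|F0 x - \sum_(n <- F) a n * gd r (x - pt e n)| <= c.
Proof.
move=> c0; have [M M0 hM] := @gd_lattice_l2b R d _ _ e0 e1 r0.
exact: (synthesis_uniform aS hM (@aF0) M0 c0).
Qed.

Lemma lattice_synthesis_L2 (c : R) : measurable_fun setT f -> {ae mu, forall x, F0 x = f x} ->
  0 < c -> exists F1 : {fset J}, forall F, (F1 `<=` F)%fset ->
  (\int[mu]_x ((f x - \sum_(n <- F) a n * gd r (x - pt e n)) ^+ 2)%:E <= c%:E)%E.
Proof.
move=> mf fF0 c0; have [M M0 hM] := @gd_lattice_sum R d _ _ e0 e1 r0.
have [W W0 hW] := @gd_L1 R d _ r0.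
have E (n : J) : (fun x => gd r (x - pt e n)) = (fun x => gd r (pt e n - x)).
  by apply/funext => x; rewrite gd_subC.
have ig (n : J) : mu.-integrable setT (EFin \o (fun x => gd r (x - pt e n))).
  by rewrite E; exact: integrable_gdB.
have mg (n : J) : measurable_fun setT (fun x : V => gd r (x - pt e n)) by exact: integrable_mfun (ig n).
have iW (n : J) : \int[mu]_x `|gd r (x - pt e n)| <= W.
  by under eq_Rintegral do rewrite gd_subC; exact: (hW (pt e n)).2.
have [F1 hF] := @synthesis_L2 _ _ R mu J (fun n x => gd r (x - pt e n)) a F0 (@boxs d)
  M W S aS hM ig iW aF0 W0 M0 (@boxs_cover d) c c0.
have mF0 : measurable_fun setT F0.
  have m1 N : measurable_fun setT (fun x : V => \sum_(n <- boxs d N) a n * gd r (x - pt e n)).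
    by apply: measurable_bigsum => n; exact: measurable_funM.
  have m2 (x : V) : setT x -> \sum_(n <- boxs d N) a n * gd r (x - pt e n) @[N --> \oo] --> F0 x.
    by move=> _; exact: (hsum_cvg (@aF0 x) (@boxs_cover d)).
  exact: (measurable_fun_cvg m1 m2).
exists F1 => F /hF; apply: le_trans; rewrite le_eqVlt; apply/orP; left; apply/eqP.
have ms : measurable_fun setT (fun x : V => \sum_(n <- F) a n * gd r (x - pt e n)).
  by apply: measurable_bigsum => n; exact: measurable_funM.
apply: ae_eq_integral => //.
- by apply/measurable_EFinP; apply: measurable_funX; exact: measurable_funB.
- by apply/measurable_EFinP; apply: measurable_funX; exact: measurable_funB.
- by apply: filterS fF0 => x -> _.
Qed.

End lattice_synthesis.

(** * Bad points and assembly of the proof *)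

Section main_steps.
Variables (R : realType) (d : nat).
Local Notation mu := (lebesgue_rV R d).
Local Notation V := 'rV[R]_d.
Local Notation J := {ffun 'I_d -> int}.

Section separation.
Variables (K : countType) (l : K -> V) (e dl : R) (i0 : 'I_d).
Hypotheses (e0 : 0 < e) (dl0 : 0 < dl) (ed : 2 * d%:R * e <= dl).
Hypothesis sep : forall k k', k <> k' -> dl <= enorm (l k - l k').

(** Closeness is measured coordinatewise: its negation yields one large coordinate, hence a lower
    bound for the Euclidean distance. *)
Definition bad_pt : pred J := fun n =>
  `[< exists k, forall i, `|(l k - pt e n) ord0 i| < e / 4 >].

(** One [l k] cannot be within e/4 of two points that differ by e in coordinate i0. Two distinct
    ones would differ by at most e + 2(e/4) = 3e/2 in each coordinate, hence by less than 2 d e <=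
    dl in norm. *)
Lemma bad_next n : bad_pt n -> ~~ bad_pt (next i0 n).
Proof.
move=> /asboolP[k hk]; apply/asboolP => -[k' hk'].
have E i : (pt e (next i0 n) - pt e n) ord0 i = if i == i0 then e else 0.
  by rewrite pt_next addrAC subrr add0r mxE.
have D i : (l k - l k') ord0 i = (l k - pt e n) ord0 i -
    (pt e (next i0 n) - pt e n) ord0 i - (l k' - pt e (next i0 n)) ord0 i.
  by rewrite !rV_subE; ring.
have [kk|kk] := pselect (k = k').
  have := D i0; rewrite kk subrr mxE E eqxx => h.
  have := hk i0; have := hk' i0; rewrite -kk in h *; rewrite !ltr_norml => /andP[h1 h1'] /andP[h2 h3].
  move: ((l k - pt e n) ord0 i0) ((l k - pt e (next i0 n)) ord0 i0) h h1 h1' h2 h3 => A B; lra.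
have := sep kk; apply/negP; rewrite -ltNge.
have d0 : (0 < d)%N by exact: leq_ltn_trans (ltn_ord i0).
have d1 : 1 <= d%:R :> R by rewrite ler1n.
apply: (@enorm_lt _ _ _ (3 / 2 * e)) => // [||i].
- by rewrite mulr_ge0// ltW.
- apply: (@lt_le_trans _ _ ((2 * d%:R * e) ^+ 2)); last first.
    by rewrite ler_sqr ?nnegrE ?mulr_ge0// ?ltW.
  by have := exprn_gt0 2 e0; rewrite !exprMn; nra.
- have := hk i; have := hk' i; rewrite D E !ltr_norml => /andP[h1 h2] /andP[h3 h4].
  by rewrite ler_norml; case: ifP => _; apply/andP; split; lra.
Qed.

Local Notation good := {n : J | ~~ bad_pt n}.

Definition ext_seq (k : K + good) : V :=
  match k with inl k => l k | inr n => pt e (val n) end.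

Lemma good_far k (n : good) : e / 4 <= enorm (l k - pt e (val n)).
Proof.
have /asboolPn/forallNP/(_ k)/existsNP[i hi] := valP n.
by apply: le_trans (enorm_ge_coord _ i); rewrite leNgt; apply/negP.
Qed.

Lemma enormN (x : V) : enorm (- x) = enorm x.
Proof. by rewrite /enorm /dotr; congr Num.sqrt; apply: eq_bigr => i _; rewrite !mxE mulrNN. Qed.

Lemma separated_ext : separated_seq ext_seq.
Proof.
apply/separated_seqP; exists (Num.min dl (e / 4)); first by rewrite lt_min dl0/= divr_gt0.
case=> [k|n] [k'|n'] kk /=; rewrite ge_min.
- by rewrite sep// => h; apply: kk; rewrite h.
- by rewrite good_far orbT.
- by rewrite -enormN opprB good_far orbT.
apply/orP; right.
have [i hi] : exists i, val n i != val n' i.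
  apply/existsP; rewrite -negb_forall; apply/negP => /forallP h; apply: kk; congr inr.
  by apply: val_inj; apply/ffunP => i; exact/eqP.
apply: le_trans (enorm_ge_coord _ i); rewrite rV_subE !mxE -mulrBr -intrB normrM (gtr0_norm e0).
apply: ler_wpM2l; first exact: ltW.
rewrite -[4^-1]mulr1; apply: (@le_trans _ _ 1); first by rewrite mulr1 invf_le1// ler1n.
by rewrite -intr_norm -[1]/(1%:~R) ler_int -gtz0_ge1 normr_gt0 subr_eq0.
Qed.

End separation.

(** Real and imaginary parts are expanded separately. The function f0 is f * g: uniform convergence
    concerns every point, whereas f is determined only almost everywhere. *)
Lemma bandlimited_lattice_expansion (E : set V) (K : countType) (l : K -> V) (e r : R)
    (bad : pred J) (f : V -> R[i]) (lat : K + {n : J | ~~ bad n} -> V) :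
  0 < e -> e <= 1 -> 0 < r -> (forall w, E w -> forall i, `|w ord0 i| <= r) ->
  (forall n, lat (inr n) = pt e (val n)) ->
  (forall f : V -> R, L2r mu f -> exists S (a : J -> R), [/\ l2b a S, forall n, bad n -> a n = 0 &
    forall x, hsum (fun n => a n * gd r (x - pt e n)) (conv f r x)]) ->
  bandlimited E f ->
  exists (a : K + {n : J | ~~ bad n} -> R[i]) (f0 : V -> R[i]),
    [/\ ell2 a, {ae mu, forall x, f0 x = f x},
        uncond_unif_cvg (fun k x => a k * gC r (x - lat k)) f0 &
        uncond_L2_cvg (fun k x => a k * gC r (x - lat k)) f].
Proof.
move=> e0 e1 r0 Er latE H bf; have [h [L2f _ _] _] := bf.
have [L1 L2] := L2_parts L2f.
pose f1 x := complex.Re (f x); pose f2 x := complex.Im (f x).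
have conv1 s x (rs : r <= s) : conv f1 s x = conv f1 r x := (bandlimited_conv x r0 rs Er bf).1.
have ae1 : {ae mu, forall x, conv f1 r x = f1 x} := approx_identity L1 r0 conv1.
have conv2 s x (rs : r <= s) : conv f2 s x = conv f2 r x := (bandlimited_conv x r0 rs Er bf).2.
have ae2 : {ae mu, forall x, conv f2 r x = f2 x} := approx_identity L2 r0 conv2.
have [S1 [a1 [aS1 bad1 sum1]]] := H _ L1.
have [S2 [a2 [aS2 bad2 sum2]]] := H _ L2.
pose al n : R[i] := (a1 n +i* a2 n)%C.
have al0 n : bad n -> al n = 0 by move=> bn; rewrite /al bad1// bad2.
pose a := extend0 (K := K) (bad := bad) al.
pose f0 x : R[i] := (conv f1 r x +i* conv f2 r x)%C.
pose n0 : J := [ffun=> 0].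
have psum (F' : {fset K + {n : J | ~~ bad n}}) (F : {fset J}) x :
    (forall (Z : zmodType) (phi : J -> Z), (forall n, bad n -> phi n = 0) ->
      \sum_(k <- F') extend0 phi k = \sum_(n <- F) phi n) ->
    partial_sum (fun k => a k * gC r (x - lat k)) F' = \sum_(n <- F) al n * gC r (x - pt e n).
  move=> hF; rewrite partial_sumE -hF => [|n /al0 ->]; last exact: mul0r.
  by apply: eq_bigr => -[k|n] _ /=; [exact: mul0r|rewrite latE].
have ReE (F : {fset J}) x : complex.Re (\sum_(n <- F) al n * gC r (x - pt e n)) =
    \sum_(n <- F) a1 n * gd r (x - pt e n).
  by rewrite Re_sum; apply: eq_bigr => n _ /=; rewrite mulr0 subr0.
have ImE (F : {fset J}) x : complex.Im (\sum_(n <- F) al n * gC r (x - pt e n)) =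
    \sum_(n <- F) a2 n * gd r (x - pt e n).
  by rewrite Im_sum; apply: eq_bigr => n _ /=; rewrite mulr0 add0r.
have mg n : measurable_fun setT (fun x : V => gd r (x - pt e n)).
  by under eq_fun do rewrite gd_subC; exact: measurable_gdB.
exists a, f0; split.
- apply: (@ell2_bound _ _ _ (S1 + S2)) => F'.
  have [F0' hF0] := @extend0_sum K J bad n0 fset0.
  (* [extend0_sum] speaks of large finite sets, so F' is enlarged first; the terms are
     nonnegative. *)
  have [F _ hF] := hF0 (F0' `|` F')%fset (fsubsetUl _ _).
  apply: (@le_trans _ _ (\sum_(k <- (F0' `|` F')%fset) absc (a k) ^+ 2)).
    by apply: le_fsum; [move=> k; exact: sqr_ge0|exact: fsubsetUr].
  have absc0 : absc (0 : R[i]) ^+ 2 = 0 by rewrite absc2 /= expr0n addr0.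
  rewrite (eq_bigr (extend0 (fun n => absc (al n) ^+ 2))); last first.
    by case=> [k|n] _ //=.
  rewrite hF => [|n /al0 -> //]; under eq_bigr do rewrite absc2/=.
  by rewrite big_split/= lerD.
- apply: filterS2 ae1 ae2 => x h1 h2; rewrite /f0 h1 h2 /f1 /f2.
  by case: (f x).
- move=> c c0; have c2 : 0 < c / 2 by rewrite divr_gt0.
  have [F1 h1] := lattice_synthesis_uniform e0 e1 r0 aS1 sum1 c2.
  have [F2 h2] := lattice_synthesis_uniform e0 e1 r0 aS2 sum2 c2.
  have [F0' hF0] := @extend0_sum K J bad n0 (F1 `|` F2)%fset.
  apply/near_totallyP; exists F0' => F' /hF0[F FF hF] x.
  rewrite (psum _ _ x hF).
  apply: le_trans (absc_le _) _; rewrite ReB ImB ReE ImE /=.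
  have := h1 F (fsubset_trans (fsubsetUl _ _) FF) x.
  have := h2 F (fsubset_trans (fsubsetUr _ _) FF) x; lra.
- apply: cvg0_totally => [F'|c c0].
    by apply: integral_ge0 => x _; rewrite lee_fin sqr_ge0.
  have c2 : 0 < c / 2 by rewrite divr_gt0.
  have [F1 h1] := lattice_synthesis_L2 e0 e1 r0 aS1 sum1 L1.1 ae1 c2.
  have [F2 h2] := lattice_synthesis_L2 e0 e1 r0 aS2 sum2 L2.1 ae2 c2.
  have [F0' hF0] := @extend0_sum K J bad n0 (F1 `|` F2)%fset.
  exists F0' => F' /hF0[F FF hF].
  have {}h1 := h1 F (fsubset_trans (fsubsetUl _ _) FF).
  have {}h2 := h2 F (fsubset_trans (fsubsetUr _ _) FF).
  rewrite /sqnormL2 (_ : (fun x => _) = fun x =>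
      (((f1 x - \sum_(n <- F) a1 n * gd r (x - pt e n)) ^+ 2)%:E +
       ((f2 x - \sum_(n <- F) a2 n * gd r (x - pt e n)) ^+ 2)%:E)%E); last first.
    apply/funext => x; rewrite (psum _ _ x hF).
    by rewrite absc2 ReB ImB ReE ImE EFinD.
  have ms (b : J -> R) : measurable_fun setT (fun x : V => \sum_(n <- F) b n * gd r (x - pt e n)).
    by apply: measurable_bigsum => n; exact: measurable_funM.
  rewrite ge0_integralD//=.
  + by rewrite (splitr c) EFinD leeD.
  + by move=> x _; rewrite lee_fin sqr_ge0.
  + by apply/measurable_EFinP; apply: measurable_funX; apply: measurable_funB; [exact: L1.1|].
  + by move=> x _; rewrite lee_fin sqr_ge0.
  + by apply/measurable_EFinP; apply: measurable_funX; apply: measurable_funB; [exact: L2.1|].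
Qed.

End main_steps.

Theorem theorem4p3 (R : realType) (d : nat) (E : set 'rV[R]_d)
    (K : countType) (lam : K -> 'rV[R]_d) :
  (0 < d)%N ->
  open E -> bounded_set E ->
  separated_seq lam ->
  frameL2 E (fun k x => expo (lam k) x * indicc E x) ->
  exists (K' : countType) (lam' : K' -> 'rV[R]_d) (g : 'rV[R]_d -> R[i]),
    [/\ separated_seq lam',
        range lam `<=` range lam',
        schwartz g,
        compact (csupport (fourier g)) &
        forall f : 'rV[R]_d -> R[i], bandlimited E f ->
          exists (a : K' -> R[i]) (f0 : 'rV[R]_d -> R[i]),
            [/\ ell2 a,
                {ae lebesgue_rV R d, forall x, f0 x = f x},
                uncond_unif_cvg (fun k x => a k * g (x - lam' k)) f0 &
                uncond_L2_cvg (fun k x => a k * g (x - lam' k)) f]].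
Proof.
move=> d0 _ bE sep _.
have [r r0 Er] := bounded_coord bE.
have /separated_seqP[dl dl0 hdl] := sep.
pose i0 : 'I_d := Ordinal d0.
have [e0 e00 he] := @good_lattice_expansion R d i0 r r0.
have dn : 0 < 2 * d%:R :> R by rewrite mulr_gt0// ltr0n.
(* The bound by dl/(2d) is the condition under which [bad_next] excludes two distinct points of
   Lambda. *)
pose e := Num.min 1 (Num.min e0 (dl / (2 * d%:R))).
have e_gt0 : 0 < e by rewrite !lt_min ltr01 e00/= divr_gt0.
have /and3P[e1 ee0 ed] : [&& e <= 1, e <= e0 & e <= dl / (2 * d%:R)].
  by rewrite /e !ge_min !lexx !orbT.
have ed' : 2 * d%:R * e <= dl by rewrite mulrC -ler_pdivlMr.
pose bad := bad_pt lam e.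
have bn := @bad_next R d K lam e dl i0 e_gt0 dl0 ed' hdl.
exists (K + {n : {ffun 'I_d -> int} | ~~ bad n})%type, (ext_seq (l := lam) (e := e)), (gC r).
split.
- exact: (separated_ext e_gt0 dl0 hdl).
- by move=> _ [k _ <-]; exists (inl k).
- exact: schwartz_gC.
- exact: compact_fourier_gC.
move=> f bf; apply: (@bandlimited_lattice_expansion R d E K lam e r bad f _) => //.
exact: he.
Qed.
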